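(* Let $C \subset \mathbb{P}^2$ be a smooth plane curve of degree $d \ge 4$ over $K$. Let $n \ge 4$, and let $P_1, P_2 \in \mathbb{P}^2 \setminus C$ be different quasi-Galois points with $|G[P_1]|=|G[P_2]|=n$. Let $\ell=\overline{P_1P_2}$. Then there exists a point $P_1' \in \ell$ such that $(P_1, P_1')$ is a $G$-pair with respect to $n$. Furthermore, the following hold. (1) If $n \ge 6$, then $\delta'[\ge n]=3$, and each two of the three quasi-Galois points in $\Delta'_{\ge n}$ form a $G$-pair. Furthermore, $\delta'[\ge 3]=\delta'[\ge n]=3$. (2) If $n=5$, then $\#(\Delta_5' \cap \ell)=2$ or $12$. Furthermore, if $\#(\Delta_5' \cap \ell)=12$, then $\#(\Delta_{\ge 5}' \cap (\mathbb{P}^2 \setminus \ell))=\#(\Delta_{\ge 10}' \cap (\mathbb{P}^2 \setminus \ell))=1$. In particular, $\delta'[5]=2, 3$ or $12$. (3) If $n=4$, then $\#(\Delta_4' \cap \ell)=2$ or $6$. Furthermore, if $\#(\Delta_4' \cap \ell)=6$, then $\#(\Delta_{\ge 4}' \cap (\mathbb{P}^2 \setminus \ell))=1$. In particular, $\delta'[4]=2, 3, 6$ or $7$.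
   Context: $K$ is an algebraically closed field of characteristic zero. For a point $P \in \mathbb{P}^2$, $\pi_P : C \dashrightarrow \mathbb{P}^1$ denotes the projection from $P$, $Q \mapsto \overline{PQ}$, and $G[P]$ denotes the group of all birational transformations $\sigma$ of $C$ preserving the fibers of $\pi_P$ (i.e. $\pi_P\circ\sigma=\pi_P$); it is a cyclic group. A point $P$ is called quasi-Galois if $|G[P]| \ge 2$. Every automorphism of $C$ is the restriction of a unique linear transformation of $\mathbb{P}^2$, so elements of $G[P]$ act on $\mathbb{P}^2$. $\Delta'_m$ (resp. $\Delta'_{\ge m}$) denotes the set of quasi-Galois points $P \in \mathbb{P}^2\setminus C$ with $|G[P]|=m$ (resp. $|G[P]| \ge m$), and $\delta'[m]$ (resp. $\delta'[\ge m]$) denotes its cardinality. For $n \ge 2$, let $P \ne P'$ be points of $\mathbb{P}^2 \setminus C$ such that $|G[P]|$ and $|G[P']|$ are divisible by $n$. The pair $(P,P')$ is a $G$-pair with respect to $n$ if $\sigma(P')=P'$ and $\sigma'(P)=P$ for generators $\sigma \in G[P]$ and $\sigma' \in G[P']$ (this does not depend on the choice of generators). *)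

(* Defs.v *)
From HB Require Import structures.
From mathcomp Require Import all_boot all_algebra.
From mathcomp Require Import mpoly.
From mathcomp Require Export classical_sets cardinality.

Set Implicit Arguments.
Unset Strict Implicit.
Unset Printing Implicit Defensive.

Import GRing.Theory.
Local Open Scope ring_scope.
Local Open Scope classical_set_scope.

(* The projective plane over K is the set of lines through the origin of K^3,
   so that Leibniz equality of points is equality in P^2. *)
Record proj_point (K : fieldType) := Point {
  point_space :> {vspace 'rV[K]_3};
  _ : \dim point_space == 1%N
}.
HB.instance Definition _ (K : fieldType) := [isSub for @point_space K].
HB.instance Definition _ (K : fieldType) := [Choice of proj_point K by <:].

(* The line through P and Q when P <> Q. *)
Definition line_through (K : fieldType) (P Q : proj_point K) : set (proj_point K) :=
  [set R : proj_point K | (R <= P + Q)%VS].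

(* A plane curve C is given by a form F in three variables; F.@[v 0] is the
   value of F at the coordinates of the row vector v. *)
Section Curve.
Variables (K : fieldType) (F : {mpoly K[3]}).

Definition on_curve (P : proj_point K) : Prop :=
  forall v : 'rV[K]_3, v \in (P : {vspace 'rV[K]_3}) -> F.@[v 0] = 0.

Definition smooth_plane_curve (d : nat) : Prop :=
  [/\ F \is d.-homog, F != 0
    & forall v : 'rV[K]_3, v != 0 -> F.@[v 0] = 0 ->
        exists i : 'I_3, (F^`M(i)).@[v 0] != 0].

(* A rational map C --> P^2 is represented by a triple of forms of the same
   degree that do not all vanish identically on C. *)
Definition triple := 3.-tuple {mpoly K[3]}.

Definition ev (A : triple) (v : 'rV[K]_3) : 'rV[K]_3 :=
  \row_i (tnth A i).@[v 0].

Definition ratmap (A : triple) : Prop :=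
  (exists e : nat, forall i, tnth A i \is e.-homog) /\
  (exists2 v : 'rV[K]_3, F.@[v 0] = 0 & ev A v != 0).

Definition same_ratmap (A B : triple) : Prop :=
  [/\ ratmap A, ratmap B
    & forall v : 'rV[K]_3, F.@[v 0] = 0 ->
        forall i j, ev A v 0 i * ev B v 0 j = ev A v 0 j * ev B v 0 i].

Definition ratmap_class (A : triple) : set triple := [set B | same_ratmap A B].

Definition id_triple : triple := [tuple 'X_i | i < 3].

(* A after B *)
Definition comp_triple (A B : triple) : triple := [tuple tnth A i \mPo B | i < 3].

Definition rational_selfmap (A : triple) : Prop :=
  ratmap A /\ forall v : 'rV[K]_3, F.@[v 0] = 0 -> F.@[ev A v 0] = 0.

Definition birational_selfmap (A : triple) : Prop :=
  rational_selfmap A /\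
  exists B, [/\ rational_selfmap B, same_ratmap (comp_triple A B) id_triple
              & same_ratmap (comp_triple B A) id_triple].

(* pi_P o A = pi_P, where pi_P maps a point [v] <> P of C to the line joining P
   and [v]; the equality is required wherever both sides are defined by the
   representative A (note that 0 \in P). *)
Definition preserves_fibers (P : proj_point K) (A : triple) : Prop :=
  forall v : 'rV[K]_3, F.@[v 0] = 0 -> v \notin (P : {vspace 'rV[K]_3}) ->
    ev A v \notin (P : {vspace 'rV[K]_3}) ->
    (P + <[ev A v]> = P + <[v]>)%VS.

Definition Grep (P : proj_point K) : set triple :=
  [set A | birational_selfmap A /\ preserves_fibers P A].

(* The underlying set of the group G[P]: rational maps are equivalence classes
   of triples. *)
Definition groupG (P : proj_point K) : set (set triple) := ratmap_class @` Grep P.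

Definition quasi_Galois (P : proj_point K) : Prop := (`I_2 #<= groupG P)%card.

(* Delta'_m and Delta'_{>= m} *)
Definition Delta (m : nat) : set (proj_point K) :=
  [set P | [/\ ~ on_curve P, quasi_Galois P & (groupG P #= `I_m)%card]].

Definition Delta_ge (m : nat) : set (proj_point K) :=
  [set P | [/\ ~ on_curve P, quasi_Galois P & (`I_m #<= groupG P)%card]].

(* G[P] is finite for P outside C, so natural powers are enough. *)
Definition generator (P : proj_point K) (A : triple) : Prop :=
  Grep P A /\
  forall B, Grep P B ->
    exists k : nat, same_ratmap B (iter k (comp_triple A) id_triple).

Definition linear_triple (f : 'End('rV[K]_3)) : triple :=
  [tuple \sum_(j < 3) f (delta_mx 0 j) 0 i *: 'X_j | i < 3].

(* sigma(Q) = Q, through the linear transformation of P^2 that restricts to the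
   birational transformation sigma of C represented by A. *)
Definition fixes (A : triple) (Q : proj_point K) : Prop :=
  exists f : 'End('rV[K]_3),
    [/\ lker f = 0%VS, same_ratmap A (linear_triple f) & (f @: Q)%VS = Q].

Definition card_G_dvd (n : nat) (P : proj_point K) : Prop :=
  exists2 m : nat, (groupG P #= `I_m)%card & (n %| m)%N.

Definition G_pair (n : nat) (P P' : proj_point K) : Prop :=
  [/\ (1 < n)%N, P <> P', ~ on_curve P /\ ~ on_curve P',
      card_G_dvd n P /\ card_G_dvd n P'
    & exists A A', [/\ generator P A, generator P' A',
                       fixes A P' & fixes A' P]].

End Curve.

(* Main.v *)
Require Import Defs.
From mathcomp Require Import boolp classical_sets cardinality.
From HB Require Import structures.
From mathcomp Require Import all_boot all_algebra all_fingroup.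
From mathcomp Require Import pgroup cyclic separable cyclotomic.
From mathcomp Require Import mpoly.
From mathcomp Require Import ring zify.

Set Implicit Arguments.
Unset Strict Implicit.
Unset Printing Implicit Defensive.

Import GRing.Theory.
Local Open Scope ring_scope.

(** A point P off the curve C is quasi-Galois exactly when some nontrivial
    homology with centre P preserves C, so the theorem is a statement about
    configurations of homologies. Three ideas carry it.

    Linearity. In the chart t p + s a + b centred at a point p off C, the curve
    is f(s)(t) = 0 with f monic in t. Smoothness makes K[s,t]/(f) integrally
    closed [integral_frac_dvd], hence a domain [curve_irreducible]. A birational
    map over the projection from p keeps s and sends t to a function that is
    again a root of f(s); being integral it is a polynomial in s and t, and its
    behaviour in the chart at infinity bounds the degree by one
    [fibre_map_linear]. So G[P] is the group of homologies and elations with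
    centre P that preserve C; characteristic zero excludes elations, and the
    rest commute, so they share an axis and form a copy of the n-th roots of
    unity [qg_exists]. The predicate [qg F p ph n] records centre, axis and
    order, and [DeltaP] translates the sets of quasi-Galois points.

    Lines. The automorphisms of C preserving the line l through two centres
    permute the points of C on l, of which there are at least three
    [line_curve_point, points_ge3]; hence they act on l through a finite group
    of projectivities. A homology with centre on l acts with two fixed points,
    the centre and the trace of the axis. Counting fixed points as for the
    rotation groups of the regular solids [pole_trichotomy], one finds for a
    centre of order n >= 4 on l that either every other centre of order at least
    three on l is the trace of its axis, or the centres of order at least four
    on l are the six vertices of an octahedron (n = 4) or the twelve vertices of
    an icosahedron (n = 5). In the last two cases their axes meet in a point r,
    which is itself a centre with axis l, of order a multiple of n, and of 10
    when n = 5 because an involution of the icosahedral group lifts to an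
    automorphism whose square is a homology with centre r [line_cases,
    involution_even].

    Counting. Two centres of order n lying on each other's axes form a G-pair,
    and the third vertex of the triangle cut out by the two axes and the joining
    line is a centre of order divisible by n [third_qg]; on an octahedral or
    icosahedral line the antipode of a vertex is its partner [antipode]. If
    n >= 6 only the mutual case occurs, and a fourth centre of order at least 3
    would lie on all three sides of the triangle [large_count]. Off an
    icosahedral line, r has order at least 10, so another centre of order at
    least 4 would lie on the axis l of r. Off an octahedral line, a second
    centre would make its join with r octahedral too; moving a centre by a
    homology of that second line and projecting it from r back to l gives a
    centre a + c b on l with neither c = 0 nor c^4 = 1, which is impossible
    [quartic_clash, off_line_four]. *)

(** * Normality of a smooth affine plane curve *)

Section InfiniteField.
Variables (K : closedFieldType).
Hypothesis charK0 : [pchar K] =i pred0.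

Lemma natr_inj : injective (fun n => n%:R : K).
Proof.
have main m n : (m <= n)%N -> m%:R = n%:R :> K -> m = n.
  have/pcharf0P ch0 := charK0.
  move=> le_mn /eqP; rewrite eq_sym -subr_eq0 -natrB // ch0.
  by rewrite subn_eq0 => le_nm; apply/eqP; rewrite eqn_leq le_mn.
move=> m n; case/orP: (leq_total m n) => le_mn; first exact: main.
by move=> eq_mn; rewrite (main _ _ le_mn).
Qed.

Lemma poly_eq0_ext (p : {poly K}) : (forall s, p.[s] = 0) -> p = 0.
Proof.
move=> p0; apply/eqP; apply/negPn/negP => nz_p.
pose rs := [seq n%:R : K | n <- iota 0 (size p)].
have: (size rs < size p)%N.
  apply: max_poly_roots => //; first by apply/allP => x _; apply/rootP.
  by rewrite map_inj_uniq ?iota_uniq //; apply: natr_inj.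
by rewrite size_map size_iota ltnn.
Qed.

Lemma poly_eq_ext (p q : {poly K}) : (forall s, p.[s] = q.[s]) -> p = q.
Proof.
by move=> epq; apply/eqP; rewrite -subr_eq0; apply/eqP/poly_eq0_ext => s;
   rewrite hornerD hornerN epq subrr.
Qed.

Lemma closed_root (p : {poly K}) : size p != 1%N -> exists x, p.[x] = 0.
Proof. by move=> /closed_rootP [x /rootP px]; exists x. Qed.

End InfiniteField.

(** The outer variable of a polynomial in {poly {poly K}} is t, the inner one s. *)
Notation ev2 G s t := ((G).[t%:P]).[s].

Section Normal.
Variables (K : closedFieldType).
Hypothesis charK0 : [pchar K] =i pred0.
Implicit Types (f G H N Q : {poly {poly K}}) (s t : K) (b l : {poly K}).

(** Specialization of s; it is a ring morphism, so fibres inherit factorizations. *)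
Definition fiber s : {poly {poly K}} -> {poly K} := map_poly (horner_eval s).
HB.instance Definition _ s := GRing.RMorphism.on (fiber s).

Lemma fiberE s G t : (fiber s G).[t] = ev2 G s t.
Proof.
have -> : t = horner_eval s t%:P by rewrite /horner_eval hornerC.
by rewrite /fiber horner_map /horner_eval hornerC.
Qed.

Lemma fiberC s b : fiber s b%:P = (b.[s])%:P.
Proof. by rewrite /fiber map_polyC. Qed.

Lemma fiber_polyC s (p : {poly K}) : fiber s (map_poly polyC p) = p.
Proof.
rewrite /fiber -map_poly_comp map_poly_id // => x _.
by rewrite /= /horner_eval hornerC.
Qed.

Lemma coef_fiber s G i : (fiber s G)`_i = (G`_i).[s].
Proof. by rewrite /fiber coef_map. Qed.

Lemma size_fiber s G : (size (fiber s G) <= size G)%N.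
Proof. exact: size_poly. Qed.

Lemma fiber_eq0 G : (forall s, fiber s G = 0) -> G = 0.
Proof.
move=> G0; apply/polyP => i; rewrite coef0; apply: (poly_eq0_ext charK0) => s.
by rewrite -coef_fiber G0 coef0.
Qed.

Lemma fiber0_dvd s G : fiber s G = 0 -> exists G', G = ('X - s%:P)%:P * G'.
Proof.
move=> G0.
have dv i : exists q, G`_i = q * ('X - s%:P).
  by apply/factor_theorem/rootP; rewrite -coef_fiber G0 coef0.
exists (map_poly (fun c => c %/ ('X - s%:P)) G).
apply/polyP => i; rewrite coefCM coef_map_id0 ?div0p //.
case: (dv i) => q ->; rewrite mulpK ?polyXsubC_eq0 //; exact: mulrC.
Qed.

Variable f : {poly {poly K}}.
Hypothesis monf : f \is monic.
Let nzf : f != 0. Proof. exact: monic_neq0. Qed.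

(** The ideal generated by f, the equation of an affine curve. *)
Definition vanf (G : {poly {poly K}}) := exists Q, G = Q * f.

Lemma vanf0 : vanf 0. Proof. by exists 0; rewrite mul0r. Qed.
Lemma vanfD G H : vanf G -> vanf H -> vanf (G + H).
Proof. by case=> Q -> [Q' ->]; exists (Q + Q'); rewrite mulrDl. Qed.
Lemma vanfMl G H : vanf G -> vanf (H * G).
Proof. by case=> Q ->; exists (H * Q); rewrite mulrA. Qed.
Lemma vanfMr G H : vanf G -> vanf (G * H).
Proof. by rewrite mulrC; apply: vanfMl. Qed.
Lemma vanfN G : vanf G -> vanf (- G).
Proof. by case=> Q ->; exists (- Q); rewrite mulNr. Qed.
Lemma vanfB G H : vanf G -> vanf H -> vanf (G - H).
Proof. by move=> vG vH; apply/vanfD/vanfN. Qed.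
Lemma vanf_self : vanf f. Proof. by exists 1; rewrite mul1r. Qed.
Definition congf G H := vanf (G - H).
Lemma congf_refl G : congf G G. Proof. by rewrite /congf subrr; apply: vanf0. Qed.
Lemma congfM G G' H H' : congf G G' -> congf H H' -> congf (G * H) (G' * H').
Proof.
move=> gg hh; rewrite /congf.
have -> : G * H - G' * H' = (G - G') * H + G' * (H - H') by ring.
by apply: vanfD; [apply: vanfMr | apply: vanfMl].
Qed.
Lemma congfX G H n : congf G H -> congf (G ^+ n) (H ^+ n).
Proof.
move=> gh; elim: n => [|n IH]; first exact: congf_refl.
by rewrite !exprS; apply: congfM.
Qed.
Lemma congfD G G' H H' : congf G G' -> congf H H' -> congf (G + H) (G' + H').
Proof.
move=> gg hh; rewrite /congf.
have -> : G + H - (G' + H') = (G - G') + (H - H') by ring.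
exact: vanfD.
Qed.
Lemma congf_sum (I : Type) (r : seq I) (P : pred I) (E E' : I -> {poly {poly K}}) :
  (forall i, P i -> congf (E i) (E' i)) ->
  congf (\sum_(i <- r | P i) E i) (\sum_(i <- r | P i) E' i).
Proof. by move=> eE; apply: big_ind2 => //; [apply: congf_refl | move=> *; apply: congfD]. Qed.
Lemma congf_vanf G H : congf G H -> vanf G -> vanf H.
Proof.
move=> gh vG; have -> : H = G - (G - H) by ring.
exact: vanfB.
Qed.

Lemma vanf_ev G s t : vanf G -> ev2 f s t = 0 -> ev2 G s t = 0.
Proof. by case=> Q ->; rewrite !hornerM => ->; rewrite mulr0. Qed.

Lemma vanf_small G : vanf G -> (size G < size f)%N -> G = 0.
Proof.
case=> Q ->; have [->|nzQ] := eqVneq Q 0; first by rewrite mul0r.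
rewrite size_Mmonic //; move: nzQ; rewrite -size_poly_gt0.
by case: (size Q) => // k _; rewrite addSn ltnNge leq_addl.
Qed.

Lemma vanf_mod G : exists2 R, vanf (G - R) & (size R < size f)%N.
Proof.
exists (Pdiv.Ring.rmodp G f); last by rewrite Pdiv.Ring.ltn_rmodp.
exists (Pdiv.Ring.rdivp G f).
by rewrite {1}(Pdiv.RingMonic.rdivp_eq monf G) addrK.
Qed.

Lemma size_fiber_monic s : size (fiber s f) = size f.
Proof.
apply: size_map_poly_id0.
by rewrite (monicP monf) /horner_eval hornerC oner_neq0.
Qed.

Lemma fiber_monic s : fiber s f \is monic.
Proof. exact: monic_map. Qed.

(** The remainder of G modulo f is zero in every fibre because its degree in
    t is too small. *)
Lemma vanf_fibers G : (forall s, fiber s f %| fiber s G) -> vanf G.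
Proof.
move=> dv; have [R vR ltR] := vanf_mod G.
suff R0 : R = 0 by rewrite R0 subr0 in vR.
apply: fiber_eq0 => s; apply/eqP; apply/negPn/negP => nzR.
have: fiber s f %| fiber s R.
  have -> : R = G - (G - R) by ring.
  case: vR => Q ->; rewrite rmorphB rmorphM; apply: dvdp_sub => //.
  exact: dvdp_mull.
move/(dvdp_leq nzR); rewrite size_fiber_monic leqNgt => /negP; apply.
exact: leq_ltn_trans (size_fiber _ _) ltR.
Qed.

(** The fibre of f over s is monic, hence nonzero, so a factor s - s0 of a
    multiple of f already divides the cofactor. *)
Lemma vanf_lincancel s G : vanf (('X - s%:P)%:P * G) -> vanf G.
Proof.
case=> Q e; have: fiber s (Q * f) = 0.
  by rewrite -e rmorphM /= fiberC hornerXsubC subrr mul0r.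
rewrite rmorphM => /eqP; rewrite mulf_eq0 (negPf (monic_neq0 (fiber_monic s))) orbF.
move=> /eqP /fiber0_dvd [Q' Q'E]; exists Q'.
by apply: (mulfI (_ : ('X - s%:P)%:P != 0)); rewrite ?polyC_eq0 ?polyXsubC_eq0 // e Q'E mulrA.
Qed.

Lemma poly_ind_roots (P : {poly K} -> Prop) :
  (forall c, c != 0 -> P c%:P) ->
  (forall s b, b != 0 -> P b -> P (('X - s%:P) * b)) ->
  forall b, b != 0 -> P b.
Proof.
move=> Pc Pm b; elim: {b}(size b) {-2}b (leqnn (size b)) => [|n IH] b leb nzb.
  by move: leb; rewrite leqn0 size_poly_eq0 (negPf nzb).
have [s1|n1] := eqVneq (size b) 1%N.
  by move/eqP: s1 => /size_poly1P [c nzc ->]; apply: Pc.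
have [s /eqP/factor_theorem [q bE]] := closed_root n1.
have nzq : q != 0 by apply: contraNneq nzb => q0; rewrite bE q0 mul0r.
rewrite bE mulrC; apply: (Pm s q nzq); apply: IH => //.
by move: leb; rewrite bE size_Mmonic ?monicXsubC // size_XsubC addn2.
Qed.

Lemma vanf_cancel b G : b != 0 -> vanf (b%:P * G) -> vanf G.
Proof.
move=> nzb; move: b nzb G; apply: poly_ind_roots.
  move=> c nzc G [Q e]; exists ((c^-1)%:P%:P * Q).
  by rewrite -mulrA -e mulrA -!polyCM mulVf // mul1r.
move=> s b nzb IH G; rewrite polyCM -mulrA => /vanf_lincancel; exact: IH.
Qed.

(** In each fibre f has size f - 1 linear factors, each of which divides G. *)
Lemma vanish_pow G : (forall s t, ev2 f s t = 0 -> ev2 G s t = 0) ->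
  vanf (G ^+ (size f).-1).
Proof.
move=> G0; apply: vanf_fibers => s.
have [r fE] := closed_field_poly_normal (fiber s f).
rewrite (monicP (fiber_monic s)) scale1r in fE.
have -> : (size f).-1 = size r.
  by rewrite -(size_fiber_monic s) fE size_prod_XsubC.
rewrite rmorphXn fE.
have: forall x, x \in r -> ('X - x%:P) %| fiber s G.
  move=> x xr; rewrite dvdp_XsubCl; apply/rootP; rewrite fiberE G0 //.
  by rewrite -fiberE; apply/rootP; rewrite fE root_prod_XsubC.
elim: r {fE} => [|x r IH] dv; first by rewrite big_nil expr0 dvd1p.
rewrite big_cons /= exprS dvdp_mul ?dv ?inE ?eqxx //.
by apply: IH => y yr; apply: dv; rewrite inE yr orbT.
Qed.

Hypothesis smoothf : forall s t, ev2 f s t = 0 ->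
  (ev2 f^`() s t != 0) || ((f.[t%:P])^`().[s] != 0).

(** The fraction N / b is integral over the coordinate ring; the equation is
    multiplied by b ^ n to avoid fractions. *)
Definition integral_frac N b := exists n (c : nat -> {poly {poly K}}),
  (0 < n)%N /\ vanf (N ^+ n + \sum_(i < n) c i * b%:P ^+ (n - i) * N ^+ i).

(** Divisibility may be tested one root at a time, with multiplicities. *)
Lemma dvdp_local (p q : {poly K}) : p \is monic ->
  (forall z m, ('X - z%:P) ^+ m %| p -> ('X - z%:P) ^+ m %| q) -> p %| q.
Proof.
move=> monp; have [r pE] := closed_field_poly_normal p.
move: pE; rewrite (monicP monp) scale1r => -> {p monp}.
elim: r q => [|z r IH] q dv; first by rewrite big_nil dvd1p.
have: ('X - z%:P) %| q.
  by rewrite -[_ - _]expr1; apply: dv; rewrite expr1 big_cons dvdp_mulr.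
rewrite big_cons => /dvdpP [q1 qE]; rewrite qE mulrC dvdp_mul2r ?polyXsubC_eq0 //.
apply: IH => y m dvr; have [yz|nyz] := eqVneq y z.
  have := dv z m.+1; rewrite big_cons qE exprSr mulrC.
  by rewrite !(mulrC ('X - z%:P)) !dvdp_mul2r ?polyXsubC_eq0 // -yz; apply.
have := dv y m; rewrite big_cons dvdp_mull // qE => /(_ isT).
rewrite Gauss_dvdpl //; apply: coprimep_expl; rewrite coprimep_XsubC2 //.
by rewrite subr_eq0 eq_sym.
Qed.

(** Normality at the points over s0. Suppose that N vanishes at a point
    (s0, t0) to an order a in t that is lower than the order of f. For a > 0 the
    point t0 is a multiple root of the fibre of f, and smoothness makes
    l = s - s0 a multiple of u ^ (a + 1), up to a factor k that is a unit at the
    point, where u = t - t0 is a local parameter. Multiplying the integral equation by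
    k ^ n, every term becomes divisible by u ^ (a n), and after cancellation the
    value at the point is a nonzero n-th power. *)
Lemma integral_frac_fiber s0 N : (size N < size f)%N ->
  integral_frac N ('X - s0%:P) -> fiber s0 N = 0.
Proof.
set l := 'X - s0%:P => ltN [n [c [n_gt0 vI]]].
pose f0 := fiber s0 f; pose N0 := fiber s0 N.
have mf0 : f0 \is monic by exact: fiber_monic.
suff dv : f0 %| N0.
  apply/eqP; apply/negPn/negP => nzN0; move: (dvdp_leq nzN0 dv).
  by rewrite size_fiber_monic leqNgt (leq_ltn_trans (size_fiber _ _) ltN).
have [N00|nzN0] := eqVneq N0 0; first by rewrite N00 dvdp0.
apply: dvdp_local => // t0 m dvf; apply/negPn/negP => ndvN.
have [a [q]] := multiplicity_XsubC N0 t0; rewrite nzN0 /= => nq0 N0E.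
have lt_am : (a < m)%N.
  rewrite ltnNge; apply: contra ndvN => le_ma.
  by rewrite N0E; apply: dvdp_mull; apply: dvdp_exp2l.
have /dvdpP [h f0E] : ('X - t0%:P) ^+ a.+1 %| f0.
  by apply: dvdp_trans dvf; apply: dvdp_exp2l.
have f00 : f0.[t0] = 0.
  by rewrite f0E hornerM horner_exp hornerXsubC subrr exprS mul0r mulr0.
have evf : ev2 f s0 t0 = 0 by rewrite -fiberE.
pose lift := map_poly (@polyC K).
have fib_lift G : fiber s0 (G - lift (fiber s0 G)) = 0.
  by rewrite rmorphB /= fiber_polyC subrr.
have ev_lift p t : ev2 (lift p) s0 t = p.[t] by rewrite -fiberE fiber_polyC.
have evl (i : nat) : (0 < i)%N -> ev2 (l%:P ^+ i) s0 t0 = 0.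
  by case: i => // i _; rewrite horner_exp hornerC horner_exp hornerXsubC subrr exprS mul0r.
have [N1 N1E] := fiber0_dvd (fib_lift N); have [k kE] := fiber0_dvd (fib_lift f).
rewrite -/l -/f0 -/N0 in N1E kE.
(* expansions of N and f along the fibre s = s0 *)
have {N1E} N1E : N = lift N0 + l%:P * N1 by rewrite -N1E addrC subrK.
have {kE} kE : f = lift f0 + l%:P * k by rewrite -kE addrC subrK.
(* if N does not vanish at (s0, t0), only the leading term survives there *)
have [a0|a_gt0] := posnP a.
  have: ev2 (N ^+ n + \sum_(i < n) c i * l%:P ^+ (n - i) * N ^+ i) s0 t0 = 0.
    exact: vanf_ev.
  rewrite hornerD !horner_exp hornerD horner_exp -fiberE -/N0 N0E a0 expr0 mulr1.
  rewrite [X in _ + X](_ : _ = 0) ?addr0; last first.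
    rewrite !horner_sum big1 // => i _.
    by rewrite hornerM hornerM hornerM hornerM evl ?subn_gt0 // mulr0 mul0r.
  by move/eqP; rewrite expf_eq0 n_gt0 /= => qt0; move: nq0; rewrite /root qt0.
pose u : {poly {poly K}} := 'X - t0%:P%:P.
have uE : lift ('X - t0%:P) = u by rewrite /lift rmorphB /= map_polyX map_polyC.
have evu : ev2 u s0 t0 = 0 by rewrite hornerXsubC subrr horner0.
have ft0 : f.[t0%:P] = l * k.[t0%:P].
  by rewrite {1}kE hornerD hornerM hornerC /lift horner_map f00 rmorph0 add0r.
have dft0 : (f.[t0%:P])^`().[s0] != 0.
  have := smoothf evf; rewrite -fiberE /fiber -deriv_map -/(fiber s0 f) -/f0.
  suff -> : f0^`().[t0] = 0 by rewrite eqxx.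
  rewrite f0E -(prednK a_gt0) 2!exprSr mulrA.
  by rewrite !(hornerXsubC, subrr, mulr0, mul0r, addr0, derivM, hornerM, hornerD).
have evk : ev2 k s0 t0 != 0.
  apply: contraNneq dft0 => k0.
  by rewrite ft0 derivM hornerD !hornerM k0 hornerXsubC subrr mul0r mulr0 addr0.
have fk_nz : f.[t0%:P] != 0 by apply: contraNneq dft0 => ->; rewrite linear0 horner0.
(* u is not a zero divisor modulo f, since f does not vanish on the line t = t0 *)
have cancel_u G j : vanf (u ^+ j * G) -> vanf G.
  elim: j G => [|j IH] G; first by rewrite expr0 mul1r.
  rewrite exprSr -mulrA => /IH [Q e].
  have: (Q * f).[t0%:P] = 0 by rewrite -e hornerM hornerXsubC subrr mul0r.
  rewrite hornerM => /eqP; rewrite mulf_eq0 (negPf fk_nz) orbF.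
  move=> /factor_theorem [Q' Q'E]; exists Q'.
  apply: (mulfI (_ : u != 0)); first by rewrite polyXsubC_eq0.
  by rewrite e Q'E mulrAC mulrC mulrA.
pose M := k * lift q - u * lift h * N1.
have evM : ev2 M s0 t0 != 0.
  rewrite /M !hornerD !hornerN !hornerM evu !mul0r subr0 ev_lift mulf_neq0 //.
have liftM p j : lift (p * ('X - t0%:P) ^+ j) = lift p * u ^+ j.
  by rewrite -uE /lift rmorphM rmorphXn.
have lfE : lift f0 = lift h * u ^+ a.+1 by rewrite f0E liftM.
have lNE : lift N0 = lift q * u ^+ a by rewrite N0E liftM.
have lk : congf (l%:P * k) (- lift h * u ^+ a.+1).
  by rewrite /congf mulNr opprK -lfE addrC -kE; apply: vanf_self.
have kN : congf (k * N) (u ^+ a * M).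
  have -> : k * N = k * lift q * u ^+ a + l%:P * k * N1 by rewrite N1E lNE; ring.
  have -> : u ^+ a * M = k * lift q * u ^+ a + (- lift h * u ^+ a.+1) * N1.
    by rewrite /M exprS; ring.
  by apply: congfD; [apply: congf_refl | apply: congfM => //; apply: congf_refl].
(* the integral equation times k ^ n is u ^ (a n) S modulo f *)
pose S := M ^+ n + \sum_(i < n) c i * (- lift h * u) ^+ (n - i) * M ^+ i.
have vS : vanf (u ^+ (a * n) * S).
  apply: congf_vanf (vanfMl (k ^+ n) vI).
  rewrite /S (mulrDr (k ^+ n)) (mulrDr (u ^+ _)).
  apply: congfD.
    by rewrite -exprMn exprM -exprMn; apply: congfX.
  rewrite !mulr_sumr; apply: congf_sum => i _.
  have le_in : (i <= n)%N by apply: ltnW.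
  have -> : k ^+ n * (c i * l%:P ^+ (n - i) * N ^+ i)
     = c i * ((l%:P * k) ^+ (n - i) * (k * N) ^+ i).
    by rewrite -{1}(subnK le_in) exprD !exprMn; ring.
  have -> : u ^+ (a * n) * (c i * (- lift h * u) ^+ (n - i) * M ^+ i)
     = c i * ((- lift h * u ^+ a.+1) ^+ (n - i) * (u ^+ a * M) ^+ i).
    rewrite -{1}(subnK le_in) mulnDr exprD !exprM exprSr !exprMn; ring.
  by apply: congfM; [apply: congf_refl | apply: congfM; apply: congfX].
move/cancel_u/vanf_ev: vS => /(_ _ _ evf).
rewrite hornerD hornerD !horner_exp !horner_sum big1 ?addr0 => [/eqP|i _].
  by rewrite expf_eq0 n_gt0 (negPf evM).
rewrite exprMn !hornerM (horner_exp u) (horner_exp u.[t0%:P]) evu.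
by rewrite expr0n subn_eq0 leqNgt ltn_ord !(mulr0, mul0r).
Qed.

(** Normality: the denominator b is split off one linear factor at a time. *)
Lemma integral_frac_dvd b N : b != 0 -> (size N < size f)%N ->
  integral_frac N b -> exists N', N = b%:P * N'.
Proof.
move=> nzb; move: b nzb N; apply: poly_ind_roots.
  move=> c nzc N _ _; exists ((c^-1)%:P%:P * N).
  by rewrite mulrA -!polyCM mulfV // mul1r.
move=> s b nzb IH N ltN [n [c [n_gt0 vI]]].
have /fiber0_dvd [N1 N1E] : fiber s N = 0.
  apply: integral_frac_fiber => //; exists n, (fun i => c i * b%:P ^+ (n - i)); split=> //.
  apply: congf_vanf vI; apply: congfD; first exact: congf_refl.
  apply: congf_sum => i _; rewrite polyCM exprMn.
  set A := c i; set B := b%:P ^+ _; set L := _%:P ^+ _.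
  have -> : A * (L * B) = A * B * L by ring.
  exact: congf_refl.
have [||N2 N2E] := IH N1.
- have [->|nz1] := eqVneq N1 0; first by rewrite size_poly0 size_poly_gt0.
  by move: ltN; rewrite N1E size_Cmul // polyXsubC_eq0.
- exists n, c; split=> //.
  have: vanf (('X - s%:P)%:P ^+ n * (N1 ^+ n + \sum_(i < n) c i * b%:P ^+ (n - i) * N1 ^+ i)).
    apply: congf_vanf vI; rewrite N1E mulrDr exprMn.
    apply: congfD; first exact: congf_refl.
    rewrite mulr_sumr; apply: congf_sum => i _.
    have le_in : (i <= n)%N by apply: ltnW.
    have expn_split (x : {poly {poly K}}) : x ^+ n = x ^+ (n - i) * x ^+ i.
      by rewrite -exprD subnK.
    rewrite (expn_split (_ - _)%:P) polyCM !exprMn.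
    set L := _ ^+ (n - i); set L' := _ ^+ i; set B := _ ^+ (n - i); set N' := _ ^+ i.
    have -> : c i * (L * B) * (L' * N') = L * L' * (c i * B * N') by ring.
    exact: congf_refl.
  have canc m G : vanf (('X - s%:P)%:P ^+ m * G) -> vanf G.
    elim: m G => [|m IHm] G; first by rewrite expr0 mul1r.
    by rewrite exprSr -mulrA => /IHm /vanf_lincancel.
  by move/canc.
by exists N2; rewrite N1E N2E polyCM mulrA.
Qed.

(** The remainder of G modulo f is a nilpotent fraction over every s, hence
    integral; by normality it vanishes in every fibre. *)
Lemma vanf_reduced G n : vanf (G ^+ n) -> vanf G.
Proof.
case: n => [|n] vG; first by rewrite -[G]mulr1; apply: vanfMl.
have [R vR ltR] := vanf_mod G.
suff R0 : R = 0 by rewrite R0 subr0 in vR.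
apply: fiber_eq0 => s; apply: integral_frac_fiber => //.
exists n.+1, (fun=> 0); split=> //.
rewrite big1 ?addr0 => [|i _]; last by rewrite !mul0r.
by apply: congf_vanf vG; apply: congfX.
Qed.

(** A form of the Nullstellensatz in which the zeros of b need no control:
    they are absorbed by multiplication with b. *)
Lemma vanf_vanish b G : b != 0 ->
  (forall s t, b.[s] != 0 -> ev2 f s t = 0 -> ev2 G s t = 0) -> vanf G.
Proof.
move=> nzb G0; apply: (vanf_cancel nzb); apply: (@vanf_reduced _ (size f).-1).
apply: vanish_pow => s t fst; rewrite hornerM hornerC hornerM.
have [->|nzbs] := eqVneq b.[s] 0; first by rewrite mul0r.
by rewrite G0 // mulr0.
Qed.

(** The version of normality that is used: integrality is only known as an
    equation between values on the curve, outside the zeros of b. *)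
Lemma integral_frac_quot b N n (c : nat -> {poly {poly K}}) :
  b != 0 -> (0 < n)%N ->
  (forall s t, b.[s] != 0 -> ev2 f s t = 0 ->
     ev2 N s t ^+ n + \sum_(i < n) ev2 (c i) s t * b.[s] ^+ (n - i) * ev2 N s t ^+ i = 0) ->
  exists E : {poly {poly K}}, (size E < size f)%N /\ vanf (N - b%:P * E).
Proof.
move=> nzb n_gt0 rel; have [R vR ltR] := vanf_mod N.
have [|E RE] := integral_frac_dvd nzb ltR.
  exists n, c; split=> //; apply: (vanf_vanish nzb) => s t bs fst.
  have NR : ev2 N s t = ev2 R s t.
    by apply/eqP; rewrite -subr_eq0 -!hornerN -!hornerD; apply/eqP/vanf_ev.
  rewrite -(rel s t bs fst) !hornerD !horner_exp NR; congr (_ + _).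
  rewrite !horner_sum; apply: eq_bigr => i _.
  by rewrite !hornerM !horner_exp hornerC.
exists E; split; last by rewrite -RE.
have [->|nzE] := eqVneq E 0; first by rewrite size_poly0 size_poly_gt0.
by move: ltR; rewrite RE size_Cmul.
Qed.

End Normal.

(** * Degree bounds at infinity and irreducibility *)

(** For the sizes x, y of a factor and its cofactor and z of their product, up to
    constants. *)
Lemma size_cofactor (x y z : nat) : (x + y).-1 = z -> (z <= x)%N -> (0 < y)%N -> (1 < z)%N -> y = 1%N.
Proof. lia. Qed.

Section Charts.
Variables (K : closedFieldType).
Hypothesis charK0 : [pchar K] =i pred0.
Implicit Types (p q b : {poly K}) (s t x : K).

Lemma exprB_div x m i : (i <= m)%N -> x != 0 -> x ^+ (m - i) = x ^+ m / x ^+ i.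
Proof. by move=> le_im nzx; rewrite -[in RHS](subnK le_im) exprD mulfK ?expf_neq0. Qed.

(** The polynomial x ^ m p(1 / x). *)
Definition revp m p : {poly K} := \poly_(j < m.+1) p`_(m - j).

Lemma revpE m p x : (size p <= m.+1)%N -> x != 0 ->
  (revp m p).[x] = x ^+ m * p.[x^-1].
Proof.
move=> lep nzx; rewrite horner_poly (horner_coef_wide _ lep) mulr_sumr.
rewrite (reindex_inj rev_ord_inj) /=; apply: eq_bigr => i _.
have le_im : (i <= m)%N by rewrite -ltnS.
rewrite subSS subKn // mulrCA; congr (_ * _).
by rewrite exprVn exprB_div.
Qed.

(** The coordinate change s -> 1 / s, t -> t / s between the two charts turns
    polynomials into polynomials after multiplication by a power of s. *)
Lemma flip_exists (E : {poly {poly K}}) : exists M0, forall M, (M0 <= M)%N ->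
  exists N : {poly {poly K}}, (size N <= size E)%N /\
    forall s t, s != 0 -> ev2 N s t = s ^+ M * ev2 E s^-1 (t / s).
Proof.
exists (size E + \max_(i < size E) size (E`_i)%R)%N => M leM.
exists (\poly_(i < size E) revp (M - i) E`_i); split; first exact: size_poly.
move=> s t nzs; rewrite horner_poly (horner_coef E) !horner_sum mulr_sumr.
apply: eq_bigr => i _; rewrite !hornerM !horner_exp !hornerC.
have lei : (size (E`_i)%R <= \max_(i < size E) size (E`_i)%R)%N by exact: (leq_bigmax i).
have ltiM : (i <= M)%N by have := ltn_ord i; lia.
rewrite revpE //; last by have := ltn_ord i; lia.
rewrite exprMn exprVn exprB_div //.
have nzi : s ^+ i != 0 by rewrite expf_neq0.
by field.
Qed.

(** A pole of order at most w - i at infinity bounds the degree. *)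
Lemma size_bound_at_infinity w i p q :
  (forall s, s != 0 -> s ^+ w * p.[s^-1] = s ^+ i * q.[s]) ->
  (size p <= w.+1 - i)%N.
Proof.
move=> rel; have [->|nzp] := eqVneq p 0; first by rewrite size_poly0.
pose m := size q.
have pE : p * 'X^(i + m) = 'X^w * revp m q.
  suff: 'X * (p * 'X^(i + m) - 'X^w * revp m q) = 0.
    by move/eqP; rewrite mulf_eq0 polyX_eq0 subr_eq0 => /eqP.
  apply: (poly_eq0_ext charK0) => x; rewrite hornerM hornerX hornerD hornerN !hornerM !hornerXn.
  have [->|nzx] := eqVneq x 0; first by rewrite mul0r.
  rewrite revpE ?leqnSn //; have := rel x^-1; rewrite invr_eq0 invrK => /(_ nzx) relx.
  have nzi := expf_neq0 i nzx; have nzw := expf_neq0 w nzx.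
  have -> : p.[x] = x ^+ w / x ^+ i * q.[x^-1].
    by apply: (mulfI (_ : x^-1 ^+ w != 0)); rewrite ?exprVn ?invr_eq0 // -!exprVn relx !exprVn; field; rewrite nzi nzw.
  by rewrite exprD; field.
have nzR : revp m q != 0.
  by apply: contraNneq nzp => R0; move/eqP: pE; rewrite R0 mulr0 mulf_eq0 (negPf (monic_neq0 (monicXn _ _))) orbF.
have := congr1 (fun p => size p) pE.
rewrite size_Mmonic ?monicXn // size_polyXn mulrC size_Mmonic ?monicXn // size_polyXn.
have := size_poly m.+1 (fun j => q`_(m - j)); rewrite -/(revp m q).
move: nzp nzR; rewrite -!size_poly_gt0; lia.
Qed.

Variables (f g : {poly {poly K}}).
Hypotheses (monf : f \is monic) (mong : g \is monic) (szfg : size g = size f).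
Hypothesis smoothf : forall s t, ev2 f s t = 0 ->
  (ev2 f^`() s t != 0) || ((f.[t%:P])^`().[s] != 0).
Hypothesis smoothg : forall s t, ev2 g s t = 0 ->
  (ev2 g^`() s t != 0) || ((g.[t%:P])^`().[s] != 0).

(** The curve is f = 0 in one chart and g = 0 in the other. A regular function
    E on the first chart, multiplied by s ^ w, is a rational function on the
    second one; if it is integral there it is a polynomial, by normality, and
    comparing the two expressions bounds the degree of every coefficient. *)
Lemma chart_bound w (E : {poly {poly K}}) n (c : nat -> {poly {poly K}}) :
  (size E < size f)%N -> (0 < n)%N ->
  (forall s t, s != 0 -> ev2 g s t = 0 ->
    let e := s ^+ w * ev2 E s^-1 (t / s) in
    e ^+ n + \sum_(i < n) ev2 (c i) s t * e ^+ i = 0) ->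
  forall i, (size (E`_i)%R <= w.+1 - i)%N.
Proof.
move=> ltE n_gt0 rel; have [M0 flipE] := flip_exists E.
pose M := M0.+1.
have [|N [leN NE]] := flipE (M + w)%N; first by rewrite /M; lia.
have nzX : 'X^M != 0 :> {poly K} by rewrite monic_neq0 ?monicXn.
have [|E' [ltE' vE']] := @integral_frac_quot K charK0 g mong smoothg 'X^M N n c nzX n_gt0.
  move=> s t; rewrite hornerXn expf_eq0 /= => nzs gst.
  rewrite NE // exprD -mulrA; set e := s ^+ w * _.
  have := rel s t nzs gst; rewrite /= -/e => rele.
  transitivity (s ^+ M ^+ n * (e ^+ n + \sum_(i < n) ev2 (c i) s t * e ^+ i)); last first.
    by rewrite rele mulr0.
  rewrite mulrDr mulr_sumr exprMn; congr (_ + _); apply: eq_bigr => i _.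
  have le_in : (i <= n)%N by apply: ltnW.
  have -> : s ^+ M ^+ n = s ^+ M ^+ (n - i) * s ^+ M ^+ i by rewrite -exprD subnK.
  by rewrite exprMn; ring.
have {vE'} NE' : N = ('X^M)%:P * E'.
  apply/eqP; rewrite -subr_eq0; apply/eqP/(vanf_small mong) => //.
  rewrite (leq_ltn_trans (size_polyD _ _)) // gtn_max size_polyN mul_polyC.
  by rewrite (leq_ltn_trans leN) ?szfg //= (leq_ltn_trans (size_scale_leq _ _)) // -szfg.
have relE s t : s != 0 -> s ^+ w * ev2 E s^-1 (t / s) = ev2 E' s t.
  move=> nzs; apply: (mulfI (expf_neq0 M nzs)); rewrite mulrA -exprD -NE //.
  by rewrite NE' hornerM hornerC hornerM hornerXn.
move=> i; apply: (@size_bound_at_infinity w i _ E'`_i) => s nzs.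
pose P1 := s ^+ w *: (fiber s^-1 E \Po (s^-1 *: 'X)).
have : P1 = fiber s E'.
  apply: (poly_eq_ext charK0) => t; rewrite fiberE -relE // /P1 hornerZ horner_comp.
  by rewrite fiberE hornerZ hornerX (mulrC s^-1 t).
move=> /(congr1 (fun P : {poly K} => P`_i)); rewrite coefZ coef_fiber => <-.
rewrite comp_polyE coef_sum; set S := \sum_(_ < _) _.
suff -> : S = (E`_i).[s^-1] / s ^+ i.
  have nzi : s ^+ i != 0 by rewrite expf_neq0.
  by field.
rewrite {}/S -coef_fiber.
under eq_bigr => j _ do rewrite exprZn coefZ coefZ coefXn.
have [lti|lei] := ltnP i (size (fiber s^-1 E)); last first.
  rewrite [in RHS]nth_default // mul0r big1 // => j _.
  by rewrite gtn_eqF ?(leq_trans _ lei) ?mulr0.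
rewrite (bigD1 (Ordinal lti)) //= eqxx mulr1 exprVn big1 ?addr0 // => j nji.
by rewrite (_ : (i == j) = false) ?mulr0 //; apply: contraNF nji => /eqP e; apply/eqP/val_inj.
Qed.

Hypothesis chart_change : forall s t, s != 0 -> ev2 g s t = 0 -> ev2 f s^-1 (t / s) = 0.
Hypothesis deg_f : (1 < size f)%N.

Lemma vanfP G : reflect (vanf f G) (Pdiv.IdomainDefs.dvdp f G).
Proof. by apply: (iffP (Pdiv.IdomainMonic.dvdpP monf G)) => -[Q QE]; exists Q. Qed.

(** An idempotent is integral in both charts, so it is constant. *)
Lemma regular_idempotent (E : {poly {poly K}}) : (size E < size f)%N ->
  vanf f (E ^+ 2 - E) -> E = 0 \/ E = 1.
Proof.
move=> ltE vE.
have bound : forall i, (size (E`_i)%R <= 1 - i)%N.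
  apply: (@chart_bound 0 E 2 (fun i => if i == 1%N then -1 else 0)) => //.
  move=> s t nzs gst; rewrite /= expr0 mul1r big_ord_recl big_ord1 /=.
  rewrite !horner0 mul0r add0r.
  have := vanf_ev vE (chart_change nzs gst).
  by rewrite !hornerD !hornerN !horner_exp !hornerC mulN1r.
have [c0 EC] : exists c : K, E = c%:P%:P.
  have E1 : E = (E`_0)%:P.
    apply/polyP => i; rewrite coefC; case: i => [|i] //=.
    by apply/eqP; rewrite -size_poly_leq0 (leq_trans (bound _)).
  by exists (E`_0)`_0; rewrite {1}E1 {1}(size1_polyC (bound 0%N)).
have: E ^+ 2 - E = 0.
  apply: (vanf_small monf vE); rewrite EC -!polyC_exp -!polyCB.
  exact: leq_ltn_trans (size_polyC_leq1 _) deg_f.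
move=> /eqP; rewrite expr2 -{3}[E]mulr1 -mulrBr mulf_eq0 subr_eq0.
by case/orP => /eqP; [left | right].
Qed.

(** If f divides G H but neither factor, then f splits up to a constant as a
    product of g0 = gcd(f, G) and h. These are coprime as f is reduced, and a
    Bezout relation U g0 + V h = b makes U g0 / b a nontrivial idempotent
    function. It is integral, hence regular, hence 0 or 1. *)
Lemma curve_irreducible G H : vanf f (G * H) -> vanf f G \/ vanf f H.
Proof.
Import Pdiv.Idomain.
move=> /vanfP fGH; set g0 := gcdp f G.
have nzf : f != 0 by apply: monic_neq0.
have /dvdpP [[c h] /= nzc cfE] : g0 %| f by apply: dvdp_gcdl.
have nzhg : h * g0 != 0 by rewrite -cfE scale_poly_eq0 negb_or nzc.
have [nzh nzg] : h != 0 /\ g0 != 0 by move: nzhg; rewrite mulf_eq0 negb_or => /andP.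
have cop : coprimep g0 h.
  apply/coprimepP => w /dvdpP [[a g1] /= nza gE] /dvdpP [[b h1] /= nzb hE].
  pose X := g1 * h1 * w.
  have XwE : X * w = (a * b * c)%:P * f.
    rewrite polyCM -mulrA [c%:P * f]mul_polyC cfE /X.
    have -> : g1 * h1 * w * w = (g1 * w) * (h1 * w) by ring.
    by rewrite -gE -hE -!mul_polyC polyCM; ring.
  have nzX : X * w != 0.
    by rewrite XwE mulf_neq0 ?polyC_eq0 // !mulf_neq0.
  have vX : vanf f X.
    apply: (vanf_reduced charK0 monf smoothf (n := 2)).
    exists (g1 * h1 * (a * b * c)%:P).
    by rewrite -[RHS]mulrA -XwE /X; ring.
  have leX : (size f <= size X)%N.
    rewrite leqNgt; apply/negP => /(vanf_small monf vX) X0.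
    by move: nzX; rewrite X0 mul0r eqxx.
  move: nzX; rewrite mulf_eq0 negb_or => /andP [nzX nzw].
  have := congr1 (fun p : {poly {poly K}} => size p) XwE.
  rewrite size_mul // size_Cmul ?mulf_neq0 // => szE.
  have {}szE : (size X + size w).-1 = size f := szE.
  have {}nzw : (0 < size w)%N by rewrite size_poly_gt0.
  by rewrite -size_poly_eq1; apply/eqP/(size_cofactor szE leX nzw deg_f).
have /Bezout_coprimepP [[u v] /= /eqpP [[c1 c2] /= /andP [nzc1 nzc2] bez]] := cop.
pose U := c1%:P * u; pose V := c1%:P * v; pose b := c2.
have {}bez : U * g0 + V * h = b%:P.
  by rewrite /U /V -!mulrA -mulrDr mul_polyC bez alg_polyC.
pose N := U * g0.
have vN : vanf f (N ^+ 2 - b%:P * N).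
  exists (- (U * V * c%:P)).
  by rewrite -bez /N mulNr -[U * V * _ * f]mulrA [c%:P * f]mul_polyC cfE; ring.
have [|E [ltE vE]] := @integral_frac_quot K charK0 f monf smoothf b N 2
   (fun i => if i == 1%N then -1 else 0) nzc2 isT.
  move=> s t _ fst; rewrite /= big_ord_recl big_ord1 /= !horner0 !mul0r add0r.
  have := vanf_ev vN fst.
  by rewrite !(hornerD, hornerN, hornerM, horner_exp, hornerC) mulN1r mulNr.
have vEE : vanf f (E ^+ 2 - E).
  apply: (vanf_cancel monf (b := b ^+ 2)); first by rewrite expf_neq0.
  have -> : (b ^+ 2)%:P * (E ^+ 2 - E) =
     (N ^+ 2 - b%:P * N) - (N - b%:P * E) * (N + b%:P * E - b%:P).
    by rewrite polyC_exp; ring.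
  by apply: vanfB => //; apply: vanfMr.
case: (regular_idempotent ltE vEE) => EC; move: vE; rewrite EC ?mulr0 ?mulr1 ?subr0.
- move=> /vanfP fN; left; apply/vanfP.
  have: h * g0 %| U * g0 by apply: dvdp_trans fN; rewrite -cfE dvdpZl.
  rewrite dvdp_mul2r // => hU.
  have hb : h %| b%:P by rewrite -bez; apply: dvdp_add; [apply: dvdp_mulr | apply: dvdp_mulIr].
  have szh : size h = 1%N.
    have := dvdp_leq _ hb; rewrite polyC_eq0 size_polyC nzc2 => /(_ isT).
    by move=> le1; apply/eqP; rewrite eqn_leq le1 size_poly_gt0.
  have [c3 nzc3 hE] := size_poly1P _ (introT eqP szh).
  apply: (dvdp_trans _ (dvdp_gcdr f G)); rewrite -/g0.
  have : c *: f %| c3 *: g0 by rewrite cfE hE mul_polyC.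
  by rewrite dvdpZl // dvdpZr.
- have -> : N - b%:P = - (V * h) by rewrite -bez /N; ring.
  move=> /vanfN; rewrite opprK => /vanfP fN; right; apply/vanfP.
  have: h * g0 %| V * h by apply: dvdp_trans fN; rewrite -cfE dvdpZl.
  rewrite [V * h]mulrC dvdp_mul2l // => gV.
  have gb : g0 %| b%:P by rewrite -bez; apply: dvdp_add; [apply: dvdp_mulIr | apply: dvdp_mulr].
  have cfG : coprimep f G.
    rewrite /coprimep -/g0; have := dvdp_leq _ gb; rewrite polyC_eq0 size_polyC nzc2.
    by move=> /(_ isT) le1; rewrite eqn_leq le1 size_poly_gt0.
  by rewrite Gauss_dvdpr in fGH.
Qed.
End Charts.

(** * Forms on lines and in charts *)

Section Forms.
Variables (K : closedFieldType).
Hypothesis charK0 : [pchar K] =i pred0.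
Implicit Types (G H : {mpoly K[3]}) (u v w p a b : 'rV[K]_3) (x y z s t k : K).

Lemma meval_homog e G k v : G \is e.-homog -> G.@[(k *: v) 0] = k ^+ e * G.@[v 0].
Proof.
move=> /dhomogP hG; rewrite !mevalE mulr_sumr big_seq [RHS]big_seq.
apply: eq_bigr => m /hG mE; rewrite mulrCA; congr (_ * _).
under eq_bigr => i _ do rewrite mxE exprMn.
rewrite big_split /= prodrXr; congr (_ ^+ _ * _).
by rewrite -mE /= mdegE.
Qed.

(** The restriction of a form to the line v + t w, as a polynomial in t. *)
Definition online G v w : {poly K} :=
  mmap (@polyC K) (fun i => (v 0 i)%:P + (w 0 i) *: 'X) G.

Definition ddir G v w : K := \sum_i w 0 i * (G^`M(i)).@[v 0].

Lemma online_eval G v w t : (online G v w).[t] = G.@[(v + t *: w) 0].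
Proof.
rewrite /online /mmap horner_sum mevalE; apply: eq_bigr => m _.
rewrite hornerM hornerC /mmap1 horner_prod; congr (_ * _).
by apply: eq_bigr => i _; rewrite horner_exp hornerD hornerC hornerZ hornerX !mxE mulrC.
Qed.

Lemma online_deriv G v w t : (online G v w)^`().[t] = ddir G (v + t *: w) w.
Proof.
pose h i := (v 0 i)%:P + (w 0 i) *: 'X : {poly K}.
have dh i : (h i)^`() = (w 0 i)%:P by rewrite derivD derivC derivZ derivX add0r alg_polyC.
pose Q G := (mmap (@polyC K) h G)^`() = \sum_i (w 0 i)%:P * mmap (@polyC K) h G^`M(i).
have QD G1 G2 : Q G1 -> Q G2 -> Q (G1 + G2).
  rewrite /Q rmorphD derivD => -> ->; rewrite -big_split; apply: eq_bigr => i _.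
  by rewrite mderivD rmorphD mulrDr.
have QM G1 G2 : Q G1 -> Q G2 -> Q (G1 * G2).
  rewrite /Q rmorphM derivM => -> ->; rewrite mulr_suml mulr_sumr -big_split.
  by apply: eq_bigr => i _; rewrite mderivM rmorphD !rmorphM /=; ring.
have QC c : Q c%:MP.
  by rewrite /Q mmapC derivC big1 // => i _; rewrite mderivC rmorph0 mulr0.
have QX i : Q 'X_i.
  rewrite /Q mmapX mmap1U dh (bigD1 i) //= big1 ?addr0 => [|j nji].
    rewrite mderivX mnm1E eqxx scale1r (_ : (U_(i) - U_(i))%MM = 0%MM).
      by rewrite mpolyX0 rmorph1 mulr1.
    by apply/mnmP => k; rewrite mnmBE subnn mnm0E.
  by rewrite mderivX mnm1E eq_sym (negPf nji) scale0r rmorph0 mulr0.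
have QXn i n : Q ('X_i ^+ n).
  by elim: n => [|n IH]; [rewrite expr0 -mpolyC1; apply: QC | rewrite exprS; apply: QM].
have QG : Q G.
  elim/mpolyind: G => [|c m p _ _ Qp]; first by rewrite -mpolyC0; apply: QC.
  apply: QD => //; rewrite -mul_mpolyC; apply: (QM); first exact: QC.
  rewrite mpolyXE_id; apply: (big_ind Q) => [|G1 G2 q1 q2|i _]; [by have := QC 1; rewrite mpolyC1 | exact: QM | exact: QXn].
rewrite /online -/h QG horner_sum; apply: eq_bigr => i _.
rewrite hornerM hornerC; congr (_ * _).
by rewrite -/(online _ v w) online_eval.
Qed.

Lemma ddirD G v w w' : ddir G v (w + w') = ddir G v w + ddir G v w'.
Proof. by rewrite -big_split; apply: eq_bigr => i _; rewrite mxE mulrDl. Qed.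

Lemma ddirZ G v k w : ddir G v (k *: w) = k * ddir G v w.
Proof. by rewrite mulr_sumr; apply: eq_bigr => i _; rewrite mxE mulrA. Qed.

Lemma ddir_delta G v i : ddir G v (delta_mx 0 i) = (G^`M(i)).@[v 0].
Proof.
rewrite /ddir (bigD1 i) //= mxE !eqxx mul1r big1 ?addr0 // => j nji.
by rewrite mxE (negPf nji) andbF mul0r.
Qed.

Lemma online_homog e G v w t : G \is e.-homog -> t != 0 ->
  (online G v w).[t^-1] * t ^+ e = (online G w v).[t].
Proof.
move=> hG nzt; rewrite !online_eval mulrC -(meval_homog _ _ hG) scalerDr scalerA mulfV //.
by rewrite scale1r addrC.
Qed.

Lemma size_online e G v w : G \is e.-homog -> (size (online G v w) <= e.+1)%N.
Proof.
move=> hG; rewrite -[e.+1]subn0.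
apply: (@size_bound_at_infinity _ charK0 e 0 _ (online G w v)) => s nzs.
by rewrite expr0 mul1r mulrC (online_homog v w hG nzs).
Qed.

(** The leading coefficient is the value at the point at infinity of the line. *)
Lemma coef_online e G v w : G \is e.-homog -> (online G v w)`_e = G.@[w 0].
Proof.
move=> hG; have szL := size_online v w hG.
suff E : revp e (online G v w) = online G w v.
  have: (revp e (online G v w)).[0] = (online G w v).[0] by rewrite E.
  by rewrite horner_coef0 coef_poly subn0 online_eval scale0r addr0.
have: 'X * (revp e (online G v w) - online G w v) = 0.
  apply: (poly_eq0_ext charK0) => x; rewrite hornerM hornerX hornerD hornerN.
  have [->|nzx] := eqVneq x 0; first by rewrite mul0r.
  by rewrite revpE // (mulrC (x ^+ e)) (online_homog v w hG nzx) subrr mulr0.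
by move/eqP; rewrite mulf_eq0 polyX_eq0 subr_eq0 => /eqP.
Qed.

(** Euler: on the line v + t v through the origin a form is a multiple of
    (1 + t) ^ e. *)
Lemma euler_vanish e G v : G \is e.-homog -> G.@[v 0] = 0 -> ddir G v v = 0.
Proof.
move=> hG Gv; have := online_deriv G v v 0; rewrite scale0r addr0 => <-.
suff -> : online G v v = 0 by rewrite derivC horner0.
apply: (poly_eq0_ext charK0) => t; rewrite online_eval.
by rewrite -{1}[v]scale1r -scalerDl (meval_homog _ _ hG) Gv mulr0.
Qed.

(** The form restricted to the points t p + s a + b; the lines through p are
    the fibres s = constant. *)
Definition chart G p a b : {poly {poly K}} :=
  mmap (polyC \o @polyC K)
    (fun i => (p 0 i)%:P%:P * 'X + ((a 0 i) *: 'X + (b 0 i)%:P)%:P) G.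

Lemma chart_eval G p a b s t :
  ev2 (chart G p a b) s t = G.@[(t *: p + s *: a + b) 0].
Proof.
rewrite /chart /mmap !horner_sum mevalE; apply: eq_bigr => m _.
rewrite !hornerM !hornerC; congr (_ * _).
rewrite /mmap1 !horner_prod; apply: eq_bigr => i _.
by rewrite !(horner_exp, hornerD, hornerM, hornerC, hornerX, hornerZ) !mxE; congr (_ ^+ _); ring.
Qed.

Lemma fiber_chart G p a b s : fiber s (chart G p a b) = online G (s *: a + b) p.
Proof.
apply: (poly_eq_ext charK0) => t; rewrite fiberE chart_eval online_eval.
by rewrite -addrA addrC.
Qed.

Lemma chart_coef G p a b t : (chart G p a b).[t%:P] = online G (t *: p + b) a.
Proof.
apply: (poly_eq_ext charK0) => s; rewrite chart_eval online_eval.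
by rewrite addrAC.
Qed.

Lemma size_chart e G p a b : G \is e.-homog -> (size (chart G p a b) <= e.+1)%N.
Proof.
move=> hG; apply/leq_sizeP => j ltj; apply: (poly_eq0_ext charK0) => s.
rewrite -coef_fiber fiber_chart nth_default //.
exact: leq_trans (size_online _ _ hG) ltj.
Qed.

Lemma coef_chart e G p a b : G \is e.-homog -> (chart G p a b)`_e = (G.@[p 0])%:P.
Proof.
move=> hG; apply: (poly_eq_ext charK0) => s.
by rewrite -coef_fiber fiber_chart hornerC (coef_online _ _ hG).
Qed.

End Forms.

(** * Frames of the plane *)

Section Frames.
Variable K : fieldType.
Implicit Types (u v w p a b : 'rV[K]_3) (x y z s t k : K).

Definition row3 x y z : 'rV[K]_3 := \row_i nth 0 [:: x; y; z] i.
Definition frame p a b : 'M[K]_3 := \matrix_(i < 3) (nth 0 [:: p; a; b] i).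

Lemma row3_frame x y z p a b :
  row3 x y z *m frame p a b = x *: p + y *: a + z *: b.
Proof.
rewrite mulmx_sum_row !big_ord_recl big_ord0 addr0 !rowK !mxE /=.
by rewrite addrA.
Qed.

Lemma row3_eta v : v = row3 (v 0 0) (v 0 1) (v 0 2%:R).
Proof.
apply/rowP => i; rewrite mxE; case: i => [[|[|[|//]]] lti] /=; congr (v _ _); exact: val_inj.
Qed.

Lemma row3_inj x y z x' y' z' : row3 x y z = row3 x' y' z' -> [/\ x = x', y = y' & z = z'].
Proof.
move/rowP => e; split; [move: (e 0) | move: (e 1) | move: (e 2%:R)]; by rewrite !mxE.
Qed.

Lemma frame_span p a b v : frame p a b \in unitmx ->
  exists x y z, v = x *: p + y *: a + z *: b.
Proof.
move=> uB; have := mulmxKV uB v; rewrite [_ *m invmx _]row3_eta row3_frame => <-.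
by do 3![eexists].
Qed.

Lemma frame_free p a b x y z : frame p a b \in unitmx ->
  x *: p + y *: a + z *: b = 0 -> [/\ x = 0, y = 0 & z = 0].
Proof.
move=> uB; rewrite -row3_frame => /(congr1 (mulmx^~ (invmx (frame p a b)))).
rewrite mulmxK // mul0mx => e; apply: row3_inj.
by rewrite e; apply/rowP => i; rewrite !mxE; case: i => [[|[|[|//]]] lti].
Qed.

Lemma frame_coord p a b x y z : frame p a b \in unitmx ->
  (x *: p + y *: a + z *: b) *m invmx (frame p a b) = row3 x y z.
Proof. by move=> uB; rewrite -row3_frame mulmxK. Qed.

Lemma frameP p a b : 
  (forall x y z, x *: p + y *: a + z *: b = 0 -> [/\ x = 0, y = 0 & z = 0]) ->
  frame p a b \in unitmx.
Proof.
move=> fr; rewrite -row_free_unit -kermx_eq0; apply/eqP/row_matrixP => i.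
set w := row i _; have: w *m frame p a b = 0.
  by apply: sub_kermxP; apply: row_sub.
rewrite row0 [w]row3_eta row3_frame => /fr [-> -> ->].
by apply/rowP => j; rewrite !mxE; case: j => [[|[|[|//]]] lti].
Qed.

Lemma frame_swap p a b : frame p a b \in unitmx -> frame p b a \in unitmx.
Proof.
move=> uB; apply: frameP => x y z e; have [|-> -> ->] // := @frame_free p a b x z y uB.
by rewrite -e addrAC.
Qed.

Lemma frame_scale p a b k : k != 0 -> frame p a b \in unitmx -> frame (k *: p) a b \in unitmx.
Proof.
move=> nzk uB; apply: frameP => x y z; rewrite scalerA => e.
have [xk -> ->] := frame_free uB e; split=> //.
by apply/eqP; move: xk => /eqP; rewrite mulf_eq0 (negPf nzk) orbF.
Qed.

Lemma frame_extend p v : p != 0 -> ~~ (v <= p)%MS -> exists a, frame p a v \in unitmx.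
Proof.
move=> nzp nv; pose W := (p + v)%MS.
have ltW : (\rank W < 3)%N.
  have [le _] := mxrank_adds_leqif p v; rewrite (leq_ltn_trans le) // !rank_rV.
  by case: (_ != 0); case: (_ != 0).
have /existsP [i ni] : [exists i : 'I_3, ~~ ((delta_mx 0 i : 'rV[K]_3) <= W)%MS].
  rewrite -negb_forall; apply: contraL ltW => /forallP allW.
  have: (\rank (1%:M : 'M[K]_3) <= \rank W)%N.
    by apply: mxrankS; apply/row_subP => i; rewrite row1.
  by rewrite mxrank1 -leqNgt.
exists (delta_mx 0 i); apply: frameP => x y z e.
have y0 : y = 0.
  apply/eqP; apply/negPn/negP => nzy; move/negP: ni; apply.
  have -> : delta_mx 0 i = y^-1 *: (- (x *: p + z *: v)) :> 'rV[K]_3.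
    by apply: (scalerI nzy); rewrite scalerA mulfV // scale1r; apply/eqP; rewrite -addr_eq0 addrCA addrA e.
  rewrite scalemx_sub // eqmx_opp addmx_sub_adds // scalemx_sub //.
move: e; rewrite y0 scale0r addr0 => e.
have z0 : z = 0.
  apply/eqP; apply/negPn/negP => nzz; move/negP: nv; apply.
  have -> : v = z^-1 *: (- (x *: p)).
    by apply: (scalerI nzz); rewrite scalerA mulfV // scale1r; apply/eqP; rewrite -addr_eq0 addrC e.
  by rewrite scalemx_sub // eqmx_opp scalemx_sub.
move: e; rewrite z0 scale0r addr0 => /eqP; rewrite scaler_eq0 (negPf nzp) orbF.
by move/eqP=> ->.
Qed.

Lemma frame_exists p : p != 0 -> exists a b, frame p a b \in unitmx.
Proof.
move=> nzp; have /existsP [i ni] : [exists i : 'I_3, ~~ ((delta_mx 0 i : 'rV[K]_3) <= p)%MS].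
  rewrite -negb_forall; apply/negP => /forallP allW.
  have: (\rank (1%:M : 'M[K]_3) <= \rank p)%N.
    by apply: mxrankS; apply/row_subP => i; rewrite row1.
  by rewrite mxrank1 rank_rV; case: (_ != 0).
by have [a ua] := frame_extend nzp ni; exists a, (delta_mx 0 i).
Qed.
End Frames.

(** * The curve in a frame *)

Section Curve.
Variables (K : closedFieldType).
Hypothesis charK0 : [pchar K] =i pred0.
Variables (d : nat) (F : {mpoly K[3]}).
Hypothesis d_gt1 : (1 < d)%N.
Hypothesis smoothC : smooth_plane_curve F d.
Implicit Types (G H : {mpoly K[3]}) (u v w p a b : 'rV[K]_3) (x y z s t k : K).

Let homF : F \is d.-homog. Proof. by case: smoothC. Qed.

Lemma F_scale k v : F.@[(k *: v) 0] = k ^+ d * F.@[v 0].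
Proof. exact: meval_homog. Qed.

Lemma F_zero : F.@[(0 : 'rV[K]_3) 0] = 0.
Proof. by rewrite -(scale0r 0) F_scale expr0n gtn_eqF ?mul0r // ltnW. Qed.

Lemma smooth_dir v : v != 0 -> F.@[v 0] = 0 -> exists w, ddir F v w != 0.
Proof.
case: smoothC => _ _ sm nzv Fv; have [i nzi] := sm v nzv Fv.
by exists (delta_mx 0 i); rewrite ddir_delta.
Qed.

Lemma size_chartF p a b : F.@[p 0] = 1 -> size (chart F p a b) = d.+1.
Proof.
move=> Fp; have cd := coef_chart charK0 p a b homF; rewrite Fp in cd.
apply/eqP; rewrite eqn_leq (size_chart charK0 _ _ _ homF) /= ltnNge; apply/negP => led.
by move/eqP: cd; rewrite nth_default // eq_sym oner_eq0.
Qed.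

Lemma monic_chart p a b : F.@[p 0] = 1 -> chart F p a b \is monic.
Proof.
move=> Fp; rewrite monicE lead_coefE size_chartF //=.
by rewrite (coef_chart charK0 p a b homF) Fp.
Qed.

(** By Euler a point of the curve where both affine derivatives vanish is a
    singular point. *)
Lemma smooth_chart p a b : frame p a b \in unitmx ->
  forall s t, ev2 (chart F p a b) s t = 0 ->
  (ev2 (chart F p a b)^`() s t != 0) || (((chart F p a b).[t%:P])^`().[s] != 0).
Proof.
move=> uB s t; rewrite chart_eval chart_coef // online_deriv.
rewrite -fiberE /fiber -deriv_map -/(fiber s _) (fiber_chart charK0) online_deriv => Fv.
rewrite -negb_and; apply/negP => /andP [/eqP dp /eqP da].
have [v vE] : exists v, v = t *: p + s *: a + b by eexists.
rewrite -vE in Fv.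
have vE1 : s *: a + b + t *: p = v by rewrite vE addrC addrA.
have vE2 : t *: p + b + s *: a = v by rewrite vE addrAC.
rewrite vE1 in dp; rewrite vE2 in da.
have nzv : v != 0.
  apply/eqP => v0; have := @frame_free _ p a b t s 1 uB.
  by rewrite scale1r -vE v0 => /(_ erefl) [_ _ /eqP]; rewrite oner_eq0.
have dv : ddir F v v = 0 by apply: (euler_vanish charK0 homF).
have [w /eqP] := smooth_dir nzv Fv; apply.
have [x [y [z ->]]] := frame_span w uB.
have db : ddir F v b = 0.
  have -> : b = v + (- t) *: p + (- s) *: a.
    by apply/rowP => i; rewrite vE !mxE; ring.
  by rewrite !ddirD !ddirZ dv dp da !mulr0 !addr0.
by rewrite !ddirD !ddirZ dp da db !mulr0 !addr0.
Qed.

Lemma chart_changeF p a b s t : s != 0 ->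
  ev2 (chart F p b a) s t = 0 -> ev2 (chart F p a b) s^-1 (t / s) = 0.
Proof.
move=> nzs; rewrite !chart_eval => Fv.
have -> : t / s *: p + s^-1 *: a + b = s^-1 *: (t *: p + s *: b + a).
  by rewrite !scalerDr !scalerA mulVf // scale1r mulrC addrAC.
by rewrite F_scale Fv mulr0.
Qed.

Section InFrame.
Variables (p a b : 'rV[K]_3).
Hypotheses (uB : frame p a b \in unitmx) (Fp : F.@[p 0] = 1).
Let f := chart F p a b.
Let g := chart F p b a.
Let monf : f \is monic := monic_chart a b Fp.
Let mong : g \is monic := monic_chart b a Fp.
Let szf : size f = d.+1 := size_chartF a b Fp.
Let szg : size g = d.+1 := size_chartF b a Fp.
Let smf := smooth_chart uB.
Let smg := smooth_chart (frame_swap uB).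

(** Every line of the pencil s = constant meets the curve off p, as f is monic
    of positive degree in t. *)
Lemma affine_point s : exists t, F.@[(t *: p + s *: a + b) 0] = 0.
Proof.
have [t tE] : exists t, (fiber s f).[t] = 0.
  by apply: closed_root; rewrite size_fiber_monic // szf eqSS -lt0n ltnW.
by exists t; rewrite -chart_eval -fiberE.
Qed.

(** The part of the curve outside the chart lies on the line through p and a,
    where the second chart takes over: the form vanishes for s nonzero there,
    and the zeros of s are absorbed by [vanf_vanish]. *)
Lemma form_extend e G : G \is e.-homog ->
  (forall s t, F.@[(t *: p + s *: a + b) 0] = 0 -> G.@[(t *: p + s *: a + b) 0] = 0) ->
  forall v, F.@[v 0] = 0 -> G.@[v 0] = 0.
Proof.
move=> hG G0 v Fv; have [x [y [z vE]]] := frame_span v uB.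
have [z0|nzz] := eqVneq z 0; last first.
  have vE' : v = z *: ((x / z) *: p + (y / z) *: a + b).
    by rewrite !scalerDr !scalerA !(mulrC z) !divfK.
  rewrite vE' (meval_homog _ _ hG) G0 ?mulr0 //.
  move: Fv; rewrite vE' F_scale => /eqP; rewrite mulf_eq0 expf_eq0 (negPf nzz) andbF.
  by move/eqP.
have [y0|nzy] := eqVneq y 0; last first.
  have vE' : v = y *: ((x / y) *: p + 0 *: b + a).
    by rewrite vE z0 !scale0r !addr0 scalerDr scalerA mulrC divfK.
  have vG : vanf g (chart G p b a).
    apply: (vanf_vanish charK0 mong smg (b := 'X)); first by rewrite polyX_eq0.
    move=> s t; rewrite hornerX => nzs gst; rewrite chart_eval.
    have -> : t *: p + s *: b + a = s *: (t / s *: p + s^-1 *: a + b).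
      by rewrite !scalerDr !scalerA mulfV // scale1r (mulrC s) divfK // addrAC.
    by rewrite (meval_homog _ _ hG) G0 ?mulr0 // -chart_eval chart_changeF.
  rewrite vE' (meval_homog _ _ hG) -chart_eval (vanf_ev vG) ?mulr0 //.
  move: Fv; rewrite vE' F_scale chart_eval => /eqP; rewrite mulf_eq0 expf_eq0 (negPf nzy) andbF.
  by move/eqP.
have x0 : x = 0.
  move: Fv; rewrite vE z0 y0 !scale0r !addr0 F_scale Fp mulr1 => /eqP.
  by rewrite expf_eq0 => /andP [_ /eqP].
have [t Ft] := affine_point 0; rewrite vE x0 y0 z0 !scale0r !addr0.
rewrite -(scale0r (t *: p + 0 *: a + b)) (meval_homog _ _ hG).
by rewrite G0 ?mulr0.
Qed.

(** [curve_irreducible], transported to forms. *)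
Lemma forms_irreducible e e' G H : G \is e.-homog -> H \is e'.-homog ->
  (forall v, F.@[v 0] = 0 -> G.@[v 0] * H.@[v 0] = 0) ->
  (forall v, F.@[v 0] = 0 -> G.@[v 0] = 0) \/ (forall v, F.@[v 0] = 0 -> H.@[v 0] = 0).
Proof.
move=> hG hH GH0.
have: vanf f (chart G p a b * chart H p a b).
  apply: (vanf_vanish charK0 monf smf (b := 1)); first exact: oner_neq0.
  move=> s t _; rewrite !hornerM !chart_eval; exact: GH0.
have szfg : size g = size f by rewrite szf szg.
case/(curve_irreducible charK0 monf mong szfg smf smg) => [s t|||]; first exact: chart_changeF.
- by rewrite szf ltnS ltnW.
- move=> vG; left; apply: (form_extend hG) => s t Ft.
  by rewrite -chart_eval (vanf_ev vG) // chart_eval.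
- move=> vG; right; apply: (form_extend hH) => s t Ft.
  by rewrite -chart_eval (vanf_ev vG) // chart_eval.
Qed.

End InFrame.
End Curve.

(** * Linearity of fibre preserving maps *)

Section Lin.
Variable K : closedFieldType.
Implicit Types (M N : 'M[K]_3) (v : 'rV[K]_3).

(** The linear transformation v -> v M as a rational map. *)
Definition lin M : triple K := [tuple \sum_(j < 3) M j i *: 'X_j | i < 3].

Lemma ev_lin M v : ev (lin M) v = v *m M.
Proof.
apply/rowP => i; rewrite mxE tnth_mktuple raddf_sum mxE.
by apply: eq_bigr => j _; rewrite /= mevalZ mevalXU mulrC.
Qed.

Lemma lin_homog M i : tnth (lin M) i \is 1.-homog.
Proof.
rewrite tnth_mktuple rpred_sum // => j _; apply: dhomogZ.
by rewrite dhomogX /= mdeg1.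
Qed.

Lemma dhomog_comp_lin e (G : {mpoly K[3]}) M : G \is e.-homog -> G \mPo lin M \is e.-homog.
Proof.
move=> /dhomogP hG; rewrite comp_mpolyEX big_seq rpred_sum // => m /hG <-.
apply: dhomogZ; rewrite comp_mpolyX /= mdegE !big_ord_recl !big_ord0.
by do ![apply: dhomogM]; rewrite ?dhomog1 // -[X in X.-homog]mul1n; apply: dhomogMn; apply: lin_homog.
Qed.

Lemma comp_lin_eval (G : {mpoly K[3]}) M v : (G \mPo lin M).@[v 0] = G.@[(v *m M) 0].
Proof.
rewrite comp_mpoly_meval; apply: meval_eq => i.
by rewrite -ev_lin mxE.
Qed.
End Lin.

Section Curve.
Variables (K : closedFieldType).
Hypothesis charK0 : [pchar K] =i pred0.
Variables (d : nat) (F : {mpoly K[3]}).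
Hypothesis d_gt1 : (1 < d)%N.
Hypothesis smoothC : smooth_plane_curve F d.
Implicit Types (G H : {mpoly K[3]}) (u v w p a b : 'rV[K]_3) (x y z s t k : K).
Let homF : F \is d.-homog. Proof. by case: smoothC. Qed.

Section InFrame.
Variables (p a b : 'rV[K]_3).
Hypotheses (uB : frame p a b \in unitmx) (Fp : F.@[p 0] = 1).
Let f := chart F p a b.
Let g := chart F p b a.
Let monf : f \is monic := monic_chart charK0 smoothC a b Fp.
Let mong : g \is monic := monic_chart charK0 smoothC b a Fp.
Let szf : size f = d.+1 := size_chartF charK0 smoothC a b Fp.
Let szg : size g = d.+1 := size_chartF charK0 smoothC b a Fp.
Let szgf : size g = size f. Proof. by rewrite szf szg. Qed.
Let smf := smooth_chart charK0 smoothC uB.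
Let smg := smooth_chart charK0 smoothC (frame_swap uB).
Let deg_f : (1 < size f)%N. Proof. by rewrite szf ltnS ltnW. Qed.

Let f_irr (G H : {poly {poly K}}) : vanf f (G * H) -> vanf f G \/ vanf f H.
Proof.
exact: (curve_irreducible charK0 monf mong szgf smf smg (chart_changeF smoothC (p := p) (a := a) (b := b)) deg_f).
Qed.

(** In the chart this map keeps s and sends t to c t + al s + be. *)
Definition hmx (c al be : K) : 'M[K]_3 :=
  invmx (frame p a b) *m frame (c *: p) (a + al *: p) (b + be *: p).

Lemma hmxE c al be x y z :
  (x *: p + y *: a + z *: b) *m hmx c al be = (c * x + al * y + be * z) *: p + y *: a + z *: b.
Proof.
rewrite mulmxA frame_coord // row3_frame.
by apply/rowP => i; rewrite !mxE; ring.
Qed.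

Lemma hmx_unit c al be : c != 0 -> hmx c al be \in unitmx.
Proof.
move=> nzc; rewrite unitmx_mul unitmx_inv uB /=; apply: frameP => x y z e.
have [|cx y0 z0] := @frame_free _ p a b (c * x + al * y + be * z) y z uB.
  by rewrite -e; apply/rowP => i; rewrite !mxE; ring.
split=> //; move/eqP: cx; rewrite y0 z0 !mulr0 !addr0 mulf_eq0 (negPf nzc).
by move/eqP.
Qed.

Lemma monic_poly_eval (h : {poly {poly K}}) s x : h \is monic -> size h = d.+1 ->
  ev2 h s x = x ^+ d + \sum_(i < d) (h`_i).[s] * x ^+ i.
Proof.
move=> monh szh; have hd : h`_d = 1 by have := monicP monh; rewrite lead_coefE szh.
rewrite -fiberE (horner_coef_wide _ (n := d.+1)); last by rewrite -szh size_fiber.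
rewrite big_ord_recr /= addrC coef_fiber hd hornerC mul1r; congr (_ + _).
by apply: eq_bigr => i _; rewrite coef_fiber.
Qed.

Section Map.
Variables (e : nat) (A : triple K).
Hypothesis hA : forall i, tnth A i \is e.-homog.
Hypothesis AC : forall v, F.@[v 0] = 0 -> F.@[ev A v 0] = 0.
Hypothesis AP : forall s t, F.@[(t *: p + s *: a + b) 0] = 0 ->
  exists c k, ev A (t *: p + s *: a + b) = c *: p + k *: (t *: p + s *: a + b).
Hypothesis Anz : exists2 v : 'rV[K]_3, F.@[v 0] = 0 & ev A v != 0.

(* The coordinates, in the frame p, a, b, of the image of the point (s, t). *)
Let cp (j : 'I_3) : {poly {poly K}} :=
  \sum_i chart (tnth A i) p a b * ((invmx (frame p a b)) i j)%:P%:P.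
Let cpE j s t : ev2 (cp j) s t = (ev A (t *: p + s *: a + b) *m invmx (frame p a b)) 0 j.
Proof.
rewrite /cp !horner_sum mxE; apply: eq_bigr => i _.
by rewrite !hornerM !hornerC chart_eval mxE.
Qed.
Let a0 := cp 0.
Let a2 := cp 2%:R.

Let curve_ev s t : ev2 f s t = 0 ->
  ev A (t *: p + s *: a + b) = ev2 a0 s t *: p + (s * ev2 a2 s t) *: a + ev2 a2 s t *: b.
Proof.
rewrite chart_eval => Ft; have [c [k AE]] := AP Ft; rewrite !cpE AE.
have -> : c *: p + k *: (t *: p + s *: a + b) = (c + k * t) *: p + (k * s) *: a + k *: b.
  by apply/rowP => i; rewrite !mxE; ring.
by rewrite frame_coord // !mxE /= (mulrC s).
Qed.

(* Otherwise the image of the curve under A would be the point p, which is not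
   on the curve. *)
Let a2_nz : ~ vanf f a2.
Proof.
move=> va; case: Anz => v Fv /eqP; apply; apply/rowP => i; rewrite !mxE.
apply: (form_extend charK0 d_gt1 smoothC uB Fp (hA i)) Fv => s t Ft.
have fst : ev2 f s t = 0 by rewrite chart_eval.
have := AC Ft; rewrite curve_ev // (vanf_ev va) // mulr0 !scale0r !addr0.
rewrite (F_scale smoothC) Fp mulr1 => /eqP; rewrite expf_eq0 => /andP [_ /eqP a00].
have := curve_ev fst; rewrite a00 (vanf_ev va) // mulr0 !scale0r !addr0.
by move/rowP/(_ i); rewrite !mxE.
Qed.

Let bezout : exists V (c : {poly K}), c != 0 /\ vanf f (V * a2 - c%:P).
Proof.
Import Pdiv.Idomain.
have cop : coprimep f a2.
  have /dvdpP [[c h] /= nzc cfE] : gcdp f a2 %| f by apply: dvdp_gcdl.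
  have nzf : f != 0 by apply: monic_neq0.
  have nzhg : h * gcdp f a2 != 0 by rewrite -cfE scale_poly_eq0 negb_or nzc.
  have [nzh nzg] : h != 0 /\ gcdp f a2 != 0 by move: nzhg; rewrite mulf_eq0 negb_or => /andP.
  have [] : vanf f h \/ vanf f (gcdp f a2).
  - by apply: f_irr; exists c%:P; rewrite mul_polyC cfE.
  - move=> vh; have leh : (size f <= size h)%N.
      by rewrite leqNgt; apply/negP => /(vanf_small monf vh) h0; rewrite h0 eqxx in nzh.
    have szE : (size h + size (gcdp f a2)).-1 = size f.
      by rewrite -(size_mul nzh nzg) -cfE size_scale.
    rewrite /coprimep; apply/eqP; move: nzg; rewrite -size_poly_gt0 => nzg.
    exact: size_cofactor szE leh nzg deg_f.
  - move/(vanfP monf) => fg; case: a2_nz; apply/(vanfP monf).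
    exact: dvdp_trans fg (dvdp_gcdr _ _).
have /Bezout_coprimepP [[u v] /= /eqpP [[c1 c2] /= /andP [nzc1 nzc2] bez]] := cop.
exists (c1%:P * v), c2; split=> //; exists (- (c1%:P * u)).
by rewrite -[c2%:P]alg_polyC -bez -mul_polyC; ring.
Qed.

(** The map sends (s, t) to (s, a0 / a2), and a0 / a2 is again a root of the
    monic polynomial f(s). With a2 inverted up to a polynomial bb(s), normality
    gives a polynomial E with a0 = a2 E on the curve; the same argument at
    infinity bounds E by weight one, so E = ga t + al s + be. If ga were zero,
    f(s) would have a root E(s) linear in s and the curve would be reducible. *)
Lemma fibre_map_linear : exists M : 'M[K]_3, [/\ M \in unitmx, (forall v, exists c, v *m M = v + c *: p),
  (forall v : 'rV[K]_3, F.@[v 0] = 0 -> F.@[(v *m M) 0] = 0) &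
  (forall v : 'rV[K]_3, F.@[v 0] = 0 -> forall i j, ev A v 0 i * (v *m M) 0 j = ev A v 0 j * (v *m M) 0 i)].
Proof.
have [V [bb [nzbb bez]]] := bezout; pose N := V * a0.
have bezE s t : ev2 f s t = 0 -> ev2 V s t * ev2 a2 s t = bb.[s].
  move=> fst; have := vanf_ev bez fst.
  by rewrite hornerD hornerN hornerM hornerD hornerN hornerM !hornerC => /eqP; rewrite subr_eq0 => /eqP.
have gE s t : bb.[s] != 0 -> ev2 f s t = 0 -> ev2 f s (ev2 a0 s t / ev2 a2 s t) = 0.
  move=> nzb fst; have nza : ev2 a2 s t != 0.
    by apply: contraNneq nzb => a20; rewrite -(bezE s t fst) a20 mulr0.
  have := AC (etrans (esym (chart_eval _ _ _ _ _ _)) fst); rewrite curve_ev //.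
  rewrite chart_eval.
  have -> : ev2 a0 s t *: p + (s * ev2 a2 s t) *: a + ev2 a2 s t *: b =
     ev2 a2 s t *: ((ev2 a0 s t / ev2 a2 s t) *: p + s *: a + b).
    by rewrite !scalerDr !scalerA (mulrC (ev2 a2 s t)) divfK // (mulrC s).
  rewrite (F_scale smoothC) => /eqP; rewrite mulf_eq0 expf_eq0 (negPf nza) andbF.
  by move/eqP.
have [|E [ltE vE]] := @integral_frac_quot K charK0 f monf smf bb N d (fun i => (f`_i)%:P) nzbb (ltnW d_gt1).
  move=> s t nzb fst; have := gE s t nzb fst; rewrite (monic_poly_eval _ _ monf szf) => rel.
  have nza : ev2 a2 s t != 0.
    by apply: contraNneq nzb => a20; rewrite -(bezE s t fst) a20 mulr0.
  have NE : ev2 N s t = bb.[s] * (ev2 a0 s t / ev2 a2 s t).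
    by rewrite -(bezE s t fst) /N !hornerM; field.
  rewrite NE; move: rel; set q := _ / _ => rel.
  transitivity (bb.[s] ^+ d * (q ^+ d + \sum_(i < d) (f`_i).[s] * q ^+ i)); last by rewrite rel mulr0.
  rewrite mulrDr mulr_sumr exprMn; congr (_ + _); apply: eq_bigr => i _.
  have -> : bb.[s] ^+ d = bb.[s] ^+ (d - i) * bb.[s] ^+ i by rewrite -exprD subnK // ltnW.
  by rewrite hornerC exprMn; ring.
have a0E s t : bb.[s] != 0 -> ev2 f s t = 0 -> ev2 a0 s t = ev2 a2 s t * ev2 E s t.
  move=> nzb fst; have nzV : ev2 V s t != 0.
    by apply: contraNneq nzb => V0; rewrite -(bezE s t fst) V0 mul0r.
  apply: (mulfI nzV); rewrite mulrA (bezE s t fst); apply/eqP; rewrite -subr_eq0; apply/eqP.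
  have := vanf_ev vE fst; rewrite !(hornerD, hornerN) /N !hornerM hornerC => <-; ring.
have va0 : vanf f (a0 - a2 * E).
  apply: (vanf_vanish charK0 monf smf nzbb) => s t nzb fst.
  by rewrite !(hornerD, hornerN) !hornerM a0E // subrr.
have comp_ev (h q : {poly {poly K}}) s t : ev2 (h \Po q) s t = ev2 h s (ev2 q s t).
  rewrite horner_comp -fiberE /fiber -[ev2 q s t]/(horner_eval s q.[t%:P]).
  by rewrite horner_map.
have vfE : vanf f (f \Po E).
  apply: (vanf_vanish charK0 monf smf nzbb) => s t nzb fst; rewrite comp_ev.
  have nza : ev2 a2 s t != 0.
    by apply: contraNneq nzb => a20; rewrite -(bezE s t fst) a20 mulr0.
  have := gE s t nzb fst; rewrite (a0E s t) // (mulrC (ev2 a2 s t)) mulfK //.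
(* in the chart at infinity s E(1 / s, t / s) is a root of the monic polynomial g(s) *)
have bound : forall i, (size (E`_i)%R <= 2 - i)%N.
  apply: (chart_bound charK0 monf mong szgf smg (w := 1) (E := E) (n := d) (c := fun i => (g`_i)%:P)) => //; first exact: ltnW.
  move=> s t nzs gst; rewrite /= expr1; set q := s * _.
  under eq_bigr => i _ do rewrite hornerC.
  rewrite -(monic_poly_eval _ _ mong szg) chart_eval.
  have := vanf_ev vfE (chart_changeF smoothC nzs gst); rewrite comp_ev chart_eval.
  have -> : q *: p + s *: b + a = s *: (ev2 E s^-1 (t / s) *: p + s^-1 *: a + b).
    by rewrite !scalerDr !scalerA mulfV // scale1r addrAC.
  by rewrite (F_scale smoothC) => ->; rewrite mulr0.
pose ga := (E`_1)`_0; pose al := (E`_0)`_1; pose be := (E`_0)`_0.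
have Eev s t : ev2 E s t = ga * t + al * s + be * 1.
  rewrite -fiberE (horner_coef_wide _ (n := 2)); last first.
    apply: leq_trans (size_fiber _ _) _; apply/leq_sizeP => j ltj.
    by apply/eqP; rewrite -size_poly_leq0 (leq_trans (bound j)) // leqn0 subn_eq0.
  rewrite big_ord_recl big_ord1 !coef_fiber /= expr0 expr1 mulr1.
  rewrite (horner_coef_wide s (bound 0%N)) big_ord_recl big_ord1 /= expr0 expr1.
  rewrite (horner_coef_wide s (bound 1%N)) big_ord1 /= expr0 /ga /al /be; ring.
have nzga : ga != 0.
  apply/eqP => ga0; have fE0 : f.[E`_0] = 0.
    apply: (poly_eq0_ext charK0) => s.
    have [t Ft] := affine_point charK0 d_gt1 smoothC a b Fp s.
    have fst : ev2 f s t = 0 by rewrite chart_eval.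
    have := vanf_ev vfE fst; rewrite comp_ev -fiberE Eev ga0 mul0r add0r.
    have -> : al * s + be * 1 = (E`_0).[s].
      by rewrite (horner_coef_wide s (bound 0%N)) big_ord_recl big_ord1 /= expr0 expr1 /al /be; ring.
    by rewrite /fiber -[(E`_0).[s]]/(horner_eval s E`_0) horner_map.
  have /factor_theorem [Q QE] : root f E`_0 by apply/rootP.
  have nzQ : Q != 0 by apply: contraTneq (monic_neq0 monf) => Q0; rewrite QE Q0 mul0r eqxx.
  have szQ : size Q = d.
    by have := szf; rewrite QE size_Mmonic ?monicXsubC // size_XsubC addn2 => -[].
  have [] : vanf f Q \/ vanf f ('X - (E`_0)%:P).
  - by apply: f_irr; rewrite -QE; apply: vanf_self.
  - by move/(vanf_small monf); rewrite szQ szf ltnS leqnn => /(_ isT)/eqP; apply/negP.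
  - move/(vanf_small monf); rewrite size_XsubC szf ltnS => /(_ d_gt1)/eqP.
    by rewrite polyXsubC_eq0.
exists (hmx ga al be).
have hE s t : (t *: p + s *: a + b) *m hmx ga al be = ev2 E s t *: p + s *: a + b.
  by rewrite Eev -[in LHS](scale1r b) hmxE scale1r.
split.
- exact: hmx_unit.
- move=> v; have [x [y [z ->]]] := frame_span v uB; rewrite hmxE.
  exists (ga * x + al * y + be * z - x).
  by apply/rowP => i; rewrite !mxE; ring.
- move=> v Fv; rewrite -comp_lin_eval.
  apply: (form_extend charK0 d_gt1 smoothC uB Fp (dhomog_comp_lin _ homF)) Fv => s t Ft.
  rewrite comp_lin_eval hE -chart_eval -comp_ev; apply: (vanf_ev vfE).
  by rewrite chart_eval.
- move=> v Fv i j; apply/eqP; rewrite -subr_eq0; apply/eqP.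
  pose G := tnth A i * tnth (lin (hmx ga al be)) j - tnth A j * tnth (lin (hmx ga al be)) i.
  have hG : G \is (e + 1).-homog.
    by apply: rpredB; apply: dhomogM => //; apply: lin_homog.
  have GE u : G.@[u 0] = ev A u 0 i * (u *m hmx ga al be) 0 j - ev A u 0 j * (u *m hmx ga al be) 0 i.
    by rewrite rmorphB !rmorphM /= -!ev_lin ![in RHS]mxE.
  rewrite -GE; apply: (form_extend charK0 d_gt1 smoothC uB Fp hG) Fv => s t Ft.
  have fst : ev2 f s t = 0 by rewrite chart_eval.
  rewrite GE curve_ev // hE.
  have := vanf_ev va0 fst; rewrite !(hornerD, hornerN) !hornerM => /eqP; rewrite subr_eq0 => /eqP ->.
  rewrite !mxE; ring.
Qed.
End Map.
End InFrame.
End Curve.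

(** * Homologies preserving the curve *)

Section Homologies.
Variable K : fieldType.
Implicit Types (M N : 'M[K]_3) (u v w p : 'rV[K]_3) (ph : 'cV[K]_3) (x y z k : K).

(** Covectors are columns: the axis of a homology is the line dot v ph = 0. *)
Definition dot v ph : K := (v *m ph) 0 0.

Lemma dotD u v ph : dot (u + v) ph = dot u ph + dot v ph.
Proof. by rewrite /dot mulmxDl mxE. Qed.
Lemma dotZ k v ph : dot (k *: v) ph = k * dot v ph.
Proof. by rewrite /dot -scalemxAl mxE. Qed.
Lemma dot0 ph : dot 0 ph = 0.
Proof. by rewrite /dot mul0mx mxE. Qed.
Lemma dotZr k v ph : dot v (k *: ph) = k * dot v ph.
Proof. by rewrite /dot -scalemxAr mxE. Qed.
Lemma dotM v M ph : dot (v *m M) ph = dot v (M *m ph).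
Proof. by rewrite /dot mulmxA. Qed.

(** The homology with centre p, axis ph and multiplier z, when dot p ph = 1. *)
Definition hom p ph z : 'M[K]_3 := 1%:M + (z - 1) *: (ph *m p).

Lemma homE v p ph z : v *m hom p ph z = v + ((z - 1) * dot v ph) *: p.
Proof.
rewrite /hom mulmxDr mulmx1 -scalemxAr mulmxA; congr (_ + _).
by rewrite [v *m ph]mx11_scalar mul_scalar_mx scalerA.
Qed.

Lemma mx_ext M N : (forall v, v *m M = v *m N) -> M = N.
Proof. by move=> e; apply/row_matrixP => i; rewrite !rowE. Qed.

Lemma hom1 p ph : hom p ph 1 = 1%:M.
Proof. by rewrite /hom subrr scale0r addr0. Qed.

Lemma hom_mul p ph z y : dot p ph = 1 -> hom p ph z *m hom p ph y = hom p ph (z * y).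
Proof.
move=> pp; apply: mx_ext => v; rewrite mulmxA !homE dotD dotZ pp -addrA -scalerDl.
by congr (_ + _ *: _); ring.
Qed.

Lemma hom_center p ph z : dot p ph = 1 -> p *m hom p ph z = z *: p.
Proof. by move=> pp; rewrite homE pp mulr1 scalerBl scale1r addrCA subrr addr0. Qed.

Lemma hom_inj p ph z y : dot p ph = 1 -> hom p ph z = hom p ph y -> z = y.
Proof.
move=> pp /(congr1 (mulmx p)); rewrite !hom_center // => /eqP.
rewrite -subr_eq0 -scalerBl scaler_eq0 subr_eq0 => /orP [/eqP //|/eqP p0].
by move: pp; rewrite p0 dot0 => /eqP; rewrite eq_sym oner_eq0.
Qed.

Lemma hom_fix p ph z v : dot v ph = 0 -> v *m hom p ph z = v.
Proof. by move=> v0; rewrite homE v0 mulr0 scale0r addr0. Qed.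

(** Every line through p is preserved; this is the linear form of preserving the
    fibres of the projection from p. *)
Definition along p M := forall v, exists c, v *m M = v + c *: p.

Lemma alongM p M N : along p M -> along p N -> along p (M *m N).
Proof.
move=> aM aN v; rewrite mulmxA; have [c ->] := aM v; rewrite mulmxDl -scalemxAl.
have [c' ->] := aN v; have [c'' ->] := aN p.
by exists (c' + c * (1 + c'')); rewrite !scalerDr !scalerA !scalerDl mulrDr mulr1 scalerDl -addrA.
Qed.

Lemma alongV p M : M \in unitmx -> along p M -> along p (invmx M).
Proof.
move=> uM aM v; have [c] := aM (v *m invmx M); rewrite mulmxKV // => vE.
by exists (- c); apply/eqP; rewrite scaleNr eq_sym subr_eq -vE.
Qed.

Lemma along_hom p ph z : along p (hom p ph z).
Proof. by move=> v; rewrite homE; eexists. Qed.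

Lemma dual_exists p : p != 0 -> exists ph, dot p ph = 1.
Proof.
move=> nzp; have /rV0Pn [i nzi] := nzp.
exists ((p 0 i)^-1 *: delta_mx i 0); rewrite dotZr /dot -colE mxE.
by rewrite mulVf.
Qed.

Lemma along_functional p M : p != 0 -> along p M ->
  exists ph, forall v, v *m M = v + dot v ph *: p.
Proof.
move=> nzp aM; have [q pq] := dual_exists nzp.
exists ((M - 1%:M) *m q) => v; have [c vM] := aM v; rewrite vM; congr (_ + _ *: _).
by rewrite -dotM mulmxBr mulmx1 vM addrAC subrr add0r dotZ pq mulr1.
Qed.
End Homologies.

Section Curve.
Variables (K : closedFieldType).
Hypothesis charK0 : [pchar K] =i pred0.
Variables (d : nat) (F : {mpoly K[3]}).
Hypothesis d_gt1 : (1 < d)%N.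
Hypothesis smoothC : smooth_plane_curve F d.
Implicit Types (G H : {mpoly K[3]}) (u v w p a b : 'rV[K]_3) (x y z s t k : K) (M N : 'M[K]_3) (ph : 'cV[K]_3).
Let homF : F \is d.-homog. Proof. by case: smoothC. Qed.

Lemma root_of_exists n k : (0 < n)%N -> exists x : K, x ^+ n = k.
Proof.
move=> n_gt0; have [|x] := @closed_root K ('X^n - k%:P).
  by rewrite size_XnsubC // eqSS -lt0n.
by rewrite !hornerE ?hornerXn => /eqP; rewrite subr_eq0 => /eqP; exists x.
Qed.

(** Linear automorphisms of the curve; c allows for rescaling. *)
Definition autC M := M \in unitmx /\ exists2 c, c != 0 & forall v, F.@[(v *m M) 0] = c * F.@[v 0].

Lemma autC1 : autC 1%:M.
Proof. by split; [apply: unitmx1 | exists 1; rewrite ?oner_neq0 // => v; rewrite mulmx1 mul1r]. Qed.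

Lemma autCM M N : autC M -> autC N -> autC (M *m N).
Proof.
case=> uM [c nzc FM] [uN [c' nzc' FN]]; split; first by rewrite unitmx_mul uM.
by exists (c' * c); rewrite ?mulf_neq0 // => v; rewrite mulmxA FN FM mulrA.
Qed.

Lemma autCV M : autC M -> autC (invmx M).
Proof.
case=> uM [c nzc FM]; split; first by rewrite unitmx_inv.
by exists c^-1; rewrite ?invr_eq0 // => v; rewrite -{2}[v](mulmxKV uM) FM mulKf.
Qed.

Lemma autCZ k M : k != 0 -> autC M -> autC (k *: M).
Proof.
move=> nzk [uM [c nzc FM]]; split; first by rewrite unitmxZ ?unitfE.
exists (k ^+ d * c); rewrite ?mulf_neq0 ?expf_neq0 // => v.
by rewrite -scalemxAr (F_scale smoothC) FM mulrA.
Qed.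

Lemma autC_zero M v : autC M -> (F.@[(v *m M) 0] == 0) = (F.@[v 0] == 0).
Proof. by case=> _ [c nzc ->]; rewrite mulf_eq0 (negPf nzc). Qed.

Lemma nz_of_F v : F.@[v 0] != 0 -> v != 0.
Proof. by apply: contraNneq => ->; rewrite (F_zero d_gt1 smoothC). Qed.

Section Center.
Variable p : 'rV[K]_3.
Hypothesis Fp : F.@[p 0] != 0.

Lemma normalize_center : exists2 k, k != 0 & F.@[(k *: p) 0] = 1.
Proof.
have [k kE] := @root_of_exists d (F.@[p 0])^-1 (ltnW d_gt1).
exists k; last by rewrite (F_scale smoothC) kE mulVf.
by apply: contra_eq_neq kE => ->; rewrite expr0n gtn_eqF ?(ltnW d_gt1) // eq_sym invr_eq0.
Qed.

(** In a chart centred at p, both F and its transform have degree d in t and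
    constant leading coefficients, so they are proportional as soon as one
    vanishes where the other does. *)
Lemma along_autC M : M \in unitmx -> along p M ->
  (forall v, F.@[v 0] = 0 -> F.@[(v *m M) 0] = 0) -> autC M.
Proof.
move=> uM aM F0; have [k nzk Fkp] := normalize_center.
have [c pM] := aM p; pose g := 1 + c.
have {}pM : p *m M = g *: p by rewrite pM /g scalerDl scale1r.
have nzp := nz_of_F Fp.
have nzg : g != 0.
  apply: contraNneq nzp => g0; move: pM; rewrite g0 scale0r => /(congr1 (mulmx^~ (invmx M))).
  by rewrite mulmxK // mul0mx => ->.
split=> //; exists (g ^+ d); rewrite ?expf_neq0 // => v.
have [/sub_rVP [x ->]|nv] := boolP (v <= p)%MS.
  by rewrite -scalemxAl pM scalerA mulrC -scalerA (F_scale smoothC).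
have [a ua] : exists a, frame (k *: p) a v \in unitmx.
  have [a ua] := frame_extend nzp nv; exists a; exact: frame_scale.
pose f := chart F (k *: p) a v; pose f' := chart (F \mPo lin M) (k *: p) a v.
have monf := monic_chart charK0 smoothC a v Fkp.
have hF' : F \mPo lin M \is d.-homog by apply: dhomog_comp_lin.
have vf' : vanf f (f' - (g ^+ d)%:P%:P * f).
  apply: vanfB; last by apply/vanfMl/vanf_self.
  apply: (vanf_vanish charK0 monf (smooth_chart charK0 smoothC ua) (b := 1)); first exact: oner_neq0.
  by move=> s t _; rewrite !chart_eval comp_lin_eval; apply: F0.
have: f' - (g ^+ d)%:P%:P * f = 0.
  apply: (vanf_small monf vf'); rewrite (size_chartF charK0 smoothC) // ltnS.
  apply/leq_sizeP => j; rewrite leq_eqVlt => /orP [/eqP <-|ltj].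
    rewrite coefB coefCM (coef_chart charK0 _ _ _ hF') (coef_chart charK0 _ _ _ homF).
    by rewrite comp_lin_eval -scalemxAl pM scalerA mulrC -scalerA (F_scale smoothC) Fkp -polyCM subrr.
  rewrite coefB coefCM !nth_default ?mulr0 ?subr0 //.
    exact: leq_trans (size_chart charK0 _ _ _ homF) ltj.
  exact: leq_trans (size_chart charK0 _ _ _ hF') ltj.
move=> /(congr1 (fun q : {poly {poly K}} => ev2 q 0 0)).
rewrite !(hornerD, hornerN) !hornerM !hornerC ?horner0 !chart_eval comp_lin_eval !scale0r !add0r.
by move/eqP; rewrite subr_eq0 => /eqP.
Qed.

Lemma line_meets_curve v : exists t, F.@[(v + t *: p) 0] = 0.
Proof.
have nzc : (online F v p)`_d != 0 by rewrite (coef_online charK0 _ _ homF).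
have sz : size (online F v p) = d.+1.
  apply/eqP; rewrite eqn_leq (size_online charK0 _ _ homF) /= ltnNge.
  by apply: contra nzc => le; rewrite nth_default.
have [|t Ft] := @closed_root K (online F v p); first by rewrite sz eqSS gtn_eqF // ltnW.
by exists t; rewrite -online_eval.
Qed.

Lemma online_nz v : online F v p != 0.
Proof. by apply: contraNneq Fp => e; rewrite -(coef_online charK0 v p homF) e coef0. Qed.

(** An elation moves a point w of the curve to w + k c p for all natural numbers
    k, and in characteristic zero the line through w and p would then lie in the
    curve. *)
Lemma no_translation M : autC M -> along p M -> p *m M = p -> M = 1%:M.
Proof.
move=> aM alM pM; have nzp := nz_of_F Fp.
have [ph phE] := along_functional nzp alM.
have pph : dot p ph = 0.
  by move: (phE p); rewrite pM -{1}[p]addr0 => /addrI /esym/eqP; rewrite scaler_eq0 (negPf nzp) orbF => /eqP.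
apply: mx_ext => v; rewrite mulmx1 phE.
suff -> : dot v ph = 0 by rewrite scale0r addr0.
apply/eqP; apply/negPn/negP => nzv.
have [t Ft] := line_meets_curve v; set w := v + t *: p in Ft.
have wE : dot w ph = dot v ph by rewrite dotD dotZ pph mulr0 addr0.
have Fk (k : nat) : F.@[(w + (k%:R * dot v ph) *: p) 0] = 0.
  elim: k => [|k IH]; first by rewrite mul0r scale0r addr0.
  apply/eqP; have <- : (w + (k%:R * dot v ph) *: p) *m M = w + (k.+1%:R * dot v ph) *: p.
    rewrite phE dotD dotZ pph mulr0 addr0 wE -addrA -scalerDl; congr (_ + _ *: _).
    by rewrite -natr1; ring.
  by rewrite autC_zero // IH.
have nzq := online_nz w.
pose rs := [seq (i : nat)%:R * dot v ph | i <- iota 0 (size (online F w p))].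
have: (size rs < size (online F w p))%N.
  apply: max_poly_roots => //.
    by apply/allP => _ /mapP [k _ ->]; apply/rootP; rewrite online_eval.
  rewrite map_inj_uniq ?iota_uniq // => i j /(mulIf nzv); exact: natr_inj.
by rewrite size_map size_iota ltnn.
Qed.

(** If the curve lay in the line ph = 0, every line through p would meet it in
    one point with multiplicity d > 1, and it would be singular everywhere. *)
Lemma point_off_axis ph : dot p ph = 1 -> exists2 v : 'rV[K]_3, F.@[v 0] = 0 & dot v ph != 0.
Proof.
move=> pph; apply: contrapT => no.
have onaxis v : F.@[v 0] = 0 -> dot v ph = 0.
  by move=> Fv; apply/eqP; apply/negPn/negP => nz; apply: no; exists v.
have Faxis v : dot v ph = 0 -> F.@[v 0] = 0.
  move=> v0; have [t Ft] := line_meets_curve v; have := onaxis _ Ft.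
  by rewrite dotD dotZ pph v0 add0r mulr1 => t0; rewrite -Ft t0 scale0r addr0.
have nzp := nz_of_F Fp; have [a [b ua]] := frame_exists nzp.
pose v0 := a - dot a ph *: p.
have v0ph : dot v0 ph = 0 by rewrite /v0 -scaleNr dotD dotZ pph mulr1 subrr.
have nzv0 : v0 != 0.
  apply/eqP => e; have [] := @frame_free _ p a b (- dot a ph) 1 0 ua.
    by rewrite scale1r scale0r addr0 scaleNr addrC.
  by move=> _ /eqP; rewrite oner_eq0.
have [w /eqP] := smooth_dir smoothC nzv0 (Faxis _ v0ph); apply.
have -> : w = (w - dot w ph *: p) + dot w ph *: p by rewrite subrK.
have dax u : dot u ph = 0 -> ddir F v0 u = 0.
  move=> u0; have := online_deriv F v0 u 0; rewrite scale0r addr0 => <-.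
  suff -> : online F v0 u = 0 by rewrite derivC horner0.
  apply: (poly_eq0_ext charK0) => t; rewrite online_eval; apply: Faxis.
  by rewrite dotD dotZ v0ph u0 mulr0 addr0.
have dp : ddir F v0 p = 0.
  have := online_deriv F v0 p 0; rewrite scale0r addr0 => <-.
  have q0 x : (online F v0 p).[x] = 0 -> x = 0.
    by rewrite online_eval => /onaxis; rewrite dotD dotZ v0ph pph add0r mulr1.
  have [q1 q1E] : exists q1, online F v0 p = q1 * 'X.
    have /factor_theorem [q] : root (online F v0 p) 0.
      by apply/rootP; rewrite online_eval scale0r addr0; apply: Faxis.
    by rewrite subr0; exists q.
  have nzq := online_nz v0.
  have nzq1 : q1 != 0 by apply: contraNneq nzq => e; rewrite q1E e mul0r.
  have sz1 : size q1 = d.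
    have nzc : (online F v0 p)`_d != 0 by rewrite (coef_online charK0 _ _ homF).
    have sz : size (online F v0 p) = d.+1.
      apply/eqP; rewrite eqn_leq (size_online charK0 _ _ homF) /= ltnNge.
      by apply: contra nzc => le; rewrite nth_default.
    by move: sz; rewrite q1E size_mulX // => -[].
  have [|x q1x] := @closed_root K q1; first by rewrite sz1 gtn_eqF.
  have x0 : x = 0 by apply: q0; rewrite q1E hornerM q1x mul0r.
  rewrite x0 in q1x.
  by rewrite q1E derivM hornerD !hornerM hornerX mulr0 q1x mul0r addr0.
rewrite ddirD ddirZ dp mulr0 dax ?addr0 //.
by rewrite -scaleNr dotD dotZ pph mulr1 subrr.
Qed.

End Center.

(** The quasi-Galois datum of the point p: the automorphisms of the curve along
    p are the n homologies with axis ph whose multipliers are n-th roots of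
    unity. *)
Definition qg p ph n := [/\ dot p ph = 1, F.@[p 0] != 0, (1 < n)%N &
  forall M, (autC M /\ along p M) <-> (exists2 z, z ^+ n = 1 & M = hom p ph z)].

Lemma qg_aut p ph n z : qg p ph n -> z ^+ n = 1 -> autC (hom p ph z).
Proof. by case=> _ _ _ qE zn; have [_ /(_ _)[|//]] := qE (hom p ph z); exists z. Qed.

Lemma qg_root p ph n z : qg p ph n -> autC (hom p ph z) -> z ^+ n = 1.
Proof.
case=> pp _ _ qE az; have [/(_ _)[|y yn e _]] := qE (hom p ph z).
  by split=> //; apply: along_hom.
by rewrite (hom_inj pp e).
Qed.

(** Two automorphisms along p commute, because their commutator fixes p, so it
    is an elation and trivial by [no_translation]; hence they have the axis of M0 in common. The multipliers that
    occur move a point of the curve off the axis along a line through p, so they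
    form a finite group Z of scalars, which is the group of n-th roots of
    unity for n = |Z|. *)
Lemma qg_exists p M0 : F.@[p 0] != 0 -> autC M0 -> along p M0 -> M0 != 1%:M ->
  exists ph n, qg p ph n.
Proof.
move=> Fp aM0 alM0 nz0; have nzp := nz_of_F Fp.
have [ph0 ph0E] := along_functional nzp alM0.
have pM0 : p *m M0 = (1 + dot p ph0) *: p by rewrite ph0E scalerDl scale1r.
have nzdot : dot p ph0 != 0.
  by apply: contraNneq nz0 => e; apply/eqP/(no_translation Fp) => //; rewrite pM0 e addr0 scale1r.
pose ph := (dot p ph0)^-1 *: ph0; pose c0 := 1 + dot p ph0.
have pph : dot p ph = 1 by rewrite dotZr mulVf.
have M0E : M0 = hom p ph c0.
  apply: mx_ext => v; rewrite homE ph0E /c0 dotZr addrAC subrr add0r mulrA mulfV //.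
  by rewrite mul1r.
(* every automorphism along p is a homology with the axis of M0 *)
have allE M : autC M -> along p M -> exists z, M = hom p ph z.
  move=> aM alM; have [ph' ph'E] := along_functional nzp alM.
  have [uM0 uM] : M0 \in unitmx /\ M \in unitmx by case: aM0; case: aM.
  have pM : p *m M = (1 + dot p ph') *: p by rewrite ph'E scalerDl scale1r.
  have comm : M0 *m M = M *m M0.
    pose N := M0 *m M *m invmx (M *m M0).
    have uMM : M *m M0 \in unitmx by rewrite unitmx_mul uM.
    have : N = 1%:M.
      apply: (no_translation Fp).
      - by apply: autCM; [apply: autCM | apply/autCV/autCM].
      - by apply: alongM; [apply: alongM | apply: alongV => //; apply: alongM].
      - have e : p *m (M0 *m M) = p *m (M *m M0).
          by rewrite !mulmxA pM pM0 -!scalemxAl pM pM0 !scalerA mulrC.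
        by rewrite /N mulmxA e mulmxK.
    by move/(congr1 (mulmx^~ (M *m M0))); rewrite mul1mx mulmxKV.
  exists (1 + dot p ph'); apply: mx_ext => v; rewrite homE [in LHS]ph'E.
  congr (_ + _ *: _); have := congr1 (fun X => dot (v *m X) ph) comm.
  rewrite !mulmxA M0E !(homE, ph'E) !(dotD, dotZ, pph, mulr1).
  have nzc : c0 - 1 != 0 by rewrite /c0 addrAC subrr add0r.
  move=> e; apply: (mulfI nzc).
  set A := dot v ph in e *; set B := dot v ph' in e *; set C := dot p ph' in e *.
  have : (c0 - 1) * B = (c0 - 1) * (C * A) + ((A + B + (c0 - 1) * (A + B)) - (A + (c0 - 1) * A + (B + (c0 - 1) * A * C))) by ring.
  rewrite -e => ->; ring.
have [v Fv nzv] := point_off_axis Fp pph.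
pose v0 := v - dot v ph *: p.
have v0ph : dot v0 ph = 0 by rewrite /v0 -scaleNr dotD dotZ pph mulr1 subrr.
have vE z : v *m hom p ph z = v0 + (z * dot v ph) *: p.
  by rewrite homE /v0 -addrA -scaleNr -scalerDl; congr (_ + _ *: _); ring.
have [rs rsE] := closed_field_poly_normal (online F v0 p).
pose Z := [seq z <- undup [seq x / dot v ph | x <- rs] | `[< autC (hom p ph z) >]].
have ZP z : (z \in Z) <-> autC (hom p ph z).
  rewrite mem_filter; split=> [/andP [/asboolP //]|az].
  apply/andP; split; first exact/asboolP.
  rewrite mem_undup; apply/mapP; exists (z * dot v ph); last by rewrite mulfK.
  have: root (online F v0 p) (z * dot v ph).
    by apply/rootP; rewrite online_eval -vE; apply/eqP; rewrite autC_zero // Fv.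
  by rewrite rsE rootZ ?lead_coef_eq0 ?online_nz // root_prod_XsubC.
have uZ : uniq Z by rewrite filter_uniq // undup_uniq.
have nzZ z : z \in Z -> z != 0.
  move/ZP => [uz _]; apply: contraTneq uz => ->.
  apply/negP => u0; have := congr1 (mulmx^~ (invmx (hom p ph 0))) (hom_center 0 pph).
  by rewrite mulmxK // scale0r mul0mx => p0; move: nzp; rewrite p0 eqxx.
pose n := size Z.
(* multiplication by z permutes Z, so the product of Z is multiplied by z ^ n = 1 *)
have Zn z : z \in Z -> z ^+ n = 1.
  move=> zZ; have nzz := nzZ z zZ.
  have pe : perm_eq [seq z * y | y <- Z] Z.
    have us : uniq [seq z * y | y <- Z] by rewrite map_inj_uniq //; apply: mulfI.
    apply: uniq_perm => //.
    have sub : {subset [seq z * y | y <- Z] <= Z}.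
      move=> _ /mapP [y yZ ->]; apply/ZP; rewrite -hom_mul //.
      by apply: autCM; apply/ZP.
    by have [|_] := uniq_min_size us sub; first by rewrite size_map.
  have: \prod_(y <- [seq z * y | y <- Z]) y = \prod_(y <- Z) y by apply: perm_big.
  rewrite big_map big_split /= big_const_seq count_predT iter_mulr_1 -/n.
  rewrite -{2}[\prod_(y <- Z) y]mul1r; apply: mulIf.
  by rewrite prodf_seq_neq0; apply/allP => y yZ; apply: nzZ.
have nZ z : z ^+ n = 1 -> z \in Z.
  move=> zn; apply/negPn/negP => nin.
  have n_gt0 : (0 < n)%N.
    by rewrite /n; case: (Z) (ZP 1) => // -[_]; rewrite hom1 => /(_ autC1).
  have: (size (z :: Z) < size ('X^n - 1%:P : {poly K})%R)%N.
    apply: max_poly_roots.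
    - by rewrite -size_poly_gt0 size_XnsubC.
    - have rt y : y ^+ n = 1 -> root ('X^n - 1%:P) y.
        by move=> yn; rewrite rootE !hornerE ?hornerXn yn subrr.
      by rewrite /= rt //=; apply/allP => y yZ; rewrite rt // Zn.
    - by rewrite /= nin.
  by rewrite size_XnsubC //= ltnn.
have n_gt1 : (1 < n)%N.
  have Z1 : 1 \in Z by apply/ZP; rewrite hom1; apply: autC1.
  have Zc : c0 \in Z by apply/ZP; rewrite -M0E.
  have nc : c0 != 1 by rewrite -subr_eq0 /c0 addrAC subrr add0r.
  have := @uniq_leq_size _ [:: 1; c0] Z; apply; first by rewrite /= inE eq_sym nc.
  by move=> y; rewrite !inE => /orP [] /eqP ->.
exists ph, n; split=> // M; split=> [[aM alM]|[z zn ->]].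
  have [z ME] := allE M aM alM; exists z => //; apply: Zn; apply/ZP; by rewrite -ME.
split; last exact: along_hom.
by apply/ZP/nZ.
Qed.

End Curve.

(** * Projectivities of the line *)

Section ProjectiveLine.
Variable K : closedFieldType.
Hypothesis charK0 : [pchar K] =i pred0.
Implicit Types (M N : 'M[K]_2) (u v : 'rV[K]_2) (o : option K) (k a : K).

(** The projective line as K with a point at infinity: Some a is (1, a) and None
    is (0, 1). *)
Definition vec2 o : 'rV[K]_2 :=
  \row_i (if i == 0 then (if o is Some _ then 1 else 0) else (if o is Some a then a else 1)).
Definition pt v : option K := if v 0 0 == 0 then None else Some (v 0 1 / v 0 0).
Definition act M o := pt (vec2 o *m M).

Lemma row2P u v : u 0 0 = v 0 0 -> u 0 1 = v 0 1 -> u = v.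
Proof.
move=> e0 e1; apply/rowP => i; case: i => [[|[|//]] lti].
  by rewrite (_ : Ordinal lti = 0) //; apply: val_inj.
by rewrite (_ : Ordinal lti = 1) //; apply: val_inj.
Qed.

Lemma vec2E0 o : vec2 o 0 0 = if o is Some _ then 1 else 0.
Proof. by rewrite mxE. Qed.
Lemma vec2E1 o : vec2 o 0 1 = if o is Some a then a else 1.
Proof. by rewrite mxE. Qed.

Lemma vec2_nz o : vec2 o != 0.
Proof.
apply/eqP => /rowP e; case: o e => [a|] e.
  by have := e 0; rewrite vec2E0 mxE => /eqP; rewrite oner_eq0.
by have := e 1; rewrite vec2E1 mxE => /eqP; rewrite oner_eq0.
Qed.

Lemma pt_vec o : pt (vec2 o) = o.
Proof. by rewrite /pt vec2E0 vec2E1; case: o => [a|]; rewrite ?eqxx ?oner_eq0 ?divr1. Qed.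

Lemma pt_scale k v : k != 0 -> pt (k *: v) = pt v.
Proof.
move=> nzk; rewrite /pt !mxE mulf_eq0 (negPf nzk) /=.
by case: eqVneq => // nz; congr Some; field; rewrite nz.
Qed.

Lemma vec_pt v : v != 0 -> exists2 k, k != 0 & v = k *: vec2 (pt v).
Proof.
move=> nzv; rewrite /pt; case: eqVneq => [e|nz].
  have nz1 : v 0 1 != 0 by apply: contraNneq nzv => e1; apply/eqP/row2P; rewrite ?e ?e1 mxE.
  by exists (v 0 1) => //; apply: row2P; rewrite mxE ?vec2E0 ?vec2E1 ?mulr0 ?mulr1.
exists (v 0 0) => //; apply: row2P; rewrite mxE ?vec2E0 ?vec2E1 ?mulr1 //.
by rewrite mulrC divfK.
Qed.

Lemma unit_nz M v : M \in unitmx -> v != 0 -> v *m M != 0.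
Proof. by move=> uM; apply: contra_neq => e; rewrite -[v](mulmxK uM) e mul0mx. Qed.

Lemma act_pt M v : M \in unitmx -> v != 0 -> act M (pt v) = pt (v *m M).
Proof.
move=> uM nzv; have [k nzk vE] := vec_pt nzv.
by rewrite [in RHS]vE -scalemxAl pt_scale.
Qed.

Lemma actM M N o : M \in unitmx -> N \in unitmx -> act (M *m N) o = act N (act M o).
Proof. move=> uM uN; rewrite [act M o]/act act_pt //; first by rewrite /act mulmxA. exact: unit_nz uM (vec2_nz o). Qed.

Lemma act1 o : act 1%:M o = o.
Proof. by rewrite /act mulmx1 pt_vec. Qed.

Lemma act_scalar k o : k != 0 -> act k%:M o = o.
Proof. by move=> nzk; rewrite /act mul_mx_scalar pt_scale // pt_vec. Qed.

Lemma act_inj M : M \in unitmx -> injective (act M).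
Proof.
move=> uM x y e; rewrite -[x]act1 -[y]act1 -(mulmxV uM) !actM ?unitmx_inv //.
by rewrite e.
Qed.

Lemma act_fixP M o : M \in unitmx -> act M o = o <-> exists k, vec2 o *m M = k *: vec2 o.
Proof.
move=> uM; split=> [e|[k kE]].
  have [k nzk vE] := vec_pt (unit_nz uM (vec2_nz o)).
  by exists k; rewrite vE -/(act M o) e.
have nzk : k != 0.
  by apply: contraTneq (unit_nz uM (vec2_nz o)) => k0; rewrite kE k0 scale0r eqxx.
by rewrite /act kE pt_scale // pt_vec.
Qed.

(** A finite fixed point a satisfies this quadratic equation, which is zero only
    for scalar matrices. *)
Definition fixpoly M : {poly K} := (M 0 1)%:P + (M 1 1 - M 0 0) *: 'X - M 1 0 *: 'X^2.

Lemma mulmx2 v M j : (v *m M) 0 j = v 0 0 * M 0 j + v 0 1 * M 1 j.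
Proof.
rewrite mxE !big_ord_recl big_ord0 addr0; congr (_ + v 0 _ * M _ j); exact: val_inj.
Qed.

Lemma fix_some M a : M \in unitmx -> act M (Some a) = Some a -> root (fixpoly M) a.
Proof.
move=> uM /(act_fixP _ uM) [k kE].
have e j : (vec2 (Some a) *m M) 0 j = k * vec2 (Some a) 0 j by rewrite kE mxE.
have := e 0; have := e 1; rewrite !mulmx2 vec2E0 vec2E1 !mul1r mulr1 => e1 e0.
rewrite rootE /fixpoly !(hornerD, hornerN, hornerC, hornerZ, hornerX, hornerXn); apply/eqP.
have -> : M 0 1 + (M 1 1 - M 0 0) * a - M 1 0 * a ^+ 2 =
  (M 0 1 + a * M 1 1) - a * (M 0 0 + a * M 1 0) by ring.
by rewrite e1 e0; ring.
Qed.

Lemma fix_none M : M \in unitmx -> act M None = None -> M 1 0 = 0.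
Proof.
move=> uM /(act_fixP _ uM) [k kE].
have : (vec2 None *m M) 0 0 = k * vec2 None 0 0 by rewrite kE mxE.
by rewrite mulmx2 vec2E0 vec2E1 mul0r mul1r add0r mulr0.
Qed.

Lemma fixpoly0 M : fixpoly M = 0 -> M = (M 0 0)%:M.
Proof.
move=> e; have c i := congr1 (fun p : {poly K} => p`_i) e.
have := c 0%N; have := c 1%N; have := c 2%N; rewrite /fixpoly.
rewrite !coefB !coefD !coefZ !coefC !coefX !coefXn ?coef0 /= !(mulr0, mulr1, addr0, add0r, subr0, sub0r).
move=> /eqP; rewrite oppr_eq0 => /eqP e2 /eqP; rewrite subr_eq0 => /eqP e1 e0.
apply/matrixP => i j; rewrite mxE.
case: i => [[|[|//]] lti]; case: j => [[|[|//]] ltj] /=; rewrite ?mulr1n ?mulr0n.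
- by congr (M _ _); exact: val_inj.
- by rewrite -[RHS]e0; congr (M _ _); exact: val_inj.
- by rewrite -[RHS]e2; congr (M _ _); exact: val_inj.
- by rewrite -[RHS]e1; congr (M _ _); exact: val_inj.
Qed.

Lemma size_fixpoly M : (size (fixpoly M) <= 3)%N.
Proof.
rewrite (leq_trans (size_polyD _ _)) // geq_max size_polyN.
rewrite (leq_trans (size_polyD _ _)) ?geq_max /=.
  by rewrite (leq_trans (size_scale_leq _ _)) // size_polyXn.
by rewrite (leq_trans (size_polyC_leq1 _)) // (leq_trans (size_scale_leq _ _)) // size_polyX.
Qed.

Definition scalar M := exists c, M = c%:M.

Lemma three_fixed M (s : seq (option K)) : M \in unitmx -> uniq s -> (3 <= size s)%N ->
  (forall o, o \in s -> act M o = o) -> scalar M.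
Proof.
move=> uM us ges fs; exists (M 0 0); apply: fixpoly0; apply/eqP/negPn/negP => nz.
pose rs := pmap id s.
have urs : uniq rs by apply: (@pmap_uniq _ _ id Some) => // -[].
have rsE a : (a \in rs) = (Some a \in s) by rewrite mem_pmap map_id.
have rt : all (root (fixpoly M)) rs.
  by apply/allP => a; rewrite rsE => /fs; apply: fix_some.
have lt := max_poly_roots nz rt urs.
have [ns|ns] := boolP (None \in s).
  have m10 : M 1 0 = 0 by apply: fix_none => //; apply: fs.
  have sz2 : (size (fixpoly M) <= 2)%N.
    rewrite /fixpoly m10 scale0r subr0 (leq_trans (size_polyD _ _)) // geq_max.
    by rewrite (leq_trans (size_polyC_leq1 _)) // (leq_trans (size_scale_leq _ _)) // size_polyX.
  have sr : size s = (size rs).+1.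
    have : perm_eq s (None :: map Some rs).
      apply: uniq_perm => //=.
        rewrite map_inj_uniq ?urs ?andbT; last by move=> ? ? [].
        by apply/mapP => -[].
      case=> [a|]; last by rewrite ns inE.
      by rewrite inE /= mem_map ?rsE // => ? ? [].
    by move/perm_size => ->; rewrite /= size_map.
  by rewrite sr ltnS in ges; have := leq_ltn_trans ges (leq_trans lt sz2); rewrite ltnn.
have sr : size s = size rs.
  have : perm_eq s (map Some rs).
    apply: uniq_perm => //=; first by rewrite map_inj_uniq // => ? ? [].
    case=> [a|]; first by rewrite mem_map ?rsE // => ? ? [].
    by rewrite (negPf ns); apply/esym/mapP => -[].
  by move/perm_size => ->; rewrite size_map.
by rewrite sr in ges; have := leq_ltn_trans ges (leq_trans lt (size_fixpoly M)); rewrite ltnn.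
Qed.

Lemma fixed_list M : M \in unitmx -> ~ scalar M ->
  exists s : seq (option K), forall o, act M o = o -> o \in s.
Proof.
move=> uM nsc; have nz : fixpoly M != 0 by apply/eqP => e; apply: nsc; exists (M 0 0); apply: fixpoly0.
have [r rE] := closed_field_poly_normal (fixpoly M).
exists (None :: map Some r) => -[a|] fo; rewrite inE //=.
rewrite mem_map; last by move=> ? ? [].
by have := fix_some uM fo; rewrite rE rootZ ?lead_coef_eq0 // root_prod_XsubC.
Qed.

(** A matrix with a scalar power is diagonalizable in characteristic zero: with
    a single eigenline, M = c (1 + N) with N ^ 2 = 0, and M ^ k = c ^ k (1 + k N)
    is not scalar. *)
Lemma two_fixed M (k : nat) : M \in unitmx -> ~ scalar M -> (0 < k)%N -> scalar (M ^+ k) ->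
  exists o1 o2, [/\ o1 != o2, act M o1 = o1 & act M o2 = o2].
Proof.
move=> uM nsc k_gt0 [c Mk].
have [r cpE] := closed_field_poly_normal (char_poly M).
rewrite (monicP (char_poly_monic M)) scale1r in cpE.
have := size_char_poly M; rewrite cpE size_prod_XsubC => -[].
case: r cpE => [|l [|m [|//]]] // cpE _; rewrite !big_cons big_nil mulr1 in cpE.
have eig x : root (char_poly M) x -> exists2 v : 'rV[K]_2, v *m M = x *: v & v != 0.
  by rewrite -eigenvalue_root_char => /eigenvalueP.
have fixeig v x : v *m M = x *: v -> v != 0 -> act M (pt v) = pt v.
  move=> vM nzv; rewrite act_pt // vM pt_scale //.
  by apply: contraNneq (unit_nz uM nzv) => x0; rewrite vM x0 scale0r.
have [lm|nlm] := eqVneq l m; last first.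
  have [|v vM nzv] := eig l; first by rewrite cpE rootM root_XsubC eqxx.
  have [|w wM nzw] := eig m; first by rewrite cpE rootM !root_XsubC eqxx orbT.
  exists (pt v), (pt w); split; [|exact: fixeig vM nzv|exact: fixeig wM nzw].
  apply: contra_neq nlm => e; have [a nza vE] := vec_pt nzv; have [b nzb wE] := vec_pt nzw.
  have {}vE : v = (a / b) *: w by rewrite [in RHS]wE scalerA divfK // -e.
  have := vM; rewrite vE -scalemxAl wM scalerA => /eqP.
  rewrite scalerA -subr_eq0 -scalerBl scaler_eq0 (negPf nzw) orbF [a / b * m]mulrC -mulrBl mulf_eq0.
  by rewrite mulf_eq0 (negPf nza) invr_eq0 (negPf nzb) !orbF subr_eq0 => /eqP.
case: nsc; pose E := M - l%:M.
have E2 : E * E = 0.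
  have := Cayley_Hamilton M; rewrite cpE -lm rmorphM rmorphB /= horner_mx_X horner_mx_C.
  by [].
have ME : M = l%:M + E by rewrite addrC subrK.
have MjE j : M ^+ j.+1 = (l ^+ j.+1)%:M + (j.+1%:R * l ^+ j) *: E.
  elim: j => [|j IH]; first by rewrite !expr1 expr0 mulr1 scale1r.
  rewrite exprS IH {1}ME mulrDl !mulrDr -!scalerAr E2 scaler0 addr0.
  rewrite -!mulmxE -scalar_mxM -exprS !mul_scalar_mx mul_mx_scalar !scalerA -addrA -scalerDl.
  congr (_ + _ *: _); rewrite -!natr1 !exprS; ring.
have nzl : l != 0.
  have [|v vM nzv] := eig l; first by rewrite cpE rootM root_XsubC eqxx.
  by apply: contraNneq (unit_nz uM nzv) => l0; rewrite vM l0 scale0r.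
case: k k_gt0 Mk => // k _ Mk.
have nzk : k.+1%:R * l ^+ k != 0.
  by rewrite mulf_neq0 ?expf_neq0 //; have/pcharf0P -> := charK0.
have EE : E = ((c - l ^+ k.+1) / (k.+1%:R * l ^+ k))%:M.
  apply: (scalerI nzk); rewrite scale_scalar_mx [X in _ = X%:M]mulrC divfK //.
  have -> : (c - l ^+ k.+1)%:M = c%:M - (l ^+ k.+1)%:M :> 'M[K]_2 by exact: raddfB.
  by rewrite -Mk MjE addrAC subrr add0r.
by exists (l + (c - l ^+ k.+1) / (k.+1%:R * l ^+ k)); rewrite ME EE -raddfD.
Qed.

End ProjectiveLine.

(** * Permutation groups in which nontrivial elements fix two points *)

(** The class equation of the rotation groups, 1/e1 + 1/e2 + 1/e3 = 1 + 2/N, with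
    orbits of sizes o and stabilizers of orders e: dihedral, octahedral and
    icosahedral solutions. *)
Lemma orbit_arith N o1 o2 o3 e1 e2 e3 :
  (o1 * e1 = N -> o2 * e2 = N -> o3 * e3 = N -> o1 + o2 + o3 = N + 2 ->
  4 <= e1 -> 2 <= e2 -> 2 <= e3 ->
  [\/ [/\ o1 = 2, e2 = 2 & e3 = 2],
      [/\ N = 24, o1 = 6, e1 = 4 , e2 <= 3 & e3 <= 3] |
      [/\ N = 60, o1 = 12, e1 = 5, e2 <= 3 & e3 <= 3]])%N.
Proof.
have half a b c ea ec : (a * ea = N -> b * 2 = N -> c * ec = N -> a + b + c = N + 2 ->
   4 <= ea -> 2 <= ec ->
  [\/ [/\ a = 2 & ec = 2], [/\ N = 24, a = 6, ea = 4 & ec = 3] |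
      [/\ N = 60, a = 12, ea = 5 & ec = 3]])%N.
  move=> aN bN cN s ge4 ge2.
  have [ec2|[ec3|ec4]] : (ec = 2 \/ ec = 3 \/ 4 <= ec)%N by lia.
  - by constructor 1; split=> //; subst ec; lia.
  - subst ec; have [ea4|[ea5|ea6]] : (ea = 4 \/ ea = 5 \/ 6 <= ea)%N by lia.
    + by constructor 2; split=> //; subst ea; lia.
    + by constructor 3; split=> //; subst ea; lia.
    + have : (a * 6 <= N)%N by rewrite -aN leq_mul2l ea6 orbT.
      lia.
  - have : (a * 4 <= N)%N by rewrite -aN leq_mul2l ge4 orbT.
    have : (c * 4 <= N)%N by rewrite -cN leq_mul2l ec4 orbT.
    lia.
move=> e1N e2N e3N s ge4 ge2 ge2'.
have [e22|[e32|[e23 e33]]] : (e2 = 2 \/ e3 = 2 \/ (3 <= e2 /\ 3 <= e3))%N by lia.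
- subst e2; case: (half _ _ _ _ _ e1N e2N e3N s ge4 ge2') => [[-> ->]|[-> -> -> ->]|[-> -> -> ->]].
  + by constructor 1.
  + by constructor 2.
  + by constructor 3.
- subst e3; have s' : (o1 + o3 + o2 = N + 2)%N by lia.
  case: (half _ _ _ _ _ e1N e3N e2N s' ge4 ge2) => [[-> ->]|[-> -> -> ->]|[-> -> -> ->]].
  + by constructor 1.
  + by constructor 2.
  + by constructor 3.
- have : (o1 * 4 <= N)%N by rewrite -e1N leq_mul2l ge4 orbT.
  have : (o2 * 3 <= N)%N by rewrite -e2N leq_mul2l e23 orbT.
  have : (o3 * 3 <= N)%N by rewrite -e3N leq_mul2l e33 orbT.
  lia.
Qed.

Section PermGroup.
Local Open Scope group_scope.
Local Open Scope nat_scope.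
Variables (T : finType) (G : {group {perm T}}).
Hypothesis two : forall g, g \in G -> g != 1%g -> #|[set y | g y == y]| = 2%N.

Definition poles : {set T} := [set y | [exists g in G, (g != 1%g) && (g y == y)]].

Let stab y := 'C_G[y | 'P]%g.

Lemma poles_acts : [acts G, on poles | 'P].
Proof.
apply/actsP => g gG y; rewrite /= !inE /aperm; apply/idP/idP => /existsP [h /and3P [hG nh /eqP hy]].
  apply/existsP; exists (g * h * g^-1)%g; rewrite !groupM ?groupV //=.
  rewrite -(inj_eq (conjg_inj g)) conj1g.
  by rewrite conjgE !mulgA mulVg mul1g mulgKV nh /= !permM hy permK.
apply/existsP; exists (g^-1 * h * g)%g; rewrite !groupM ?groupV //=.
rewrite -(inj_eq (conjg_inj (g^-1)%g)) conj1g.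
by rewrite conjgE invgK !mulgA mulgV mul1g mulgK nh /= !permM permK hy.
Qed.

Lemma fix_polesE g y : (y \in 'Fix_(poles | 'P)[g])%g = (y \in poles) && (g y == y).
Proof. by rewrite inE; congr andb; apply/afix1P/eqP. Qed.

Lemma poleP y g : g \in G -> g != 1%g -> g y = y -> y \in poles.
Proof. by move=> gG ng gy; rewrite inE; apply/existsP; exists g; rewrite gG ng gy eqxx. Qed.

(** Cauchy-Frobenius on the poles: the identity fixes all of them and every
    other element fixes two. *)
Lemma burnside_poles :
  (#|orbit 'P G @: poles| * #|G| = #|poles| + 2 * #|G|.-1)%N.
Proof.
rewrite -(Frobenius_Cauchy poles_acts) (bigD1 1%g) //=.
congr (_ + _)%N.
  by apply: eq_card => y; rewrite fix_polesE perm1 eqxx andbT.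
rewrite (eq_bigr (fun=> 2)) => [|g /andP [gG ng]].
  rewrite sum_nat_const mulnC; congr (_ * _)%N.
  by rewrite (cardsD1 1%g G) group1 /=; apply: eq_card => g; rewrite !inE andbC.
rewrite -(two gG ng); apply: eq_card => y; rewrite fix_polesE inE.
by case: eqP => [/(poleP gG ng) -> | _]; rewrite ?andbF.
Qed.

Lemma orbit_stab y : (#|orbit 'P G y| * #|stab y| = #|G|)%N.
Proof. by apply: card_orbit_in_stab; apply: subsetT. Qed.

Lemma stab_order y g : g \in G -> g y = y -> #[g] %| #|stab y|.
Proof.
by move=> gG gy; apply: order_dvdG; rewrite inE gG; apply/astab1P.
Qed.

Lemma stab_gt1 y : y \in poles -> 2 <= #|stab y|.
Proof.
rewrite inE => /existsP [g /and3P [gG ng /eqP gy]].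
apply: leq_trans (dvdn_leq _ (stab_order gG gy)); last by rewrite cardG_gt0.
by rewrite ltn_neqAle eq_sym order_eq1 ng order_gt0.
Qed.

Lemma orbit_gt0 y : 0 < #|orbit 'P G y|.
Proof. by apply/card_gt0P; exists y; apply: orbit_refl. Qed.

Lemma orbit_stab_eq y z : orbit 'P G y = orbit 'P G z -> #|stab y| = #|stab z|.
Proof.
move=> e; have := orbit_stab y; rewrite e -(orbit_stab z) => /eqP.
by rewrite eqn_pmul2l ?orbit_gt0 // => /eqP.
Qed.

Variables (y1 : T) (g1 : {perm T}).
Hypotheses (g1G : g1 \in G) (g1y : g1 y1 = y1) (g1n : 4 <= #[g1]).

(** By [burnside_poles] and the bound |P| |G| >= 2 |poles| there are at most three
    orbits of poles. With two orbits all nontrivial elements have the same fixed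
    points; with three, [orbit_arith] leaves the dihedral case, where the fixed
    points of elements of order at least three form the orbit of size two, and the
    octahedral and icosahedral cases, where the poles of order at least four are
    the orbit of y1. The involution of the icosahedral group comes from
    Cauchy's theorem. *)
Lemma pole_trichotomy :
  (forall y g, g \in G -> g y = y -> 2 < #[g] -> g1 y = y) \/
  ((#|orbit 'P G y1| = 6 /\ #[g1] = 4 \/
   [/\ #|orbit 'P G y1| = 12, #[g1] = 5 & exists2 h, h \in G & #[h] = 2]) /\
   (forall y g, g \in G -> g y = y -> 3 < #[g] -> y \in orbit 'P G y1)).
Proof.
have ng1 : g1 != 1%g by rewrite -order_eq1; apply: contraTneq g1n => ->.
have nge g m : m < #[g] -> 0 < m -> g != 1%g.
  by move=> lt m0; rewrite -order_eq1; apply: contraTneq lt => ->; rewrite -leqNgt.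
set P := orbit 'P G @: poles; set O1 := orbit 'P G y1.
have O1P : O1 \in P by apply: imset_f; apply: poleP g1y.
have bp := burnside_poles; rewrite -/P in bp.
have sumP : \sum_(O in P) #|O| = #|poles| := acts_sum_card_orbit poles_acts.
have N_gt0 : 0 < #|G| by apply: cardG_gt0.
have st1 := orbit_stab y1; rewrite -/O1 in st1.
have e1ge : 4 <= #|stab y1|.
  by apply: leq_trans g1n (dvdn_leq _ (stab_order g1G g1y)); rewrite cardG_gt0.
have O1_gt0 : 0 < #|O1| by apply: orbit_gt0.
have O1le : #|O1| * 4 <= #|G| by rewrite -st1 leq_mul2l e1ge orbT.
have P_le : #|poles| * 2 <= #|P| * #|G|.
  rewrite -sumP big_distrl /= -sum_nat_const; apply: leq_sum => _ /imsetP [y yS ->].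
  by rewrite -(orbit_stab y) leq_mul2l stab_gt1 ?orbT.
have r_le : #|P| <= 3.
  rewrite leqNgt; apply/negP => r4.
  have : 4 * #|G| <= #|P| * #|G| by rewrite leq_mul2r r4 orbT.
  by move: bp P_le; move: (#|P| * #|G|) => x; lia.
have r_gt0 : 0 < #|P| by apply/card_gt0P; exists O1.
have fix1_sub (A : {set T}) : (forall z, g1 z = z -> z \in A) -> #|A| = 2 -> forall y, y \in A -> g1 y = y.
  move=> sub cA y yA; have e : [set z | g1 z == z] = A.
    apply/eqP; rewrite eqEcard cA (two g1G ng1) leqnn andbT.
    by apply/subsetP => z; rewrite inE => /eqP /sub.
  by move: yA; rewrite -e inE => /eqP.
have [r1|[r2|r3]] : (#|P| = 1 \/ #|P| = 2 \/ #|P| = 3) by lia.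
- have PE : P = [set O1].
    by apply/esym/eqP; rewrite eqEcard sub1set O1P cards1 r1.
  by move: sumP bp; rewrite r1 PE big_set1 => <-; lia.
- have cS : #|poles| = 2 by move: bp; rewrite r2; lia.
  left=> y g gG gy lt2; apply: (fix1_sub poles) => //.
    by move=> z; apply: poleP.
  by apply: poleP gy => //; apply: nge lt2 _.
have /cards2P [O2 [O3 [n23 PE]]] : #|P :\ O1| == 2.
  by have := cardsD1 O1 P; rewrite O1P r3 add1n => -[<-].
have [O2P O3P] : O2 \in P /\ O3 \in P.
  by split; apply/(subsetP (subsetDl P [set O1])); rewrite PE !inE eqxx ?orbT.
have [/imsetP [y2 y2S O2E] /imsetP [y3 y3S O3E]] := (O2P, O3P).
have sum3 : #|O1| + #|O2| + #|O3| = #|G| + 2.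
  move: sumP; rewrite (big_setD1 O1) //= PE big_setU1 ?inE //= big_set1 => sumP.
  have arith a b c N : 3 * N = a + (b + c) + 2 * N.-1 -> 0 < N -> a + b + c = N + 2 by lia.
  by apply: arith; rewrite // -r3 bp -sumP.
have st2 := orbit_stab y2; have st3 := orbit_stab y3; rewrite -O2E -O3E in st2 st3.
have inO1 y g m : g \in G -> g y = y -> m < #[g] -> 0 < m -> #|stab y2| <= m -> #|stab y3| <= m ->
    y \in O1.
  move=> gG gy ltm m_gt0 le2 le3; have yS : y \in poles by apply: poleP gy => //; apply: nge ltm _.
  have ltst : m < #|stab y| by apply: leq_trans ltm (dvdn_leq _ (stab_order gG gy)); rewrite cardG_gt0.
  have : orbit 'P G y \in P by apply: imset_f.
  have [e _|nO1] := eqVneq (orbit 'P G y) O1; first by rewrite -e orbit_refl.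
  move=> yP; have : orbit 'P G y \in P :\ O1 by rewrite !inE nO1.
  rewrite PE !inE => /orP [] /eqP e.
    have := orbit_stab_eq (etrans e O2E) => est; by move: ltst; rewrite est ltnNge le2.
  have := orbit_stab_eq (etrans e O3E) => est; by move: ltst; rewrite est ltnNge le3.
have dv1 := stab_order g1G g1y.
case: (orbit_arith st1 st2 st3 sum3 e1ge (stab_gt1 y2S) (stab_gt1 y3S)).
- move=> [c1 e2 e3]; left=> y g gG gy lt2; apply: (fix1_sub O1) => //.
    by move=> z gz; apply: (inO1 z g1 2) => //; rewrite ?e2 ?e3 // (leq_trans _ g1n).
  by apply: (inO1 y g 2); rewrite ?e2 ?e3.
- move=> [_ c1 e1 e2 e3]; right; split; last by move=> y g gG gy lt3; apply: (inO1 y g 3).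
  left; split=> //; apply/eqP; rewrite eqn_leq g1n andbT.
  by move: dv1; rewrite e1; apply: dvdn_leq.
- move=> [cG c1 e1 e2 e3]; right; split; last by move=> y g gG gy lt3; apply: (inO1 y g 3).
  right; split=> //.
    move: dv1; rewrite e1 dvdn_divisors //=; move: g1n; rewrite (_ : divisors 5 = [:: 1; 5]) //.
    by rewrite !inE => ge4 /orP [] /eqP eo; move: ge4; rewrite eo.
  have [|h hG oh] := @Cauchy _ 2 G isT; first by rewrite cG.
  by exists h.
Qed.

End PermGroup.

(** * Finite groups of projectivities *)

Section FiniteGroup.
Variable K : closedFieldType.
Hypothesis charK0 : [pchar K] =i pred0.
Implicit Types (M N : 'M[K]_2) (o : option K).
Variable G : 'M[K]_2 -> Prop.
Hypotheses (G1 : G 1%:M) (GM : forall M N, G M -> G N -> G (M *m N))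
  (GV : forall M, G M -> G (invmx M)) (GU : forall M, G M -> M \in unitmx).
Variable X : seq (option K).
Hypotheses (uX : uniq X) (X3 : (3 <= size X)%N)
  (GX : forall M o, G M -> o \in X -> act M o \in X).

Lemma scalar_act M o : M \in unitmx -> scalar M -> act M o = o.
Proof.
move=> uM [c Mc]; rewrite Mc; apply: act_scalar.
apply: contraTneq uM => c0; rewrite Mc c0; apply/negP => u0.
have := unit_nz u0 (vec2_nz (None : option K)).
by rewrite mul_mx_scalar scale0r eqxx.
Qed.

Lemma act_same_scalar M N : G M -> G N -> (forall o, o \in X -> act M o = act N o) ->
  scalar (M *m invmx N).
Proof.
move=> gM gN e; apply: (three_fixed _ uX X3); first by apply/GU/GM/GV.
move=> o oX; rewrite actM ?unitmx_inv ?GU // e //.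
by rewrite -actM ?unitmx_inv ?GU // mulmxV ?GU // act1.
Qed.

(** A projectivity is determined by its values on the three or more points of X,
    which it permutes. *)
Lemma finitely_many_maps : exists s : seq 'M[K]_2, (forall M, M \in s -> G M) /\
  forall M, G M -> exists2 N, N \in s & forall o, act M o = act N o.
Proof.
pose good (t : seq (option K)) N := G N /\ map (act N) X = t.
pose pick t : 'M[K]_2 := if pselect (exists N, good t N) is left e then projT1 (cid e) else 1%:M.
pose tuples := [seq map (nth None X) (map val (tval w)) | w : (size X).-tuple 'I_(size X)].
exists [seq pick t | t <- tuples]; split.
  move=> _ /mapP [t _ ->]; rewrite /pick; case: pselect => // e.
  by case: (projT2 (cid e)).
move=> M gM; pose t := map (act M) X.
have tT : t \in tuples.
  have ix o : o \in X -> (index (act M o) X < size X)%N by move=> oX; rewrite index_mem GX.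
  have [w wE] : exists w : (size X).-tuple 'I_(size X), forall i : 'I_(size X),
      val (tnth w i) = index (act M (nth None X i)) X.
    exists [tuple (Ordinal (ix _ (mem_nth None (ltn_ord i)))) | i < size X] => i.
    by rewrite tnth_mktuple.
  apply/mapP; exists w; first by rewrite mem_enum.
  apply: (@eq_from_nth _ None); rewrite !size_map ?size_tuple // => i lti.
  rewrite (nth_map None) // (nth_map 0%N) ?size_map ?size_tuple //.
  rewrite (nth_map (Ordinal lti)) ?size_tuple // -[i in nth _ w i]/(val (Ordinal lti)) -tnth_nth wE /=.
  by rewrite nth_index // GX // mem_nth.
exists (pick t); first by apply: map_f.
rewrite /pick; case: pselect => [e|[]]; last by exists M.
case: (projT2 (cid e)); set N := projT1 _ => gN tN o.
have eX o' : o' \in X -> act M o' = act N o'.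
  move=> oX; have := congr1 (fun s : seq (option K) => nth None s (index o' X)) tN.
  by rewrite /t /= !(nth_map None) ?index_mem // nth_index.
have sc := act_same_scalar gM gN eX.
have uN := GU gN; have uM := GU gM.
by rewrite -[M](mulmxKV uN) actM ?unitmx_mul ?unitmx_inv ?uM // (scalar_act _ _ sc) // unitmx_mul unitmx_inv uM.
Qed.

Definition in_poles o := exists M, [/\ G M, ~ scalar M & act M o = o].

(** The finite set on which the group acts as a permutation group in which
    nontrivial elements fix exactly two points: X and all the poles. *)
Lemma stable_points : exists Y : seq (option K), uniq Y /\
  forall o, (o \in Y) <-> (o \in X \/ in_poles o).
Proof.
have [s [sG sP]] := finitely_many_maps.
have fl M : exists t : seq (option K), G M -> ~ scalar M -> forall o, act M o = o -> o \in t.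
  have [[gM nsc]|no] := pselect (G M /\ ~ scalar M); last by exists [::] => gM nsc; case: no.
  by have [t tP] := fixed_list (GU gM) nsc; exists t.
pose fx M := projT1 (cid (fl M)).
have fxP M : G M -> ~ scalar M -> forall o, act M o = o -> o \in fx M := projT2 (cid (fl M)).
pose Z := X ++ flatten [seq fx M | M <- s].
exists [seq o <- undup Z | `[< o \in X \/ in_poles o >]].
split; first by rewrite filter_uniq // undup_uniq.
move=> o; rewrite mem_filter mem_undup mem_cat.
split=> [/andP [/asboolP //]|oP]; apply/andP; split; first exact/asboolP.
case: (oP) => [-> //|[M [gM nsc Mo]]]; apply/orP; right.
have [N Ns MN] := sP M gM; have gN := sG N Ns.
apply/flattenP; exists (fx N); first by apply: map_f.
apply: fxP => //; last by rewrite -MN.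
move=> scN; apply: nsc; apply: (three_fixed (GU gM) uX X3) => o' _.
by rewrite MN (scalar_act _ (GU gN) scN).
Qed.

Lemma scalar_conj M N : N \in unitmx -> scalar (N *m M *m invmx N) -> scalar M.
Proof.
move=> uN [c e]; exists c; apply: (can_inj (mulKmx uN)); apply: (can_inj (mulmxK (_ : invmx N \in unitmx))).
  by rewrite unitmx_inv.
by rewrite e scalar_mxC mulmxK.
Qed.

Variables (M1 : 'M[K]_2) (y1 : option K) (n : nat).
Hypotheses (n4 : (4 <= n)%N) (gM1 : G M1) (M1y : act M1 y1 = y1)
  (M1n : forall k, scalar (M1 ^+ k) <-> (n %| k)%N).

(** [pole_trichotomy] for the permutation group induced on [stable_points]. Orders
    are expressed by scalar powers, as G consists of matrices and scalar
    matrices act trivially. *)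
Lemma pgl2_trichotomy :
  (forall y M, G M -> act M y = y -> ~ scalar M -> ~ scalar (M *m M) -> act M1 y = y) \/
  exists s : seq (option K), [/\ uniq s, y1 \in s,
    (size s = 6%N /\ n = 4%N) \/ [/\ size s = 12%N, n = 5%N &
        exists M, [/\ G M, ~ scalar M & scalar (M *m M)]],
    forall y, y \in s -> exists2 M, G M & act M y1 = y &
    forall y M, G M -> act M y = y -> ~ scalar M -> ~ scalar (M *m M) -> ~ scalar (M *m M *m M) -> y \in s].
Proof.
have [Y [uY YP]] := stable_points.
have XY o : o \in X -> o \in Y by move=> oX; apply/YP; left.
have GY M o : G M -> o \in Y -> act M o \in Y.
  move=> gM /YP [oX|[N [gN nsc No]]]; apply/YP; first by left; apply: GX.
  right; exists (invmx M *m N *m M); split.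
  - by apply: (GM _ gM); apply: GM => //; apply: GV.
  - by move=> sc; apply: nsc; apply: (@scalar_conj N (invmx M)); rewrite ?unitmx_inv ?GU // invmxK.
  - by rewrite -actM ?unitmx_mul ?unitmx_inv ?GU // !mulmxA mulmxV ?GU // mul1mx actM ?GU // No.
pose T := seq_sub Y.
pose lft M (gM : G M) (y : T) : T := SeqSub (GY M (val y) gM (valP y)).
have lft_inj M (gM : G M) : injective (lft M gM).
  by move=> x y /(congr1 val) /= /(act_inj (GU gM)) /val_inj.
pose pm M (gM : G M) : {perm T} := perm (@lft_inj M gM).
have pmE M (gM : G M) y : val (pm M gM y) = act M (val y) by rewrite permE.
(* rel g M: the permutation g of Y is induced by M *)
pose rel (g : {perm T}) M := G M /\ forall y : T, val (g y) = act M (val y).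
pose GG : {set {perm T}} := [set g | `[< exists M, rel g M >]].
have GGP g : reflect (exists M, rel g M) (g \in GG) by rewrite inE; apply: asboolP.
have relM g h M N : rel g M -> rel h N -> rel (g * h)%g (M *m N).
  case=> gM eM [gN eN]; split; first exact: GM.
  by move=> y; rewrite permM eN eM actM ?GU.
have rel1 : rel 1%g 1%:M by split=> // y; rewrite perm1 act1.
have relX g M k : rel g M -> rel (g ^+ k)%g (M ^+ k).
  move=> r; elim: k => [|k IH]; first by rewrite expg0 expr0.
  by rewrite expgS exprS; apply: relM.
have grGG : group_set GG.
  apply/group_setP; split; first by apply/GGP; exists 1%:M.
  by move=> g h /GGP [M rM] /GGP [N rN]; apply/GGP; exists (M *m N); apply: relM.
pose H := Group grGG.
have inY y : in_poles y -> y \in Y by move=> py; apply/YP; right.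
have rel_scalar g M : rel g M -> (g == 1%g) <-> scalar M.
  case=> gM eM; split=> [/eqP g1|sc].
    apply: (three_fixed (GU gM) uX X3) => o oX.
    by have := eM (SeqSub (XY o oX)); rewrite g1 perm1 /= => <-.
  by apply/eqP/permP => y; apply: val_inj; rewrite perm1 eM (scalar_act _ (GU gM) sc).
have two g : g \in H -> g != 1%g -> #|[set y | g y == y]| = 2%N.
  move=> /GGP [M rM] ng; have [gM eM] := rM; have uM := GU gM.
  have nsc : ~ scalar M by move/(rel_scalar _ _ rM); apply/negP.
  have scX : scalar (M ^+ #[g]%g).
    by apply/(rel_scalar _ _ (relX _ _ #[g]%g rM)); rewrite expg_order.
  have [o1 [o2 [n12 f1 f2]]] := two_fixed charK0 uM nsc (order_gt0 g) scX.
  have y1Y : o1 \in Y by apply: inY; exists M.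
  have y2Y : o2 \in Y by apply: inY; exists M.
  apply/eqP/cards2P; exists (SeqSub y1Y), (SeqSub y2Y); split.
    by apply: contra_neq n12 => /(congr1 val).
  apply/setP => y; rewrite !inE -!val_eqE eM /=.
  apply/eqP/orP => [fy|[] /eqP ->] //.
  apply/orP; apply: contrapT => /negP; rewrite negb_or => /andP [ne1 ne2].
  apply: nsc; apply: (@three_fixed _ M [:: o1; o2; val y]) => //.
    by rewrite /= !inE negb_or n12 eq_sym ne1 eq_sym ne2.
  by move=> o; rewrite !inE => /or3P [] /eqP ->.
have nscM1 : ~ scalar M1.
  by move=> sc; have := (M1n 1).1; rewrite expr1 => /(_ sc); rewrite dvdn1 => /eqP n1; move: n4; rewrite n1.
have y1Y : y1 \in Y by apply: inY; exists M1.
pose g1 := pm M1 gM1; pose z1 : T := SeqSub y1Y.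
have r1 : rel g1 M1 by split=> // y; apply: pmE.
have g1H : g1 \in H by apply/GGP; exists M1.
have g1z : g1 z1 = z1 by apply: val_inj; rewrite pmE.
have og1 : #[g1]%g = n.
  apply/eqP; rewrite eqn_dvd; apply/andP; split.
    by rewrite order_dvdn; apply/(rel_scalar _ _ (relX _ _ n r1)); apply/M1n.
  by apply/M1n/(rel_scalar _ _ (relX _ _ _ r1)); rewrite expg_order.
(* the order of the permutation is the least exponent of a scalar power *)
have ord2 g M : rel g M -> ~ scalar M -> ~ scalar (M *m M) -> (2 < #[g]%g)%N.
  move=> r ns1 ns2; rewrite ltnNge; apply/negP => le2.
  have o_gt0 := order_gt0 g.
  have [o1|o2] : (#[g]%g = 1 \/ #[g]%g = 2)%N by lia.
    by apply/ns1/(rel_scalar _ _ r); rewrite -order_eq1 o1.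
  apply/ns2/(rel_scalar _ _ (relM _ _ _ _ r r)).
  by rewrite -[(g * g)%g]/(g ^+ 2)%g -o2 expg_order.
have ord3 g M : rel g M -> ~ scalar M -> ~ scalar (M *m M) -> ~ scalar (M *m M *m M) -> (3 < #[g]%g)%N.
  move=> r ns1 ns2 ns3; have lt2 := ord2 g M r ns1 ns2.
  rewrite ltn_neqAle lt2 andbT eq_sym; apply/eqP => o3.
  apply/ns3/(rel_scalar _ _ (relM _ _ _ _ (relM _ _ _ _ r r) r)).
  by rewrite -mulgA -[(g * (g * g))%g]/(g ^+ 3)%g -o3 expg_order.
have n4' : (4 <= #[g1]%g)%N by rewrite og1.
case: (pole_trichotomy two g1H g1z n4') => [I|[II cov]].
  left=> y M gM My ns1 ns2; have yY : y \in Y by apply: inY; exists M.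
  have rM : rel (pm M gM) M by split=> // z; apply: pmE.
  have := I (SeqSub yY) (pm M gM).
  have -> : pm M gM \in H by apply/GGP; exists M.
  move=> /(_ isT) J; have /(congr1 val) : g1 (SeqSub yY) = SeqSub yY.
    by apply: J; [apply: val_inj; rewrite pmE | apply: ord2 rM _ _].
  by rewrite pmE.
right; exists [seq val z | z <- enum (orbit 'P H z1)%act].
have szE : size [seq val z | z <- enum (orbit 'P H z1)%act] = #|orbit 'P%act H z1|.
  by rewrite size_map cardE.
split.
- by rewrite map_inj_uniq ?enum_uniq //; apply: val_inj.
- by apply/mapP; exists z1 => //; rewrite mem_enum orbit_refl.
- rewrite szE -og1; case: II => [[-> ->]|[-> -> [h /GGP [M rM] oh]]]; [by left | right].
  split=> //; exists M; have [gM _] := rM; split=> //.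
    by move/(rel_scalar _ _ rM); rewrite -order_eq1 oh.
  apply/(rel_scalar _ _ (relM _ _ _ _ rM rM)).
  by rewrite -[(h * h)%g]/(h ^+ 2)%g -oh expg_order.
- move=> y /mapP [z]; rewrite mem_enum => /orbitP [g /GGP [M [gM eM]] gz] ->.
  by exists M => //; rewrite -gz /= /aperm eM.
- move=> y M gM My ns1 ns2 ns3; have yY : y \in Y by apply: inY; exists M.
  have rM : rel (pm M gM) M by split=> // z; apply: pmE.
  apply/mapP; exists (SeqSub yY) => //; rewrite mem_enum.
  apply: (cov _ (pm M gM)); first by apply/GGP; exists M.
    by apply: val_inj; rewrite pmE.
  exact: ord3 rM _ _ _.
Qed.

Lemma projective_order M : G M -> exists2 k, (0 < k)%N & scalar (M ^+ k).
Proof.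
move=> gM; have [s [sG sP]] := finitely_many_maps.
have gX k : G (M ^+ k).
  by elim: k => [|k IH]; [rewrite expr0 | rewrite exprS; apply: GM].
pose ts := [seq map (act (M ^+ k)) X | k <- iota 0 (size s).+1].
have : ~~ uniq ts.
  apply/negP => uts; have : (size ts <= size [seq map (act N) X | N <- s])%N.
    apply: uniq_leq_size => // _ /mapP [k _ ->].
    have [N Ns e] := sP _ (gX k); apply/mapP; exists N => //.
    by apply: eq_map.
  by rewrite !size_map size_iota ltnn.
move/(uniqPn [::]) => [i [j [ltij]]]; rewrite size_map size_iota => ltj.
rewrite !(nth_map 0%N) ?size_iota ?nth_iota ?(ltn_trans ltij ltj) // !add0n => e.
have uM := GU gM; exists (j - i)%N; first by rewrite subn_gt0.
have sc : scalar (M ^+ j *m invmx (M ^+ i)).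
  apply: act_same_scalar => // o oX.
  by have := congr1 (fun t => nth None t (index o X)) e; rewrite !(nth_map None) ?index_mem // nth_index // => ->.
have Mj : M ^+ j = M ^+ (j - i) *m M ^+ i by rewrite -{1}(subnK (ltnW ltij)) exprD.
by case: sc => c; rewrite Mj mulmxK ?GU // => ->; exists c.
Qed.

(** The commutator of M and N fixes o with eigenvalue one and has determinant one;
    as it has finite order modulo scalars it has a second fixed point, so it is
    the identity. Then N permutes the two fixed points of M, and it fixes o. *)
Lemma common_fixed_point M N o o' : G M -> G N -> ~ scalar M ->
  act M o = o -> act N o = o -> act M o' = o' -> act N o' = o'.
Proof.
move=> gM gN nsM Mo No Mo'; have [uM uN] := (GU gM, GU gN).
have [-> //|noo] := eqVneq o' o.
pose C := invmx M *m invmx N *m M *m N.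
have gC : G C by do 3![apply: GM => //]; apply: GV.
have uC := GU gC.
have Co : vec2 o *m C = vec2 o.
  have [a Ma] := (act_fixP o uM).1 Mo; have [b Nb] := (act_fixP o uN).1 No.
  have nza : a != 0.
    by apply: contraTneq (unit_nz uM (vec2_nz o)) => a0; rewrite Ma a0 scale0r eqxx.
  have nzb : b != 0.
    by apply: contraTneq (unit_nz uN (vec2_nz o)) => b0; rewrite Nb b0 scale0r eqxx.
  have iM : vec2 o *m invmx M = a^-1 *: vec2 o.
    by apply: (scalerI nza); rewrite scalerA mulfV // scale1r scalemxAl -Ma mulmxK.
  have iN : vec2 o *m invmx N = b^-1 *: vec2 o.
    by apply: (scalerI nzb); rewrite scalerA mulfV // scale1r scalemxAl -Nb mulmxK.
  rewrite /C !mulmxA iM -scalemxAl iN -!scalemxAl Ma -!scalemxAl Nb !scalerA.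
  by rewrite (_ : _ * _ = 1) ?scale1r //; field; rewrite nza nzb.
have detC : \det C = 1.
  rewrite /C !det_mulmx !det_inv; field.
  by rewrite -!unitfE -!unitmxE uM uN.
have C1 : C = 1%:M.
  have [[c Cc]|nsC] := pselect (scalar C).
    have := Co; rewrite Cc mul_mx_scalar -{2}[vec2 o]scale1r => /eqP.
    by rewrite -subr_eq0 -scalerBl scaler_eq0 (negPf (vec2_nz o)) orbF subr_eq0 => /eqP ->.
  have [k k_gt0 Ck] := projective_order gC.
  have [w nwo Cw] : exists2 w, w != o & act C w = w.
    have [o1 [o2 [n12 C1 C2]]] := two_fixed charK0 uC nsC k_gt0 Ck.
    have [e|] := eqVneq o1 o; last by exists o1.
    by exists o2 => //; rewrite -e eq_sym.
  have [b Cb] := (act_fixP w uC).1 Cw.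
  pose P := \matrix_(i < 2) (if i == 0 then vec2 o else vec2 w) : 'M[K]_2.
  have uP : P \in unitmx.
    rewrite -row_free_unit -kermx_eq0; apply/eqP/row_matrixP => i; rewrite row0.
    set u := row i _; have uP0 : u *m P = 0 by apply: sub_kermxP; apply: row_sub.
    have e : u 0 0 *: vec2 o + u 0 1 *: vec2 w = 0.
      by rewrite -uP0 mulmx_sum_row !big_ord_recl big_ord0 addr0 !rowK /=; congr (_ + u 0 _ *: _); apply: val_inj.
    have u1 : u 0 1 = 0.
      apply/eqP; apply/negPn/negP => nz; case/eqP: nwo.
      have we : vec2 w = (- (u 0 0 / u 0 1)) *: vec2 o.
        apply: (scalerI nz); rewrite scalerA mulrN mulrC divfK // scaleNr.
        by apply/eqP; rewrite -addr_eq0 addrC e.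
      rewrite -[w]pt_vec we pt_scale ?pt_vec //.
      by apply: contraNneq (vec2_nz w) => z; rewrite we z scale0r.
    have u0 : u 0 0 = 0.
      by move/eqP: e; rewrite u1 scale0r addr0 scaler_eq0 (negPf (vec2_nz o)) orbF => /eqP.
    by apply: row2P; rewrite ?u0 ?u1 mxE.
  pose D : 'rV[K]_2 := \row_i (if i == 0 then 1 else b).
  have PC : P *m C = diag_mx D *m P.
    apply/row_matrixP => i; rewrite !row_mul rowK row_diag_mx mxE -scalemxAl -rowE rowK.
    by case: ifP => _; rewrite ?scale1r.
  have b1 : b = 1.
    have := congr1 determinant PC; rewrite (det_mulmx P C) (det_mulmx (diag_mx D)) detC mulr1 det_diag.
    rewrite !big_ord_recl big_ord0 !mxE /= mulr1 mul1r -{1}[\det P]mul1r => /eqP.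
    rewrite -subr_eq0 -mulrBl mulf_eq0 -[\det P == 0]negbK -unitfE -unitmxE uP orbF subr_eq0.
    by move/eqP.
  apply: (can_inj (mulKmx uP)); rewrite PC mulmx1.
  by rewrite (_ : diag_mx D = 1%:M) ?mul1mx //; apply/matrixP => i j; rewrite !mxE b1; case: (i == 0).
have comm : M *m N = N *m M.
  have : N *m M *m C = N *m M by rewrite C1 mulmx1.
  by rewrite /C !mulmxA mulmxK // mulmxV // mul1mx.
apply/eqP; apply/negPn/negP => nN; apply: nsM.
apply: (@three_fixed _ M [:: o; o'; act N o']) => //.
  rewrite /= !inE negb_or (eq_sym o o') noo (eq_sym o' (act N o')) nN !andbT /=.
  by apply: contra_neq noo => e; apply: (act_inj uN); rewrite -e No.
move=> x; rewrite !inE => /or3P [] /eqP -> //.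
by rewrite -actM // -comm actM // Mo'.
Qed.

End FiniteGroup.

(** * From rational maps to homologies *)

Local Open Scope classical_set_scope.
Local Open Scope card_scope.

Lemma card_seq (T : eqType) (A : set T) (s : seq T) :
  uniq s -> (forall x, A x <-> x \in s) -> A #= `I_(size s).
Proof.
case: s => [_ As|x0 s us As].
  suff -> : A = classical_sets.set0 by rewrite II0; apply: card_eq00.
  by apply/seteqP; split=> x // /As.
have -> : A = nth x0 (x0 :: s) @` `I_(size (x0 :: s)).
  apply/seteqP; split=> x.
    by move=> /As xs; exists (index x (x0 :: s)); [rewrite /mkset index_mem | rewrite nth_index].
  by move=> [i lti <-]; apply/As/mem_nth.
apply: inj_card_eq => i j; rewrite !classical_sets.inE => lti ltj /eqP.
by rewrite nth_uniq // => /eqP.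
Qed.

Section RootsOfUnity.
Variable K : closedFieldType.
Hypothesis charK0 : [pchar K] =i pred0.

(** In characteristic zero X ^ n - 1 is separable. *)
Lemma unity_roots n : (0 < n)%N -> exists s : seq K,
  [/\ uniq s, size s = n & forall z, (z \in s) = (z ^+ n == 1)].
Proof.
move=> n_gt0; have [r rE] := closed_field_poly_normal ('X^n - 1 : {poly K}).
have sz : size ('X^n - 1 : {poly K}) = n.+1 by rewrite size_XnsubC.
have lc : lead_coef ('X^n - 1 : {poly K}) = 1 by rewrite lead_coefDl ?lead_coefXn // size_polyXn size_polyN size_poly1.
rewrite lc scale1r in rE; exists r; split.
- rewrite -separable_prod_XsubC -rE separable_Xn_sub_1 //.
  by have/pcharf0P -> := charK0; rewrite -lt0n.
- by move: sz; rewrite rE size_prod_XsubC => -[].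
- by move=> z; rewrite -root_prod_XsubC -rE rootE !hornerE ?hornerXn subr_eq0.
Qed.

Lemma prim_root_ex n : (0 < n)%N -> exists z : K, n.-primitive_root z.
Proof.
move=> n_gt0; have [s [us szs sE]] := unity_roots n_gt0.
have /hasP [z _ zn] : has n.-primitive_root s.
  apply: has_prim_root => //; last by rewrite szs.
  by apply/allP => z; rewrite sE unity_rootE.
by exists z.
Qed.
End RootsOfUnity.

Section LinearTriples.
Variable K : closedFieldType.
Implicit Types (M N : 'M[K]_3).

Lemma lin1 : lin (1%:M : 'M[K]_3) = id_triple K.
Proof.
apply: eq_from_tnth => i; rewrite !tnth_mktuple (bigD1 i) //= mxE eqxx scale1r.
by rewrite big1 ?addr0 // => j nji; rewrite mxE (negPf nji) scale0r.
Qed.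

Lemma comp_lin M N : comp_triple (lin M) (lin N) = lin (N *m M).
Proof.
apply: eq_from_tnth => i; rewrite !tnth_mktuple raddf_sum /=.
under eq_bigr => j _ do rewrite comp_mpolyZ comp_mpolyXU -tnth_nth tnth_mktuple scaler_sumr.
rewrite exchange_big /=; apply: eq_bigr => k _; rewrite mxE scaler_suml.
by apply: eq_bigr => j _; rewrite scalerA mulrC.
Qed.

Lemma iter_comp_lin M k : iter k (comp_triple (lin M)) (id_triple K) = lin (iter k (mulmx^~ M) 1%:M).
Proof. by elim: k => [|k IH]; rewrite ?lin1 //= IH comp_lin. Qed.

Lemma linear_triple_lin M : linear_triple (linfun (mulmxr M)) = lin M.
Proof.
apply: eq_from_tnth => i; rewrite !tnth_mktuple; apply: eq_bigr => j _.
by rewrite lfunE /= -rowE mxE.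
Qed.
End LinearTriples.

Section Bridge.
Variables (K : closedFieldType).
Hypothesis charK0 : [pchar K] =i pred0.
Variables (d : nat) (F : {mpoly K[3]}).
Hypothesis d_gt1 : (1 < d)%N.
Hypothesis smoothC : smooth_plane_curve F d.
Implicit Types (G H : {mpoly K[3]}) (u v w p a b : 'rV[K]_3) (x y z s t k : K) (M N : 'M[K]_3) (ph : 'cV[K]_3).
Implicit Types (P Q : proj_point K) (A B : triple K).
Let homF : F \is d.-homog. Proof. by case: smoothC. Qed.

Lemma along_scale k p M : along (k *: p) M -> along p M.
Proof. by move=> alM v; have [c ->] := alM v; exists (c * k); rewrite scalerA. Qed.

Section Center.
Variable p : 'rV[K]_3.
Hypothesis Fp : F.@[p 0] != 0.

Lemma curve_point : exists2 v : 'rV[K]_3, F.@[v 0] = 0 & v != 0.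
Proof.
have [ph pph] := dual_exists (nz_of_F d_gt1 smoothC Fp).
have [v Fv nz] := point_off_axis charK0 d_gt1 smoothC Fp pph; exists v => //.
by apply: contraNneq nz => ->; rewrite dot0.
Qed.

Lemma irreducible_forms e e' G H : G \is e.-homog -> H \is e'.-homog ->
  (forall v, F.@[v 0] = 0 -> G.@[v 0] * H.@[v 0] = 0) ->
  (forall v, F.@[v 0] = 0 -> G.@[v 0] = 0) \/ (forall v, F.@[v 0] = 0 -> H.@[v 0] = 0).
Proof.
have [k nzk Fkp] := normalize_center d_gt1 smoothC Fp.
have [a [b ua]] := frame_exists (nz_of_F d_gt1 smoothC Fp).
exact: (forms_irreducible charK0 d_gt1 smoothC (frame_scale nzk ua) Fkp).
Qed.

Lemma same_ratmap_sym A B : same_ratmap F A B -> same_ratmap F B A.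
Proof.
by case=> rA rB e; split=> // v Fv i j; have := e v Fv j i; rewrite mulrC => ->; rewrite mulrC.
Qed.

Lemma ratmap_lin M : M \in unitmx -> ratmap F (lin M).
Proof.
move=> uM; split; first by exists 1%N; apply: lin_homog.
have [v Fv nzv] := curve_point; exists v => //; rewrite ev_lin.
by apply: contra_neq nzv => e; rewrite -[v](mulmxK uM) e mul0mx.
Qed.

Lemma same_ratmap_refl A : ratmap F A -> same_ratmap F A A.
Proof. by move=> rA; split=> // v _ i j; rewrite mulrC. Qed.

(** Two triples that agree with B agree with each other where some fixed entry of
    B is nonzero, hence everywhere since the curve is irreducible. *)
Lemma same_ratmap_trans A B D : same_ratmap F A B -> same_ratmap F B D -> same_ratmap F A D.
Proof.
case=> rA rB AB [_ rD BD]; split=> // v Fv i j.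
have [[e1 hA] _] := rA; have [[e2 hB] [w Fw /rV0Pn [k nzk]]] := rB; have [[e3 hD] _] := rD.
pose G := tnth A i * tnth D j - tnth A j * tnth D i.
have hG : G \is (e1 + e3).-homog by rewrite rpredB // dhomogM.
have GE u : G.@[u 0] = ev A u 0 i * ev D u 0 j - ev A u 0 j * ev D u 0 i.
  by rewrite rmorphB !rmorphM /= ![in RHS]mxE.
have [|G0|B0] := irreducible_forms hG (hB k).
- move=> u Fu; rewrite GE.
  have -> : (tnth B k).@[u 0] = ev B u 0 k by rewrite mxE.
  have := AB u Fu; have := BD u Fu.
  set X := ev A u; set Y := ev B u; set Z := ev D u => YZ XY.
  have [e|nzY] := eqVneq (Y 0 k) 0; first by rewrite e mulr0.
  suff -> : X 0 i * Z 0 j = X 0 j * Z 0 i by rewrite subrr mul0r.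
  have XE m : X 0 m = X 0 k / Y 0 k * Y 0 m.
    by apply: (mulIf nzY); rewrite XY; field.
  have ZE m : Z 0 m = Z 0 k / Y 0 k * Y 0 m.
    by apply: (mulIf nzY); rewrite mulrC YZ; field.
  by rewrite (XE i) (XE j) (ZE i) (ZE j); ring.
- by apply/eqP; rewrite -subr_eq0 -GE; apply/eqP/G0.
- by move: nzk; rewrite mxE B0 // eqxx.
Qed.

Section Point.
Variable P : proj_point K.
Hypothesis Pp : (P : {vspace _}) = <[p]>%VS.

Lemma Grep_lin M : autC F M -> along p M -> Grep F P (lin M).
Proof.
move=> aM alM; have [uM _] := aM.
have rs N : autC F N -> rational_selfmap F (lin N).
  move=> aN; split; first by apply: ratmap_lin; case: aN.
  by move=> v Fv; rewrite ev_lin; apply/eqP; rewrite (autC_zero _ aN) Fv.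
have r1 := same_ratmap_refl (ratmap_lin (unitmx1 K 3)).
split.
  split; first exact: rs.
  exists (lin (invmx M)); split; first exact/rs/autCV.
    by rewrite comp_lin mulVmx // -lin1.
  by rewrite comp_lin mulmxV // -lin1.
move=> v Fv _ _; rewrite ev_lin Pp; have [c ->] := alM v.
apply/eqP; rewrite eqEsubv !subv_add !addvSl /= -!memvE.
apply/andP; split.
  by rewrite addrC; apply: memv_add; rewrite ?memv_line // memvZ // memv_line.
rewrite -{1}[v](addrK (c *: p)) addrC; apply: memv_add; last exact: memv_line.
by rewrite memvN memvZ // memv_line.
Qed.

Lemma Grep_linear A : Grep F P A ->
  exists M, [/\ autC F M, along p M & same_ratmap F A (lin M)].
Proof.
case=> [[[[[e hA] Anz] AC] _] AP].
have [k nzk Fkp] := normalize_center d_gt1 smoothC Fp.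
have [a [b ua]] := frame_exists (nz_of_F d_gt1 smoothC Fp).
have ukp := frame_scale nzk ua.
have AP' s t : F.@[(t *: (k *: p) + s *: a + b) 0] = 0 ->
  exists c k', ev A (t *: (k *: p) + s *: a + b) = c *: (k *: p) + k' *: (t *: (k *: p) + s *: a + b).
  set v := t *: (k *: p) + s *: a + b => Fv.
  have nvP : v \notin (P : {vspace _}).
    rewrite Pp; apply/negP => /vlineP [c vE].
    have [] := @frame_free _ p a b (t * k - c) s 1 ua.
      transitivity (v - c *: p); last by rewrite vE subrr.
      by apply/rowP => i; rewrite /v !mxE; ring.
    by move=> _ _ /eqP; rewrite oner_eq0.
  have [|nAv] := boolP (ev A v \in (P : {vspace _})).
    rewrite Pp => /vlineP [c ->]; exists (c / k), 0.
    by rewrite scale0r addr0 scalerA divfK.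
  have := AP v Fv nvP nAv; rewrite Pp => e2.
  have : ev A v \in (<[p]> + <[v]>)%VS by rewrite -e2 (subvP (addvSr _ _)) // memv_line.
  case/memv_addP => _ /vlineP [c ->] [_ /vlineP [k' ->]] ->.
  by exists (c / k), k'; rewrite scalerA divfK.
have [M [uM alM FM same]] := fibre_map_linear charK0 d_gt1 smoothC ukp Fkp hA AC AP' Anz.
have alpM : along p M by exact: along_scale alM.
exists M; split=> //; first exact: (along_autC charK0 d_gt1 smoothC Fp).
split; [by split; [exists e | ] | exact: ratmap_lin |].
by move=> v Fv i j; rewrite ev_lin; apply: same.
Qed.

(** M and N agree up to a scalar at every point of the curve, and along p the
    scalar is one; so the homology M N^-1 fixes the curve pointwise, and the curve
    has points off its axis. *)
Lemma lin_inj M N : autC F M -> along p M -> autC F N -> along p N ->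
  same_ratmap F (lin M) (lin N) -> M = N.
Proof.
move=> aM alM aN alN [_ _ e]; have [uM _] := aM; have [uN _] := aN.
have nzp := nz_of_F d_gt1 smoothC Fp.
have eqon v : F.@[v 0] = 0 -> v *m M = v *m N.
  move=> Fv; have [v0|nzv] := eqVneq v 0; first by rewrite v0 !mul0mx.
  have nv : ~~ (v <= p)%MS.
    apply/negP => /sub_rVP [c vE]; move: Fv nzv; rewrite vE (F_scale smoothC).
    move/eqP; rewrite mulf_eq0 (negPf Fp) orbF expf_eq0 => /andP [_ /eqP ->].
    by rewrite scale0r eqxx.
  have [c vM] := alM v; have [c' vN] := alN v.
  have nzvN : v *m N != 0 by apply: contra_neq nzv => e0; rewrite -[v](mulmxK uN) e0 mul0mx.
  have /rV0Pn [i nzi] := nzvN; pose r := (v *m M) 0 i / (v *m N) 0 i.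
  have vMN : v *m M = r *: (v *m N).
    apply/rowP => j; rewrite [RHS]mxE; apply: (mulIf nzi).
    by have := e v Fv j i; rewrite !ev_lin => ->; rewrite /r; field.
  have [a ua] := frame_extend nzp nv.
  have [] := @frame_free _ p a v (c - r * c') 0 (1 - r) ua.
    rewrite scale0r addr0 !scalerBl scale1r -scalerA.
    by move: vMN; rewrite vM vN scalerDr => /eqP; rewrite -subr_eq0 => /eqP <-; apply/rowP => j; rewrite !mxE; ring.
  move=> /eqP; rewrite subr_eq0 => /eqP cE _ /eqP; rewrite subr_eq0 => /eqP r1.
  by rewrite vM vN cE -r1 mul1r.
pose L := M *m invmx N.
suff L1 : L = 1%:M by rewrite -[M](mulmxKV uN) -/L L1 mul1mx.
have aL : autC F L by apply: autCM => //; apply: autCV.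
have alL : along p L by apply: alongM => //; apply: alongV.
apply/eqP; apply/negPn/negP => nL.
have [ph [n [pph _ _ qE]]] := qg_exists charK0 d_gt1 smoothC Fp aL alL nL.
have [/(_ (conj aL alL)) [z zn LE] _] := qE L.
have [v Fv nzv] := point_off_axis charK0 d_gt1 smoothC Fp pph.
have : v *m L = v by rewrite /L mulmxA eqon // mulmxK.
rewrite LE homE -{3}[v]addr0 => /addrI /eqP.
rewrite scaler_eq0 (negPf nzp) orbF mulf_eq0 (negPf nzv) orbF subr_eq0 => /eqP z1.
by move: nL; rewrite LE z1 hom1 eqxx.
Qed.

Lemma ratmap_class_eq A B : same_ratmap F A B -> ratmap_class F A = ratmap_class F B.
Proof.
move=> AB; apply/seteqP; split=> D; last exact: same_ratmap_trans.
by apply: same_ratmap_trans; apply: same_ratmap_sym.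
Qed.

(** The classes of rational maps in G[P] correspond to the n-th roots of unity. *)
Lemma groupG_card ph n : qg F p ph n -> groupG F P #= `I_n.
Proof.
move=> q; have [pph _ n_gt1 qE] := q.
have [s [us szs sE]] := unity_roots charK0 (ltnW n_gt1).
have al z : z ^+ n = 1 -> autC F (hom p ph z) /\ along p (hom p ph z).
  by move=> zn; apply/qE; exists z.
have -> : groupG F P = (fun z => ratmap_class F (lin (hom p ph z))) @` [set z | z \in s].
  apply/seteqP; split=> X.
    move=> [A gA <-]; have [M [aM alM AM]] := Grep_linear gA.
    have [/(_ (conj aM alM)) [z zn ME] _] := qE M.
    exists z; first by rewrite /mkset sE zn.
    by rewrite -ME; apply/esym/ratmap_class_eq.
  move=> [z]; rewrite /mkset sE => /eqP /al [az alz] <-.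
  by exists (lin (hom p ph z)) => //; apply: Grep_lin.
have inj : {in [set z | z \in s] &, injective (fun z => ratmap_class F (lin (hom p ph z)))}.
  move=> z y; rewrite !classical_sets.inE /mkset !sE => /eqP /al [az alz] /eqP /al [ay aly] e.
  apply: (hom_inj pph); apply: (lin_inj az alz ay aly).
  have : ratmap_class F (lin (hom p ph y)) (lin (hom p ph y)).
    by apply: same_ratmap_refl; apply: ratmap_lin; case: ay.
  by rewrite -e.
apply: card_eq_trans (inj_card_eq inj) _.
by rewrite -szs; apply: card_seq.
Qed.

Lemma quasi_Galois_qg : quasi_Galois F P -> exists ph n, qg F p ph n.
Proof.
move=> qG; apply: contrapT => no.
have sub : groupG F P `<=` [set ratmap_class F (lin 1%:M)].
  move=> _ [A gA <-]; have [M [aM alM AM]] := Grep_linear gA.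
  have [M1|nM] := eqVneq M 1%:M; first by rewrite /mkset -M1; apply: ratmap_class_eq.
  by case: no; apply: (qg_exists charK0 d_gt1 smoothC Fp aM alM nM).
have := card_le_trans qG (subset_card_le sub).
move=> le; have : `I_2 #<= `I_1.
  by apply: card_le_trans le _; have := @card_set1 _ (ratmap_class F (lin (1%:M : 'M[K]_3))); rewrite card_eq_le => /andP [].
by rewrite card_le_II.
Qed.

End Point.
End Center.

Lemma on_curveP p P : (P : {vspace _}) = <[p]>%VS -> on_curve F P <-> F.@[p 0] = 0.
Proof.
move=> Pp; split=> [oc|Fp v].
  by apply: oc; rewrite Pp memv_line.
by rewrite Pp => /vlineP [k ->]; rewrite (F_scale smoothC) Fp mulr0.
Qed.

Lemma DeltaP p P n : (1 < n)%N -> (P : {vspace _}) = <[p]>%VS ->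
  Delta F n P <-> exists ph, qg F p ph n.
Proof.
move=> n_gt1 Pp; split=> [[nC qG cP]|[ph q]].
  have Fp : F.@[p 0] != 0 by apply/eqP => /(on_curveP Pp).
  have [ph [m q]] := quasi_Galois_qg Fp Pp qG; exists ph.
  have := card_eq_trans (card_esym cP) (groupG_card Fp Pp q).
  by move/card_eq_II ->.
have [_ Fp _ _] := q.
have cP := groupG_card Fp Pp q; split=> //; first by move/(on_curveP Pp) => e; rewrite e eqxx in Fp.
rewrite /quasi_Galois; apply: card_le_trans (_ : `I_2 #<= `I_n) _; first by rewrite card_le_II.
by have := card_esym cP; rewrite card_eq_le => /andP [].
Qed.

Lemma Delta_geP p P m : (1 < m)%N -> (P : {vspace _}) = <[p]>%VS ->
  Delta_ge F m P <-> exists ph n, (m <= n)%N /\ qg F p ph n.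
Proof.
move=> m_gt1 Pp; split=> [[nC qG cP]|[ph [n [le_mn q]]]].
  have Fp : F.@[p 0] != 0 by apply/eqP => /(on_curveP Pp).
  have [ph [n q]] := quasi_Galois_qg Fp Pp qG; exists ph, n; split=> //.
  have := card_le_trans cP (_ : groupG F P #<= `I_n).
  by rewrite card_le_II; apply; by have := groupG_card Fp Pp q; rewrite card_eq_le => /andP [].
have [_ Fp n_gt1 _] := q; have cP := groupG_card Fp Pp q.
split; first by move/(on_curveP Pp) => e; rewrite e eqxx in Fp.
  rewrite /quasi_Galois; apply: card_le_trans (_ : `I_2 #<= `I_n) _; first by rewrite card_le_II.
  by have := card_esym cP; rewrite card_eq_le => /andP [].
apply: card_le_trans (_ : `I_m #<= `I_n) _; first by rewrite card_le_II.
by have := card_esym cP; rewrite card_eq_le => /andP [].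
Qed.

End Bridge.

(** * Two centres and their triangle *)

Section Curve.
Variables (K : closedFieldType).
Hypothesis charK0 : [pchar K] =i pred0.
Variables (d : nat) (F : {mpoly K[3]}).
Hypothesis d_gt1 : (1 < d)%N.
Hypothesis smoothC : smooth_plane_curve F d.
Implicit Types (G : {mpoly K[3]}) (u v w p q r a b : 'rV[K]_3) (x y z s t k : K) (M N : 'M[K]_3) (ph : 'cV[K]_3).
Let homF : F \is d.-homog. Proof. by case: smoothC. Qed.

Lemma qg_nz p ph n : qg F p ph n -> p != 0.
Proof. by case=> _ Fp _ _; apply: (nz_of_F d_gt1 smoothC Fp). Qed.

Lemma qg_scale k p ph n : k != 0 -> qg F p ph n -> qg F (k *: p) (k^-1 *: ph) n.
Proof.
move=> nzk [pph Fp n_gt1 qE]; have homS z : hom (k *: p) (k^-1 *: ph) z = hom p ph z.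
  by rewrite /hom -scalemxAl -scalemxAr [k^-1 *: _]scalerA mulVf // scale1r.
split=> //.
- by rewrite dotZ dotZr pph mulr1 mulfV.
- by rewrite (F_scale smoothC) mulf_neq0 ?expf_neq0.
move=> M; split=> [[aM alM]|[z zn ->]].
  have [/(_ (conj aM (along_scale alM))) [z zn ->] _] := qE M.
  by exists z.
have [_ /(_ (ex_intro2 _ _ z zn erefl)) [aM alM]] := qE (hom p ph z).
by rewrite homS; split=> // v; have [c ->] := alM v; exists (c / k); rewrite scalerA divfK.
Qed.

Lemma hom_conj N p ph z : N \in unitmx ->
  hom (p *m N) (invmx N *m ph) z = invmx N *m hom p ph z *m N.
Proof.
move=> uN; rewrite /hom mulmxDr mulmxDl mulmx1 mulVmx //.
by rewrite -scalemxAr -scalemxAl !mulmxA.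
Qed.

Lemma qg_conj N p ph n : autC F N -> qg F p ph n -> qg F (p *m N) (invmx N *m ph) n.
Proof.
move=> aN [pph Fp n_gt1 qE]; have [uN _] := aN; split=> //.
- by rewrite dotM mulmxA mulmxV // mul1mx.
- by rewrite (autC_zero _ aN).
move=> M; split=> [[aM alM]|[z zn ->]].
  pose M' := N *m M *m invmx N.
  have aM' : autC F M' by apply: autCM; [apply: autCM | apply: autCV].
  have alM' : along p M'.
    move=> v; have [c vM] := alM (v *m N); exists c.
    by rewrite /M' !mulmxA vM mulmxDl mulmxK // -scalemxAl mulmxK.
  have [/(_ (conj aM' alM')) [z zn ME] _] := qE M'.
  exists z => //; rewrite hom_conj // -ME /M' !mulmxA mulVmx // mul1mx.
  by rewrite mulmxKV.
have [_ /(_ (ex_intro2 _ _ z zn erefl)) [aM alM]] := qE (hom p ph z).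
rewrite hom_conj //; split; first by apply: autCM => //; apply: autCM => //; apply: autCV.
by rewrite -hom_conj //; apply: along_hom.
Qed.

Lemma qg_prim p ph n : qg F p ph n -> exists z : K, n.-primitive_root z.
Proof. by case=> _ _ n_gt1 _; apply: prim_root_ex => //; apply: ltnW. Qed.

Lemma prim_neq1 n z : n.-primitive_root z -> (1 < n)%N -> z != 1.
Proof.
move=> pz n_gt1; apply/eqP => z1.
by have := prim_order_dvd pz 1; rewrite expr1 z1 eqxx dvdn1 => /eqP n1; rewrite n1 in n_gt1.
Qed.

Lemma qg_unique p ph n ph' n' : qg F p ph n -> qg F p ph' n' -> ph = ph' /\ n = n'.
Proof.
move=> q q'; have [pph _ n_gt1 qE] := q; have [pph' _ n_gt1' qE'] := q'.
have [z pz] := qg_prim q; have nz1 := prim_neq1 pz n_gt1.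
have eph : ph = ph'.
  have [_ /(_ (ex_intro2 _ _ z (prim_expr_order pz) erefl)) hz] := qE (hom p ph z).
  have [/(_ hz) [y yn e] _] := qE' (hom p ph z).
  have zy : z = y.
    have := congr1 (mulmx p) e; rewrite !hom_center // => /eqP.
    by rewrite -subr_eq0 -scalerBl scaler_eq0 (negPf (qg_nz q)) orbF subr_eq0 => /eqP.
  have dE v : dot v ph = dot v ph'.
    have := congr1 (mulmx v) e; rewrite !homE zy => /addrI /eqP.
    rewrite -subr_eq0 -scalerBl scaler_eq0 (negPf (qg_nz q)) orbF -mulrBr mulf_eq0.
    by rewrite subr_eq0 -zy (negPf nz1) /= subr_eq0 => /eqP.
  apply/matrixP => i j; rewrite ord1; have := dE (delta_mx 0 i).
  by rewrite /dot -!rowE !mxE.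
split=> //; rewrite -eph in q'; apply/eqP; rewrite eqn_dvd; apply/andP; split.
  rewrite (prim_order_dvd pz); apply/eqP/(qg_root q')/(qg_aut q).
  exact: prim_expr_order.
have [z' pz'] := qg_prim q'.
rewrite (prim_order_dvd pz'); apply/eqP/(qg_root q)/(qg_aut q').
exact: prim_expr_order.
Qed.

(** The two centres and their axes extend to a basis and its dual basis; r is the
    intersection of the axes and ps the joining line. *)
Lemma dual_third p1 ph1 p2 ph2 : dot p1 ph1 = 1 -> dot p2 ph2 = 1 ->
  dot p1 ph2 = 0 -> dot p2 ph1 = 0 -> exists r ps,
  [/\ dot r ps = 1, dot r ph1 = 0 & dot r ph2 = 0] /\
  [/\ dot p1 ps = 0, dot p2 ps = 0 & forall v, v = dot v ph1 *: p1 + dot v ph2 *: p2 + dot v ps *: r].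
Proof.
move=> d11 d22 d12 d21.
have nz1 : p1 != 0 by apply: contra_eq_neq d11 => ->; rewrite dot0 eq_sym oner_neq0.
have np : ~~ (p2 <= p1)%MS.
  apply/negP => /sub_rVP [k e]; have := d22; rewrite e dotZ d12 mulr0 => /eqP.
  by rewrite eq_sym oner_eq0.
have [a ua] := frame_extend nz1 np.
pose r := a - dot a ph1 *: p1 - dot a ph2 *: p2.
have r1 : dot r ph1 = 0.
  by rewrite /r -!scaleNr !dotD !dotZ d11 d21 mulr0 mulr1 addr0 subrr.
have r2 : dot r ph2 = 0.
  by rewrite /r -!scaleNr !dotD !dotZ d22 d12 mulr0 mulr1 addr0 subrr.
have ur : frame p1 p2 r \in unitmx.
  apply: frameP => x y z e.
  have [|ex z0 ey] := @frame_free _ p1 a p2 (x - z * dot a ph1) z (y - z * dot a ph2) ua.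
    by rewrite -e /r; apply/rowP => i; rewrite !mxE; ring.
  by move: ex ey; rewrite z0 !mul0r !subr0 => -> ->.
pose ps : 'cV[K]_3 := invmx (frame p1 p2 r) *m delta_mx 2%:R 0.
have psE x y z : dot (x *: p1 + y *: p2 + z *: r) ps = z.
  by rewrite /dot /ps mulmxA frame_coord // -colE !mxE.
exists r, ps; split; split=> //.
- by have := psE 0 0 1; rewrite !scale0r !add0r scale1r.
- by have := psE 1 0 0; rewrite !scale0r !addr0 scale1r.
- by have := psE 0 1 0; rewrite !scale0r add0r addr0 scale1r.
move=> v; have [x [y [z vE]]] := frame_span v ur.
have -> : dot v ph1 = x by rewrite vE !dotD !dotZ d11 d21 r1 !mulr0 !addr0 mulr1.
have -> : dot v ph2 = y by rewrite vE !dotD !dotZ d22 d12 r2 !mulr0 addr0 add0r mulr1.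
by rewrite {2}vE psE.
Qed.

(** As a form, so that it can be differentiated again. *)
Definition dform G w : {mpoly K[3]} := \sum_i w 0 i *: G^`M(i).

Lemma dformE G w v : (dform G w).@[v 0] = ddir G v w.
Proof. by rewrite /dform raddf_sum; apply: eq_bigr => i _; rewrite /= mevalZ. Qed.

Lemma ddir_chain G G' M k : (forall v, G'.@[(v *m M) 0] = k * G.@[v 0]) ->
  forall v w, ddir G' (v *m M) (w *m M) = k * ddir G v w.
Proof.
move=> GM v w; have := online_deriv G' (v *m M) (w *m M) 0.
rewrite scale0r addr0 => <-; have := online_deriv G v w 0; rewrite scale0r addr0 => <-.
suff -> : online G' (v *m M) (w *m M) = k *: online G v w by rewrite derivZ hornerZ.
apply: (poly_eq_ext charK0) => t; rewrite hornerZ !online_eval -GM.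
by rewrite mulmxDl scalemxAl.
Qed.

Lemma dform_chain G G' M k w : (forall v, G'.@[(v *m M) 0] = k * G.@[v 0]) ->
  forall v, (dform G' (w *m M)).@[(v *m M) 0] = k * (dform G w).@[v 0].
Proof. by move=> GM v; rewrite !dformE (ddir_chain GM). Qed.

Lemma ddir_dformD G v u w w' : ddir (dform G (w + w')) v u = ddir (dform G w) v u + ddir (dform G w') v u.
Proof.
have -> : dform G (w + w') = dform G w + dform G w'.
  by rewrite /dform -big_split /=; apply: eq_bigr => i _; rewrite mxE scalerDl.
move: (dform G w) (dform G w') => A B.
by rewrite /ddir -big_split; apply: eq_bigr => i _; rewrite mderivD mevalD mulrDr.
Qed.

Lemma ddir_dformZ G v u k w : ddir (dform G (k *: w)) v u = k * ddir (dform G w) v u.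
Proof.
have -> : dform G (k *: w) = k *: dform G w.
  by rewrite /dform scaler_sumr; apply: eq_bigr => i _; rewrite mxE scalerA.
by rewrite /ddir mulr_sumr; apply: eq_bigr => i _; rewrite mderivZ mevalZ mulrCA.
Qed.

Lemma dform_scale w k v : k != 0 -> (dform F w).@[(k *: v) 0] = k ^+ d.-1 * (dform F w).@[v 0].
Proof.
move=> nzk; have Fk u : F.@[(u *m k%:M) 0] = k ^+ d * F.@[u 0].
  by rewrite mul_mx_scalar (F_scale smoothC).
have := dform_chain w Fk v; rewrite !mul_mx_scalar !dformE ddirZ -(prednK (ltnW d_gt1)) exprS -mulrA.
by move/(mulfI nzk).
Qed.

Lemma euler_dform w v : ddir (dform F w) v v = d.-1%:R * (dform F w).@[v 0].
Proof.
have := online_deriv (dform F w) v v 0; rewrite scale0r addr0 => <-.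
suff -> : online (dform F w) v v = (dform F w).@[v 0] *: ('X + 1%:P) ^+ d.-1.
  rewrite derivZ deriv_exp derivD derivX derivC addr0 mul1r hornerZ hornerMn.
  by rewrite horner_exp hornerD hornerX hornerC add0r expr1n mulrC.
apply: (mulfI (_ : 'X + 1%:P != 0)); first by rewrite -size_poly_eq0 size_XaddC.
apply: (poly_eq_ext charK0) => t; rewrite !hornerM hornerD hornerX hornerC.
have [->|nz] := eqVneq (t + 1) 0; first by rewrite !mul0r.
rewrite hornerZ horner_exp hornerD hornerX hornerC online_eval; congr (_ * _).
by rewrite [RHS]mulrC -dform_scale // scalerDl scale1r addrC.
Qed.

Lemma qg_mult p ph n z u : qg F p ph n -> z ^+ n = 1 ->
  F.@[(u *m hom p ph z) 0] = z ^+ d * F.@[u 0].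
Proof.
move=> q zn; have [pph Fp _ _] := q; have [_ [c nzc FM]] := qg_aut q zn.
rewrite FM; congr (_ * _); apply: (mulIf Fp).
by rewrite -FM hom_center // (F_scale smoothC).
Qed.

(** Comparing derivatives at the fixed vector v in the fixed direction w shows that
    the homology multiplies F by one. *)
Lemma axis_tangent p ph n w v : qg F p ph n -> dot v ph = 0 -> dot w ph = 0 ->
  ddir F v w != 0 -> forall z, z ^+ n = 1 -> forall u, F.@[(u *m hom p ph z) 0] = F.@[u 0].
Proof.
move=> q v0 w0 nz z zn; have [_ [c nzc FM]] := qg_aut q zn.
have := ddir_chain FM v w; rewrite !hom_fix // => e.
have c1 : c = 1 by apply: (mulIf nz); rewrite mul1r.
by move=> u; rewrite FM c1 mul1r.
Qed.

(** Up to a scalar the homology with centre r, axis ps and multiplier y is the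
    product of the homologies with centres p1, p2 and multiplier 1 / y. It remains
    to see that r is off the curve: otherwise some derivative of F at r towards
    p1 or p2 is nonzero, say towards p'. The homologies of the other centre fix r
    and p', so z ^ d = 1; hence the homology with centre p' preserves F itself,
    but it multiplies that derivative by z. *)
Lemma third_qg p1 ph1 p2 ph2 n : qg F p1 ph1 n -> qg F p2 ph2 n ->
  dot p1 ph2 = 0 -> dot p2 ph1 = 0 -> exists r ps m,
  [/\ qg F r ps m, (n %| m)%N, dot r ph1 = 0 & dot r ph2 = 0] /\
  [/\ dot p1 ps = 0, dot p2 ps = 0 & forall v, v = dot v ph1 *: p1 + dot v ph2 *: p2 + dot v ps *: r].
Proof.
move=> q1 q2 d12 d21; have [d11 F1 n_gt1 _] := q1; have [d22 F2 _ _] := q2.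
have [r [ps [[rr r1 r2] [s1 s2 dec]]]] := dual_third d11 d22 d12 d21.
have [z pz] := qg_prim q1; have zn := prim_expr_order pz.
have nz1 := prim_neq1 pz n_gt1.
have nzr : r != 0 by apply: contra_eq_neq rr => ->; rewrite dot0 eq_sym oner_neq0.
have Fr : F.@[r 0] != 0.
  apply/eqP => Fr0; have [w nzw] := smooth_dir smoothC nzr Fr0.
  have eu : ddir F r r = 0 by apply: (euler_vanish charK0 homF).
  have tang p ph p' ph' : qg F p ph n -> qg F p' ph' n -> dot r ph = 0 -> dot r ph' = 0 ->
      dot p' ph = 0 -> ddir F r p' != 0 -> False.
    move=> q q' rp rp' pp' nzd; have [dd Fp _ _] := q; have [dd' _ _ _] := q'.
    have zd : z ^+ d = 1.
      apply: (mulIf Fp); rewrite mul1r -(qg_mult _ q zn).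
      exact: axis_tangent q rp pp' nzd z zn p.
    have FM u : F.@[(u *m hom p' ph' z) 0] = 1 * F.@[u 0] by rewrite (qg_mult _ q' zn) zd.
    have := ddir_chain FM r p'; rewrite hom_fix // hom_center // ddirZ => /(mulIf nzd) e.
    by rewrite e eqxx in nz1.
  have [e|] := eqVneq (ddir F r p1) 0; last exact: tang q2 q1 r2 r1 d12.
  have : ddir F r p2 != 0.
    by apply: contraNneq nzw => e2; rewrite (dec w) !ddirD !ddirZ e e2 eu !mulr0 !addr0.
  exact: tang q1 q2 r1 r2 d21.
have aR y : y ^+ n = 1 -> autC F (hom r ps y).
  move=> yn; have nzy : y != 0.
    by apply: contra_eq_neq yn => ->; rewrite expr0n gtn_eqF ?(ltnW n_gt1) // eq_sym oner_neq0.
  have yn' : y^-1 ^+ n = 1 by rewrite exprVn yn invr1.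
  have -> : hom r ps y = y *: (hom p1 ph1 y^-1 *m hom p2 ph2 y^-1).
    apply: mx_ext => v; rewrite -scalemxAr mulmxA !homE !dotD !dotZ d12 mulr0 addr0.
    have vi i : v 0 i = dot v ph1 * p1 0 i + dot v ph2 * p2 0 i + dot v ps * r 0 i.
      by rewrite {1}(dec v) !mxE.
    by apply/rowP => i; rewrite !mxE vi; field.
  by apply: (autCZ smoothC nzy); apply: autCM; [apply: (qg_aut q1) | apply: (qg_aut q2)].
have nhom : hom r ps z != 1%:M.
  by apply: contra_neq nz1 => e; apply: (hom_inj rr); rewrite e hom1.
have [ps' [m q]] := qg_exists charK0 d_gt1 smoothC Fr (aR z zn) (along_hom _ _ _) nhom.
have eps : ps' = ps.
  have [rr' _ _ qE] := q.
  have [/(_ (conj (aR z zn) (along_hom _ _ _))) [y ym e] _] := qE (hom r ps z).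
  have zy : z = y.
    have := congr1 (mulmx r) e; rewrite !hom_center // => /eqP.
    by rewrite -subr_eq0 -scalerBl scaler_eq0 (negPf nzr) orbF subr_eq0 => /eqP.
  have dE v : dot v ps' = dot v ps.
    have := congr1 (mulmx v) e; rewrite !homE zy => /addrI /eqP.
    rewrite -subr_eq0 -scalerBl scaler_eq0 (negPf nzr) orbF -mulrBr mulf_eq0.
    by rewrite subr_eq0 -zy (negPf nz1) /= subr_eq0 => /eqP ->.
  apply/matrixP => i j; rewrite ord1; have := dE (delta_mx 0 i).
  by rewrite /dot -!rowE !mxE.
rewrite {}eps in q; exists r, ps, m; split; split=> //.
by rewrite (prim_order_dvd pz); apply/eqP/(qg_root q)/aR.
Qed.

Lemma fixed0 (c e : K) : c != 1 -> c * e = e -> e = 0.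
Proof.
move=> nc /eqP; rewrite -subr_eq0 -{2}[e]mul1r -mulrBl mulf_eq0 subr_eq0 (negPf nc).
by move/eqP.
Qed.

(** Zero is then a root of multiplicity at least two. *)
Lemma only_root_deriv (h : {poly K}) : (2 < size h)%N -> (forall t, h.[t] = 0 -> t = 0) -> h^`().[0] = 0.
Proof.
move=> szh h0.
have [|x hx] := @closed_root K h; first by move: szh; case: (size h) => [|[|]].
have x0 := h0 x hx; rewrite x0 in hx.
have /factor_theorem [h1] : root h 0 by apply/rootP.
rewrite subr0 => hE.
have nzh1 : h1 != 0 by apply: contraTneq szh => e; rewrite hE e mul0r size_poly0.
have [|y h1y] := @closed_root K h1.
  by move: szh; rewrite hE size_mulX // ltnS; case: (size h1) => [|[|]].
have y0 : y = 0 by apply: h0; rewrite hE hornerM h1y mul0r.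
rewrite y0 in h1y.
by rewrite hE derivM hornerD !hornerM hornerX mulr0 h1y mul0r addr0.
Qed.

Lemma size_online_center v p : F.@[p 0] != 0 -> size (online F v p) = d.+1.
Proof.
move=> Fp; have nzc : (online F v p)`_d != 0 by rewrite (coef_online charK0 _ _ homF).
apply/eqP; rewrite eqn_leq (size_online charK0 _ _ homF) /= ltnNge.
by apply: contra nzc => le; rewrite nth_default.
Qed.

(** Otherwise the line meets the curve in a single point q, the trace of the axis
    of p1, and of the axis of p2 too; so the line is tangent at q, and by
    [axis_tangent] both homologies preserve F itself. This makes so many second
    derivatives of F at q vanish that, by Euler's relation for the first
    derivatives, q is a singular point. *)
Lemma line_curve_point p1 ph1 n1 p2 ph2 n2 : qg F p1 ph1 n1 -> (2 < n1)%N -> qg F p2 ph2 n2 ->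
  p2 - dot p2 ph1 *: p1 != 0 ->
  exists x y, F.@[(x *: p1 + y *: p2) 0] = 0 /\ dot (x *: p1 + y *: p2) ph1 != 0.
Proof.
move=> q1 n1_gt2 q2; set q := p2 - dot p2 ph1 *: p1 => nzq.
have [d11 F1 _ _] := q1; have [d22 F2 n2_gt1 _] := q2.
apply: contrapT => no; pose al := dot p2 ph1.
have onaxis x y : F.@[(x *: p1 + y *: p2) 0] = 0 -> dot (x *: p1 + y *: p2) ph1 = 0.
  by move=> Fv; apply/eqP; apply/negPn/negP => nz; apply: no; exists x, y.
have q1ph : dot q ph1 = 0 by rewrite /q -scaleNr dotD dotZ d11 mulr1 subrr.
have qt t : q + t *: p1 = (t - al) *: p1 + 1 *: p2.
  by rewrite /q /al; apply/rowP => i; rewrite !mxE; ring.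
have root0 t : F.@[(q + t *: p1) 0] = 0 -> t = 0.
  by rewrite qt => /onaxis; rewrite -qt dotD dotZ q1ph d11 add0r mulr1.
have Fq : F.@[q 0] = 0.
  have [t Ft] := line_meets_curve charK0 d_gt1 smoothC F1 q.
  by have t0 := root0 t Ft; rewrite t0 scale0r addr0 in Ft.
have nzal : al != 0.
  by apply/eqP => al0; move: Fq; rewrite /q -/al al0 scale0r subr0 => e; rewrite e eqxx in F2.
have p2E : p2 = al *: p1 + q by rewrite /q addrC subrK.
have [z pz] := qg_prim q1; have [y py] := qg_prim q2.
have zn := prim_expr_order pz; have yn := prim_expr_order py.
have nz1 : z != 1 by apply: prim_neq1 pz (ltnW n1_gt2).
have ny1 := prim_neq1 py n2_gt1.
have nzz2 : z ^+ 2 != 1.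
  by rewrite -(prim_order_dvd pz) gtnNdvd.
have qph2 : dot q ph2 = 0.
  have : F.@[(q *m hom p2 ph2 y) 0] = 0 by apply/eqP; rewrite (autC_zero _ (qg_aut q2 yn)) Fq.
  rewrite homE; set c := _ * _ => Fc.
  have qc : q + c *: p2 = (- al) *: p1 + (1 + c) *: p2.
    by rewrite /q -/al; apply/rowP => i; rewrite !mxE; ring.
  move: Fc; rewrite qc => /onaxis; rewrite -qc dotD dotZ q1ph add0r -/al => /eqP.
  by rewrite mulf_eq0 (negPf nzal) orbF mulf_eq0 subr_eq0 (negPf ny1) => /eqP.
have Dq : ddir F q q = 0 by apply: (euler_vanish charK0 homF).
have Dp1 : ddir F q p1 = 0.
  have := online_deriv F q p1 0; rewrite scale0r addr0 => <-; apply: only_root_deriv.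
    by rewrite size_online_center // ltnS.
  by move=> t; rewrite online_eval; apply: root0.
have Dp2 : ddir F q p2 = 0 by rewrite p2E ddirD ddirZ Dp1 Dq mulr0 addr0.
have [w0 nzw0] := smooth_dir smoothC nzq Fq.
pose w := w0 - dot w0 ph1 *: p1.
have wph1 : dot w ph1 = 0 by rewrite /w -scaleNr dotD dotZ d11 mulr1 subrr.
have nzw : ddir F q w != 0 by rewrite /w -scaleNr ddirD ddirZ Dp1 mulr0 addr0.
have F1M u : F.@[(u *m hom p1 ph1 z) 0] = 1 * F.@[u 0].
  by rewrite mul1r; apply: (axis_tangent q1 q1ph wph1 nzw zn).
pose w2 := w - dot w ph2 *: p2.
have w2ph2 : dot w2 ph2 = 0 by rewrite /w2 -scaleNr dotD dotZ d22 mulr1 subrr.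
have nzw2 : ddir F q w2 != 0 by rewrite /w2 -scaleNr ddirD ddirZ Dp2 mulr0 addr0.
have F2M u : F.@[(u *m hom p2 ph2 y) 0] = 1 * F.@[u 0].
  by rewrite mul1r; apply: (axis_tangent q2 qph2 w2ph2 nzw2 yn).
have qM1 := hom_fix p1 z q1ph; have qM2 := hom_fix p2 y qph2.
have wM1 := hom_fix p1 z wph1; have w2M2 := hom_fix p2 y w2ph2.
have pM1 := hom_center z d11; have pM2 := hom_center y d22.
(* a second derivative at q in two eigendirections vanishes unless the product
     of the eigenvalues is one; the products here are z, z ^ 2 and y *)
have D1 u : u *m hom p1 ph1 z = u -> ddir (dform F u) q p1 = 0.
  move=> uM; have GM v : (dform F u).@[(v *m hom p1 ph1 z) 0] = 1 * (dform F u).@[v 0].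
    by rewrite -{1}uM (dform_chain _ F1M).
  by have := ddir_chain GM q p1; rewrite qM1 pM1 ddirZ mul1r => /(fixed0 nz1).
have D11 : ddir (dform F p1) q p1 = 0.
  have GM v : (dform F (z *: p1)).@[(v *m hom p1 ph1 z) 0] = 1 * (dform F p1).@[v 0].
    by rewrite -pM1 (dform_chain _ F1M).
  by have := ddir_chain GM q p1; rewrite qM1 pM1 ddirZ ddir_dformZ mulrA mul1r => /(fixed0 nzz2).
have D22 : ddir (dform F w2) q p2 = 0.
  have GM v : (dform F w2).@[(v *m hom p2 ph2 y) 0] = 1 * (dform F w2).@[v 0].
    by rewrite -{1}w2M2 (dform_chain _ F2M).
  by have := ddir_chain GM q p2; rewrite qM2 pM2 ddirZ mul1r => /(fixed0 ny1).
have Dw2p1 : ddir (dform F w2) q p1 = 0.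
  rewrite /w2 -scaleNr ddir_dformD ddir_dformZ (D1 w) // p2E ddir_dformD ddir_dformZ.
  by rewrite D11 (D1 q) // !(mulr0, addr0).
move: D22; rewrite p2E ddirD ddirZ Dw2p1 mulr0 add0r euler_dform dformE => /eqP.
rewrite mulf_eq0 (negPf nzw2) orbF; have/pcharf0P -> := charK0.
by rewrite -subn1 subn_eq0 leqNgt d_gt1.
Qed.

End Curve.

(** * The action on a line *)

Section Line.
Variables (K : closedFieldType).
Hypothesis charK0 : [pchar K] =i pred0.
Variables (d : nat) (F : {mpoly K[3]}).
Hypothesis d_gt1 : (1 < d)%N.
Hypothesis smoothC : smooth_plane_curve F d.
Implicit Types (u v w p q r t : 'rV[K]_3) (x y z k : K) (M N : 'M[K]_3) (ph : 'cV[K]_3) (o : option K).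
Variable B : 'M[K]_(2, 3).
Hypothesis freeB : row_free B.

(** The line is the row space of B, with the projective coordinate o; res M is
    the matrix of M on the line. *)
Definition pe o : 'rV[K]_3 := vec2 o *m B.
Definition res M : 'M[K]_2 := B *m M *m pinvmx B.
Definition stab M := (B *m M <= B)%MS.

Lemma resK M : stab M -> res M *m B = B *m M.
Proof. exact: mulmxKpV. Qed.

Lemma res_uniq M (N' : 'M[K]_2) : N' *m B = B *m M -> res M = N'.
Proof.
move=> e; apply: (row_free_inj freeB); rewrite /= resK // /stab -e; exact: submxMl.
Qed.

Lemma res1 : res 1%:M = 1%:M.
Proof. by apply: res_uniq; rewrite mul1mx mulmx1. Qed.

Lemma resM M N : stab M -> stab N -> res (M *m N) = res M *m res N.
Proof. by move=> sM sN; apply: res_uniq; rewrite -mulmxA (resK sN) mulmxA (resK sM) -mulmxA. Qed.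

Lemma peM o M : stab M -> pe o *m M = (vec2 o *m res M) *m B.
Proof. by move=> sM; rewrite /pe -[LHS]mulmxA -[RHS]mulmxA (resK sM). Qed.

Lemma pe_in o : (pe o <= B)%MS. Proof. exact: submxMl. Qed.

Lemma pe_nz o : pe o != 0.
Proof.
apply: contraTneq (vec2_nz o) => e; rewrite negbK; apply/eqP.
by apply: (row_free_inj freeB); rewrite /= -/(pe o) e mul0mx.
Qed.

Lemma pe_inj o o' k : pe o = k *: pe o' -> o = o'.
Proof.
move=> e; have : vec2 o = k *: vec2 o' by apply: (row_free_inj freeB); rewrite /= -scalemxAl.
move=> e'; rewrite -[o]pt_vec e' pt_scale ?pt_vec //.
by apply: contraNneq (vec2_nz o) => k0; rewrite e' k0 scale0r.
Qed.

Lemma in_line v : (v <= B)%MS -> v != 0 -> exists o k, k != 0 /\ v = k *: pe o.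
Proof.
move=> /submxP [u ->] nz; have nzu : u != 0 by apply: contraNneq nz => ->; rewrite mul0mx.
have [k nzk uE] := vec_pt nzu; exists (pt u), k; split=> //.
by rewrite {1}uE -scalemxAl.
Qed.

Lemma act_res o M : stab M -> res M \in unitmx -> exists2 k, k != 0 & pe o *m M = k *: pe (act (res M) o).
Proof.
move=> sM uM; have [k nzk e] := vec_pt (unit_nz uM (vec2_nz o)).
by exists k => //; rewrite peM // e -scalemxAl.
Qed.

Lemma act_res_eq o o' k M : stab M -> res M \in unitmx -> pe o *m M = k *: pe o' -> act (res M) o = o'.
Proof.
move=> sM uM e; have [k' nzk' e'] := act_res o sM uM.
apply: (@pe_inj _ _ (k / k')); apply: (scalerI nzk').
by rewrite -e' e scalerA mulrC divfK.
Qed.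

Lemma scalar_res M : stab M -> scalar (res M) <-> exists c, forall v, (v <= B)%MS -> v *m M = c *: v.
Proof.
move=> sM; split=> [[c e]|[c e]]; exists c.
  by move=> v /submxP [u ->]; rewrite -mulmxA -resK // e mulmxA mul_mx_scalar -scalemxAl.
apply: res_uniq; rewrite mul_scalar_mx; apply/row_matrixP => i.
by rewrite row_mul e ?row_sub // linearZ.
Qed.

Lemma along_stab p M : (p <= B)%MS -> along p M -> stab M.
Proof.
move=> pB alM; apply/row_subP => i; rewrite row_mul.
by have [c ->] := alM (row i B); rewrite addmx_sub ?row_sub // scalemx_sub.
Qed.

Lemma axis_point p ph : (p <= B)%MS -> dot p ph = 1 ->
  exists q, [/\ (q <= B)%MS, q != 0 & dot q ph = 0].
Proof.
move=> pB pp; pose q i := row i B - dot (row i B) ph *: p.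
have qB i : (q i <= B)%MS by rewrite /q addmx_sub ?row_sub // eqmx_opp scalemx_sub.
have q0 i : dot (q i) ph = 0 by rewrite /q -scaleNr dotD dotZ pp mulr1 subrr.
have [z0|nz] := eqVneq (q 0) 0; last by exists (q 0).
have [z1|nz] := eqVneq (q 1) 0; last by exists (q 1).
have le : (B <= p)%MS.
  apply/row_subP => i; have -> : row i B = dot (row i B) ph *: p; last exact: scalemx_sub (submx_refl p).
  apply/eqP; rewrite -subr_eq0 -/(q i); apply/eqP.
  case: i => [[|[|//]] lti]; [rewrite -[RHS]z0 | rewrite -[RHS]z1]; congr (q _); exact: val_inj.
have := mxrankS le; rewrite (eqP freeB) rank_rV; by case: (_ != 0).
Qed.

(** The only fixed points of a homology are its centre and the points of its
    axis. *)
Lemma eigen_hom p ph z t c : p != 0 -> z != 1 -> t *m hom p ph z = c *: t ->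
  dot t ph = 0 \/ exists k, t = k *: p.
Proof.
move=> nzp nz1; rewrite homE => e.
have e' : (c - 1) *: t = ((z - 1) * dot t ph) *: p by rewrite scalerBl scale1r -e addrAC subrr add0r.
have [c1|nc] := eqVneq (c - 1) 0; last first.
  by right; exists ((c - 1)^-1 * ((z - 1) * dot t ph)); rewrite -scalerA -e' scalerA mulVf // scale1r.
have [d0|nd] := eqVneq (dot t ph) 0; first by left.
move/eqP: e'; rewrite c1 scale0r eq_sym scaler_eq0 mulf_eq0 subr_eq0.
by rewrite (negPf nz1) (negPf nd) (negPf nzp).
Qed.

Section Group.
Variable H : 'M[K]_3 -> Prop.
Hypotheses (H1 : H 1%:M) (HM : forall M N, H M -> H N -> H (M *m N))
  (HV : forall M, H M -> H (invmx M)) (HA : forall M, H M -> autC F M)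
  (HS : forall M, H M -> stab M).

Let G (M' : 'M[K]_2) := exists M, H M /\ M' = res M.
Let G1 : G 1%:M. Proof. by exists 1%:M; rewrite res1. Qed.
Let GM (M' N' : 'M[K]_2) : G M' -> G N' -> G (M' *m N').
Proof.
by move=> [M [hM ->]] [N [hN ->]]; exists (M *m N); rewrite resM //; [split=> //; apply: HM | apply: HS | apply: HS].
Qed.
Let resV M : H M -> res M *m res (invmx M) = 1%:M.
Proof.
move=> hM; have [uM _] := HA hM.
by rewrite -resM ?mulmxV ?res1 //; apply: HS => //; apply: HV.
Qed.
Lemma res_unit M : H M -> res M \in unitmx.
Proof. by move=> hM; case: (mulmx1_unit (resV hM)). Qed.
Let GU (M' : 'M[K]_2) : G M' -> M' \in unitmx.
Proof. by case=> M [hM ->]; apply: res_unit. Qed.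
Let GV (M' : 'M[K]_2) : G M' -> G (invmx M').
Proof.
case=> M [hM ->]; exists (invmx M); split; first exact: HV.
by rewrite -[LHS]mulmx1 -(resV hM) mulmxA mulVmx ?mul1mx // res_unit.
Qed.

Variables (p1 : 'rV[K]_3) (ph1 : 'cV[K]_3) (n : nat).
Hypotheses (q1 : qg F p1 ph1 n) (p1B : (p1 <= B)%MS) (n4 : (3 < n)%N)
  (H1h : forall z, z ^+ n = 1 -> H (hom p1 ph1 z)).
Hypothesis off_axis : exists v, [/\ (v <= B)%MS, F.@[v 0] = 0 & dot v ph1 != 0].

Lemma line_points : exists X : seq (option K), uniq X /\ forall o, (o \in X) = (F.@[(pe o) 0] == 0).
Proof.
have [_ Fp1 _ _] := q1.
pose b0 := row 0 B; pose b1 := row 1 B.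
have peS a : pe (Some a) = b0 + a *: b1.
  have -> : pe (Some a) = (delta_mx 0 0 + a *: delta_mx 0 1) *m B.
    by congr (_ *m B); apply: row2P; rewrite ?vec2E0 ?vec2E1 !mxE /= ?mulr0 ?mulr1 ?addr0 ?add0r.
  by rewrite mulmxDl -scalemxAl -!rowE.
have peN : pe None = b1.
  have -> : pe None = delta_mx 0 1 *m B.
    by congr (_ *m B); apply: row2P; rewrite ?vec2E0 ?vec2E1 !mxE.
  by rewrite -rowE.
have nzh : online F b0 b1 != 0.
  apply: contraNneq Fp1 => h0.
  have [o [k [nzk ->]]] := in_line p1B (qg_nz d_gt1 smoothC q1).
  rewrite (F_scale smoothC); apply/eqP; rewrite (_ : F.@[(pe o) 0] = 0) ?mulr0 //.
  case: o => [a|]; first by rewrite peS -online_eval h0 horner0.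
  rewrite peN -(coef_online charK0 b0 b1 (_ : F \is d.-homog)) ?h0 ?coef0 //.
  by case: smoothC.
have [r rE] := closed_field_poly_normal (online F b0 b1).
exists ((if F.@[b1 0] == 0 then [:: None] else [::]) ++ map Some (undup r)).
have iS a : (Some a \in map Some (undup r)) = (F.@[(pe (Some a)) 0] == 0).
  rewrite mem_map ?mem_undup; last by move=> ? ? [].
  rewrite peS -online_eval -[_ == 0]/(root _ a) rE rootZ ?lead_coef_eq0 //.
  by rewrite root_prod_XsubC.
have nN : None \notin map Some (undup r) by apply/mapP => -[].
split.
  case: ifP => _; rewrite /= ?nN /= map_inj_uniq ?undup_uniq // => ? ? [] //.
case=> [a|]; rewrite mem_cat; first by rewrite iS; case: ifP.
by rewrite (negPf nN) orbF peN; case: ifP.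
Qed.

Let o1_ex : exists o1 k1, k1 != 0 /\ p1 = k1 *: pe o1.
Proof. exact: in_line p1B (qg_nz d_gt1 smoothC q1). Qed.

Lemma scalar_hom p ph z m : qg F p ph m -> (p <= B)%MS -> z ^+ m = 1 -> H (hom p ph z) ->
  scalar (res (hom p ph z)) -> z = 1.
Proof.
move=> q pB zm hz; have [pp _ _ _] := q; have [w [wB nzw w0]] := axis_point pB pp.
move/(scalar_res (HS hz)) => [c cE].
have := cE w wB; rewrite hom_fix // -{1}[w]scale1r => /eqP.
rewrite -subr_eq0 -scalerBl scaler_eq0 (negPf nzw) orbF subr_eq0 => /eqP c1.
have := cE p pB; rewrite hom_center // -c1 => /eqP.
by rewrite -subr_eq0 -scalerBl scaler_eq0 (negPf (qg_nz d_gt1 smoothC q)) orbF subr_eq0 => /eqP.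
Qed.

Let homX p ph z (k : nat) : dot p ph = 1 -> (hom p ph z) ^+ k = hom p ph (z ^+ k).
Proof.
by move=> pp; elim: k => [|k IH]; rewrite ?expr0 ?hom1 // !exprS IH -mulmxE hom_mul.
Qed.

Let resX M (k : nat) : H M -> res M ^+ k = res (M ^+ k) /\ H (M ^+ k).
Proof.
move=> hM; elim: k => [|k [IH hk]]; first by rewrite !expr0; split=> //; rewrite res1.
by rewrite !exprS IH -mulmxE -resM; [split=> //; apply: HM | apply: HS | apply: HS].
Qed.

(** The images of a point of the curve off the axis under the homologies of
    multiplier 1, z, z ^ 2. *)
Lemma points_ge3 X : (forall o, (o \in X) = (F.@[(pe o) 0] == 0)) -> (3 <= size X)%N.
Proof.
move=> XE; have [v [vB Fv nzv]] := off_axis.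
have [d11 F1 n_gt1 _] := q1; have [z pz] := qg_prim charK0 q1; have zn := prim_expr_order pz.
have pt_of (k : nat) : exists o c, c != 0 /\ v *m hom p1 ph1 (z ^+ k) = c *: pe o.
  have zkn : (z ^+ k) ^+ n = 1 by rewrite exprAC zn expr1n.
  apply: in_line; last by apply: (contra_neq _ (_ : v != 0)) => [e|]; [case: (qg_aut q1 zkn) => u _; rewrite -[v](mulmxK u) e mul0mx | apply: contraNneq nzv => ->; rewrite dot0].
  have := HS (H1h zkn); move: vB => /submxP [u ->]; rewrite -mulmxA => s.
  exact: submx_trans (submxMl _ _) s.
have [o0 [c0 [nc0 e0]]] := pt_of 0%N; have [o1 [c1 [nc1 e1]]] := pt_of 1%N; have [o2 [c2 [nc2 e2]]] := pt_of 2%N.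
have inX o c (k : nat) : v *m hom p1 ph1 (z ^+ k) = c *: pe o -> c != 0 -> o \in X.
  move=> e nc; rewrite XE; have zkn : (z ^+ k) ^+ n = 1 by rewrite exprAC zn expr1n.
  have : F.@[(v *m hom p1 ph1 (z ^+ k)) 0] == 0 by rewrite (autC_zero _ (qg_aut q1 zkn)) Fv.
  by rewrite e (F_scale smoothC) mulf_eq0 expf_eq0 (negPf nc) andbF.
have [w wE] : exists w, w = v - dot v ph1 *: p1 by eexists.
have nzw : w != 0.
  apply: contra_eq_neq Fv => w0; have -> : v = dot v ph1 *: p1 by apply/eqP; rewrite -subr_eq0 -wE w0.
  by rewrite (F_scale smoothC) mulf_neq0 // expf_neq0.
have neq i j oi oj ci cj : (i < j < 3)%N -> v *m hom p1 ph1 (z ^+ i) = ci *: pe oi ->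
    v *m hom p1 ph1 (z ^+ j) = cj *: pe oj -> ci != 0 -> cj != 0 -> oi != oj.
  move=> /andP [ij j3] ei ej nci ncj; apply/eqP => oij.
  have e : v *m hom p1 ph1 (z ^+ i) = (ci / cj) *: (v *m hom p1 ph1 (z ^+ j)).
    by rewrite ej scalerA divfK // ei oij.
  have vE (k : nat) : v *m hom p1 ph1 (z ^+ k) = w + (z ^+ k * dot v ph1) *: p1.
    by rewrite homE wE; apply/rowP => l; rewrite !mxE; ring.
  have wph : dot w ph1 = 0 by rewrite wE -scaleNr dotD dotZ d11 mulr1 subrr.
  have := congr1 (fun u => dot u ph1) e; rewrite !vE dotZ !dotD !dotZ wph d11 !add0r !mulr1 => ed.
  have rw : w = (ci / cj) *: w.
    apply: (addIr ((z ^+ i * dot v ph1) *: p1)); rewrite -vE e vE scalerDr; congr (_ + _).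
    by rewrite scalerA ed.
  have r1 : ci / cj = 1.
    move/eqP: rw; rewrite -{1}[w]scale1r -subr_eq0 -scalerBl scaler_eq0 (negPf nzw) orbF subr_eq0 eq_sym.
    by move/eqP.
  move: ed; rewrite r1 mul1r => /(mulIf nzv)/eqP; rewrite (eq_prim_root_expr pz) => /eqP.
  have jn : (j < n)%N := ltn_trans j3 n4.
  by rewrite !modn_small ?(ltn_trans ij jn) // => ije; rewrite ije ltnn in ij.
have u3 : uniq [:: o0; o1; o2].
  rewrite /= !inE negb_or (neq 0 1 _ _ _ _ _ e0 e1) ?(neq 0 2 _ _ _ _ _ e0 e2) ?(neq 1 2 _ _ _ _ _ e1 e2) //.
apply: (uniq_leq_size u3) => o; rewrite !inE => /or3P [] /eqP ->.
- exact: inX e0 nc0.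
- exact: inX e1 nc1.
- exact: inX e2 nc2.
Qed.

(** [pgl2_trichotomy] for the group H acting on the line. The group is left
    abstract because it is applied twice: to all automorphisms preserving the
    line, and to those that moreover fix a point off the line. *)
Lemma line_trichotomy :
  (forall t ph m, (t <= B)%MS -> qg F t ph m -> (2 < m)%N -> (forall z, z ^+ m = 1 -> H (hom t ph z)) ->
      dot t ph1 = 0 \/ exists k, t = k *: p1) \/
  exists s : seq (option K), [/\ uniq s,
    (size s = 6%N /\ n = 4%N) \/ [/\ size s = 12%N, n = 5%N &
        exists M, [/\ H M, ~ scalar (res M) & scalar (res M *m res M)]],
    forall o, o \in s -> exists M k, [/\ H M, k != 0 & pe o = k *: (p1 *m M)],
    forall t ph m, (t <= B)%MS -> qg F t ph m -> (3 < m)%N -> (forall z, z ^+ m = 1 -> H (hom t ph z)) ->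
      exists o k, [/\ o \in s, k != 0 & t = k *: pe o] &
    forall t, (t <= B)%MS -> t != 0 -> dot t ph1 = 0 -> exists o k, [/\ o \in s, k != 0 & t = k *: pe o]].
Proof.
have [X [uX XE]] := line_points; have X3 := points_ge3 XE.
have [d11 F1 n_gt1 _] := q1; have [z pz] := qg_prim charK0 q1; have zn := prim_expr_order pz.
have nz1 := prim_neq1 pz n_gt1; have nzp1 := qg_nz d_gt1 smoothC q1.
have GX (M' : 'M[K]_2) o : G M' -> o \in X -> act M' o \in X.
  case=> M [hM ->]; rewrite !XE => /eqP Fo.
  have [k nzk e] := act_res o (HS hM) (res_unit hM).
  have : F.@[(pe o *m M) 0] == 0 by rewrite (autC_zero _ (HA hM)) Fo.
  by rewrite e (F_scale smoothC) mulf_eq0 expf_eq0 (negPf nzk) andbF.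
have [o1 [k1 [nzk1 p1E]]] := o1_ex.
have hz := H1h zn; pose M1 := res (hom p1 ph1 z).
have gM1 : G M1 by exists (hom p1 ph1 z).
have fixo t ph y o k : dot t ph = 1 -> t = k *: pe o -> k != 0 -> H (hom t ph y) -> act (res (hom t ph y)) o = o.
  move=> tt tE nzk hy; apply: (act_res_eq (k := y) (HS hy) (res_unit hy)).
  apply: (scalerI nzk); rewrite scalemxAl -tE hom_center // tE !scalerA.
  by rewrite mulrC.
have M1y : act M1 o1 = o1 by apply: fixo p1E nzk1 hz.
have M1n (k : nat) : scalar (M1 ^+ k) <-> (n %| k)%N.
  have zkn : (z ^+ k) ^+ n = 1 by rewrite exprAC zn expr1n.
  rewrite (resX k hz).1 homX // (prim_order_dvd pz); split=> [|/eqP ->].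
    by move/(scalar_hom q1 p1B zkn (H1h zkn)) => ->.
  by rewrite hom1 res1; exists 1.
have ns t ph m (q : qg F t ph m) (tB : (t <= B)%MS) (hH : forall z, z ^+ m = 1 -> H (hom t ph z)) y j :
    m.-primitive_root y -> (0 < j < m)%N -> ~ scalar (res (hom t ph y) ^+ j).
  move=> py /andP [j0 jm]; have ym := prim_expr_order py; have [tt _ _ _] := q.
  have yjm : (y ^+ j) ^+ m = 1 by rewrite exprAC ym expr1n.
  rewrite (resX j (hH _ ym)).1 homX // => /(scalar_hom q tB yjm (hH _ yjm))/eqP.
  by rewrite -(prim_order_dvd py) gtnNdvd.
have fix_cases t o k : t = k *: pe o -> k != 0 -> act M1 o = o -> dot t ph1 = 0 \/ exists k', t = k' *: p1.
  move=> tE nzk fo; have [c nzc e] := act_res o (HS hz) (res_unit hz).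
  apply: (eigen_hom nzp1 nz1 (c := c)); by rewrite tE -scalemxAl e -/M1 fo !scalerA mulrC.
case: (pgl2_trichotomy charK0 G1 GM GV GU uX X3 GX n4 gM1 M1y M1n) => [I|[s [us y1s szs cov cls]]].
  left=> t ph m tB q m_gt2 hH; have [tt _ _ _] := q.
  have [o [k [nzk tE]]] := in_line tB (qg_nz d_gt1 smoothC q).
  have [y py] := qg_prim charK0 q; have ym := prim_expr_order py; have hy := hH _ ym.
  apply: (fix_cases t o k tE nzk); apply: (I o (res (hom t ph y))).
  - by exists (hom t ph y).
  - exact: fixo tt tE nzk hy.
  - by have := ns t ph m q tB hH y 1%N py; rewrite expr1; apply; rewrite (ltnW m_gt2).
  - by have := ns t ph m q tB hH y 2%N py; rewrite expr2; apply.
right; exists s; split=> //.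
- case: szs => [e6|[szs n5 [M' [[M [hM ->]] nsM sM]]]]; first by left.
  by right; split=> //; exists M.
- move=> o /cov [M' [M [hM ->]] e].
  have [k nzk eo] := act_res o1 (HS hM) (res_unit hM); rewrite e in eo.
  exists M, (k^-1 / k1); split=> //; first by rewrite mulf_neq0 ?invr_eq0.
  by rewrite p1E -scalemxAl eo !scalerA; rewrite (_ : _ * _ = 1) ?scale1r //; field; rewrite nzk nzk1.
- move=> t ph m tB q m_gt3 hH; have [tt _ _ _] := q.
  have [o [k [nzk tE]]] := in_line tB (qg_nz d_gt1 smoothC q).
  have [y py] := qg_prim charK0 q; have ym := prim_expr_order py; have hy := hH _ ym.
  exists o, k; split=> //; apply: (cls o (res (hom t ph y))).
  - by exists (hom t ph y).
  - exact: fixo tt tE nzk hy.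
  - by have := ns t ph m q tB hH y 1%N py; rewrite expr1; apply; rewrite (ltnW (ltnW m_gt3)).
  - by have := ns t ph m q tB hH y 2%N py; rewrite expr2; apply; rewrite (ltnW m_gt3).
  - by have := ns t ph m q tB hH y 3%N py; rewrite !exprS expr0 mulr1 -!mulmxE mulmxA; apply.
move=> t tB nzt t0; have [o [k [nzk tE]]] := in_line tB nzt.
exists o, k; split=> //; apply: (cls o M1) => //.
- apply: (act_res_eq (k := 1) (HS hz) (res_unit hz)); rewrite scale1r hom_fix //.
  by move/eqP: t0; rewrite tE dotZ mulf_eq0 (negPf nzk) => /eqP.
- by have := ns _ _ _ q1 p1B H1h z 1%N pz; rewrite expr1; apply; rewrite n_gt1.
- by have := ns _ _ _ q1 p1B H1h z 2%N pz; rewrite expr2; apply; rewrite (ltnW n4).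
- by have := ns _ _ _ q1 p1B H1h z 3%N pz; rewrite !exprS expr0 mulr1 -!mulmxE mulmxA; apply.
Qed.

Section TwoCentres.
Variables (p2 : 'rV[K]_3) (ph2 : 'cV[K]_3) (m : nat).
Hypotheses (q2 : qg F p2 ph2 m) (p2B : (p2 <= B)%MS) (hH : forall z, z ^+ m = 1 -> H (hom p2 ph2 z)).

Let fixo t c o k M : t = k *: pe o -> k != 0 -> H M -> t *m M = c *: t -> act (res M) o = o.
Proof.
move=> tE nzk hM e; apply: (act_res_eq (k := c) (HS hM) (res_unit hM)).
by apply: (scalerI nzk); rewrite scalemxAl -tE e tE !scalerA mulrC.
Qed.

(** By [common_fixed_point] homologies sharing one fixed point q on the line share
    both, so p1 is the centre or on the axis of the second one. *)
Lemma shared_fixed q : (q <= B)%MS -> q != 0 -> dot q ph1 = 0 ->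
  (dot q ph2 = 0 \/ q = p2) -> dot p1 ph2 = 0 \/ exists k, p1 = k *: p2.
Proof.
move=> qB nzq q_1 q_2.
have [X [uX XE]] := line_points; have X3 := points_ge3 XE.
have [d11 F1 n_gt1 _] := q1; have [z pz] := qg_prim charK0 q1; have zn := prim_expr_order pz.
have [d22 F2 m_gt1 _] := q2; have [y py] := qg_prim charK0 q2; have ym := prim_expr_order py.
have nz1 := prim_neq1 pz n_gt1; have ny1 := prim_neq1 py m_gt1.
have nzp1 := qg_nz d_gt1 smoothC q1; have nzp2 := qg_nz d_gt1 smoothC q2.
have GX (M' : 'M[K]_2) o : G M' -> o \in X -> act M' o \in X.
  case=> M [hM ->]; rewrite !XE => /eqP Fo.
  have [k nzk e] := act_res o (HS hM) (res_unit hM).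
  have : F.@[(pe o *m M) 0] == 0 by rewrite (autC_zero _ (HA hM)) Fo.
  by rewrite e (F_scale smoothC) mulf_eq0 expf_eq0 (negPf nzk) andbF.
have hz := H1h zn; have hy := hH ym.
have [o1 [k1 [nzk1 p1E]]] := o1_ex.
have [oq [kq [nzkq qE]]] := in_line qB nzq.
have nsz : ~ scalar (res (hom p1 ph1 z)) by move/(scalar_hom q1 p1B zn hz)/eqP; apply/negP.
have fixq1 : act (res (hom p1 ph1 z)) oq = oq.
  by apply: (fixo qE nzkq hz (c := 1)); rewrite hom_fix // scale1r.
have fixq2 : act (res (hom p2 ph2 y)) oq = oq.
  case: q_2 => [q_2|qp]; first by apply: (fixo qE nzkq hy (c := 1)); rewrite hom_fix // scale1r.
  by apply: (fixo qE nzkq hy (c := y)); rewrite qp hom_center.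
have fixp1 : act (res (hom p1 ph1 z)) o1 = o1.
  by apply: (fixo p1E nzk1 hz (c := z)); rewrite hom_center.
have fix12 : act (res (hom p2 ph2 y)) o1 = o1.
  apply: (common_fixed_point charK0 G1 GM GV GU uX X3 GX _ _ nsz fixq1 fixq2 fixp1).
    by exists (hom p1 ph1 z).
  by exists (hom p2 ph2 y).
have [c nzc e] := act_res o1 (HS hy) (res_unit hy); rewrite fix12 in e.
by apply: (eigen_hom nzp2 ny1 (c := c)); rewrite p1E -scalemxAl e !scalerA mulrC.
Qed.

Lemma axis_symmetric : dot p2 ph1 = 0 -> dot p1 ph2 = 0.
Proof.
move=> p21; have [d11 _ _ _] := q1; have nzp2 := qg_nz d_gt1 smoothC q2.
have [//|[k p1k]] := shared_fixed p2B nzp2 p21 (or_intror erefl).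
by move/eqP: d11; rewrite p1k dotZ p21 mulr0 eq_sym oner_eq0.
Qed.

(** If the axes met on the line at q, the homology with centre p2 would fix three
    points of the line, p1, q and p2. *)
Lemma line_common_axis q : (q <= B)%MS -> q != 0 -> dot q ph1 = 0 -> dot q ph2 = 0 ->
  exists k, p1 = k *: p2.
Proof.
move=> qB nzq q_1 q_2; have [p1ph2|//] := shared_fixed qB nzq q_1 (or_introl q_2).
have [d11 F1 n_gt1 _] := q1.
have [d22 F2 m_gt1 _] := q2; have [y py] := qg_prim charK0 q2; have ym := prim_expr_order py.
have ny1 := prim_neq1 py m_gt1; have hy := hH ym.
have nzp2 := qg_nz d_gt1 smoothC q2.
have [o1 [k1 [nzk1 p1E]]] := o1_ex.
have [oq [kq [nzkq qE]]] := in_line qB nzq.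
have [o2 [k2 [nzk2 p2E]]] := in_line p2B nzp2.
have nsy : ~ scalar (res (hom p2 ph2 y)) by move/(scalar_hom q2 p2B ym hy)/eqP; apply/negP.
case: nsy; apply: (@three_fixed _ _ [:: o1; oq; o2]); first exact: res_unit.
- have dne o o' k k' ph : dot (k *: pe o) ph = 0 -> k != 0 -> dot (k' *: pe o') ph = 1 -> o != o'.
    move=> d0 nzk dd1; apply/eqP => oo; move: dd1 d0; rewrite oo !dotZ => dd1 /eqP.
    rewrite mulf_eq0 (negPf nzk) => /eqP d0; move/eqP: dd1.
    by rewrite d0 mulr0 eq_sym oner_eq0.
  rewrite /= !inE negb_or (eq_sym o1) (dne oq o1 kq k1 ph1) -?qE -?p1E //.
  by rewrite (dne o1 o2 k1 k2 ph2) -?p1E -?p2E // (dne oq o2 kq k2 ph2) -?qE -?p2E.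
- by [].
move=> o; rewrite !inE => /or3P [] /eqP ->.
- by apply: (fixo p1E nzk1 hy (c := 1)); rewrite hom_fix // scale1r.
- by apply: (fixo qE nzkq hy (c := 1)); rewrite hom_fix // scale1r.
- by apply: (fixo p2E nzk2 hy (c := y)); rewrite hom_center.
Qed.

End TwoCentres.
End Group.
End Line.

(** * Octahedral and icosahedral lines *)

Section Eigenframe.
Variable K : fieldType.
Implicit Types (u v w p : 'rV[K]_3) (x y z : K) (M : 'M[K]_3) (ph : 'cV[K]_3).

Lemma det_eigenframe u v w M x y z : frame u v w \in unitmx ->
  u *m M = x *: u -> v *m M = y *: v -> w *m M = z *: w -> \det M = x * y * z.
Proof.
move=> uP uM vM wM; pose P := frame u v w.
have PM : P *m M = diag_mx (row3 x y z) *m P.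
  apply/row_matrixP => i; rewrite !row_mul rowK row_diag_mx mxE -scalemxAl -rowE rowK.
  by case: i => [[|[|[|//]]] lti].
have nzP : \det P != 0 by rewrite -unitfE -unitmxE.
have := congr1 determinant PM; rewrite !det_mulmx [RHS]mulrC => /(mulfI nzP) ->.
by rewrite det_diag !big_ord_recl big_ord0 !mxE /= mulr1 mulrA.
Qed.

Lemma det_hom p ph z : dot p ph = 1 -> \det (hom p ph z) = z.
Proof.
move=> pp; have nzp : p != 0 by apply: contra_eq_neq pp => ->; rewrite dot0 eq_sym oner_neq0.
have [a [b ua]] := frame_exists nzp.
pose a' := a - dot a ph *: p; pose b' := b - dot b ph *: p.
have a0 : dot a' ph = 0 by rewrite /a' -scaleNr dotD dotZ pp mulr1 subrr.
have b0 : dot b' ph = 0 by rewrite /b' -scaleNr dotD dotZ pp mulr1 subrr.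
have ua' : frame p a' b' \in unitmx.
  apply: frameP => x y w e.
  have [|ex y0 w0] := @frame_free _ p a b (x - y * dot a ph - w * dot b ph) y w ua.
    by rewrite -e /a' /b'; apply/rowP => i; rewrite !mxE; ring.
  by move: ex; rewrite y0 w0 !mul0r !subr0 => ->.
rewrite (@det_eigenframe _ _ _ _ z 1 1 ua') ?mulr1 //; rewrite ?scale1r ?hom_center ?hom_fix //.
Qed.

Lemma common_zero (f g : 'cV[K]_3) : exists r : 'rV[K]_3, [/\ r != 0, dot r f = 0 & dot r g = 0].
Proof.
have : kermx (row_mx f g) != 0.
  rewrite -mxrank_eq0 mxrank_ker -lt0n subn_gt0.
  by apply: leq_ltn_trans (rank_leq_col _) _.
move=> /rowV0Pn [r /sub_kermxP]; rewrite mul_mx_row => e nz; exists r; split=> //.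
  by have /(congr1 lsubmx) := e; rewrite row_mxKl linear0 /dot => ->; rewrite mxE.
by have /(congr1 rsubmx) := e; rewrite row_mxKr linear0 /dot => ->; rewrite mxE.
Qed.
End Eigenframe.

Section Geometry.
Variables (K : closedFieldType).
Hypothesis charK0 : [pchar K] =i pred0.
Variables (d : nat) (F : {mpoly K[3]}).
Hypothesis d_gt1 : (1 < d)%N.
Hypothesis smoothC : smooth_plane_curve F d.
Implicit Types (u v w p q r t : 'rV[K]_3) (x y z k : K) (M N : 'M[K]_3) (ph ps : 'cV[K]_3) (o : option K).

Section OnLine.
Variable B : 'M[K]_(2, 3).
Hypothesis freeB : row_free B.

Definition line_aut M := autC F M /\ stab B M.

Lemma stabM M N : stab B M -> stab B N -> stab B (M *m N).
Proof. by move=> sM sN; rewrite /stab mulmxA (submx_trans (submxMr _ sM)). Qed.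

Lemma stabV M : M \in unitmx -> stab B M -> stab B (invmx M).
Proof.
move=> uM sM; have rk : \rank (B *m M) = \rank B by rewrite mxrankMfree // row_free_unit.
have le : (B <= B *m M)%MS by rewrite -(mxrank_leqif_sup sM) rk.
by rewrite /stab; have := submxMr (invmx M) le; rewrite mulmxK.
Qed.

Lemma line_aut_1 : line_aut 1%:M. Proof. by split; [apply: autC1 | rewrite /stab mulmx1]. Qed.
Lemma line_aut_M M N : line_aut M -> line_aut N -> line_aut (M *m N).
Proof. by case=> aM sM [aN sN]; split; [apply: autCM | apply: stabM]. Qed.
Lemma line_aut_V M : line_aut M -> line_aut (invmx M).
Proof. by case=> aM sM; split; [apply: autCV | apply: stabV => //; case: aM]. Qed.
Lemma line_aut_A M : line_aut M -> autC F M. Proof. by case. Qed.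
Lemma line_aut_S M : line_aut M -> stab B M. Proof. by case. Qed.

Lemma line_aut_hom p ph n : qg F p ph n -> (p <= B)%MS -> forall z, z ^+ n = 1 -> line_aut (hom p ph z).
Proof.
by move=> q pB z zn; split; [apply: qg_aut zn | apply: along_stab pB (along_hom _ _ _)].
Qed.

(** The determinant condition is satisfied by the homologies of order n with centre
    on the line and axis through r; it pins down the scalar in lifts of
    projectivities of the line. *)
Definition pole_aut r n M := [/\ autC F M, stab B M, r *m M = r & \det M ^+ n = 1].

Lemma pole_aut_1 r n : pole_aut r n 1%:M.
Proof. by split; rewrite /stab ?mulmx1 ?det1 ?expr1n //; apply: autC1. Qed.
Lemma pole_aut_M r n M N : pole_aut r n M -> pole_aut r n N -> pole_aut r n (M *m N).
Proof.
case=> aM sM rM dM [aN sN rN dN]; split; [exact: autCM | exact: stabM | by rewrite mulmxA rM |].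
by rewrite det_mulmx exprMn dM dN mulr1.
Qed.
Lemma pole_aut_V r n M : pole_aut r n M -> pole_aut r n (invmx M).
Proof.
case=> aM sM rM dM; have [uM _] := aM; split; [exact: autCV | exact: stabV | |].
  by rewrite -{1}rM mulmxK.
by rewrite det_inv exprVn dM invr1.
Qed.
Lemma pole_aut_A r n M : pole_aut r n M -> autC F M. Proof. by case. Qed.
Lemma pole_aut_S r n M : pole_aut r n M -> stab B M. Proof. by case. Qed.
Lemma pole_aut_hom r p ph n : qg F p ph n -> (p <= B)%MS -> dot r ph = 0 ->
  forall z, z ^+ n = 1 -> pole_aut r n (hom p ph z).
Proof.
move=> q pB r0 z zn; have [pp _ _ _] := q; split.
- exact: qg_aut zn.
- exact: along_stab pB (along_hom _ _ _).
- exact: hom_fix.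
- by rewrite det_hom.
Qed.

Lemma line_off_axis p1 ph1 n1 p2 ph2 n2 : qg F p1 ph1 n1 -> qg F p2 ph2 n2 -> (2 < n1)%N ->
  (p1 <= B)%MS -> (p2 <= B)%MS -> ~ (exists k, p2 = k *: p1) ->
  exists v, [/\ (v <= B)%MS, F.@[v 0] = 0 & dot v ph1 != 0].
Proof.
move=> q1 q2 n1_gt2 p1B p2B np.
have [|x [y [Fv nv]]] := line_curve_point charK0 d_gt1 smoothC q1 n1_gt2 q2.
  by apply/eqP => e; apply: np; exists (dot p2 ph1); apply/eqP; rewrite -subr_eq0 e.
by exists (x *: p1 + y *: p2); split=> //; rewrite addmx_sub ?scalemx_sub.
Qed.

(** An octahedral or icosahedral line. The vertices s are the centres of order at
    least four on the line B; their axes pass through r, which is itself a centre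
    with axis B. Antipodes of vertices, the traces of their axes, are vertices. *)
Record rich (n : nat) (r : 'rV[K]_3) (ps : 'cV[K]_3) (m : nat) (s : seq (option K)) : Prop := Rich {
  rich_uniq : uniq s;
  rich_size : (size s = 6%N /\ n = 4%N) \/ (size s = 12%N /\ n = 5%N);
  rich_qg : qg F r ps m;
  rich_dvd : (n %| m)%N;
  rich_even : n = 5%N -> (10 %| m)%N;
  rich_axis : forall v, (dot v ps = 0) <-> (v <= B)%MS;
  rich_centre : forall o, o \in s -> exists ph, qg F (pe B o) ph n /\ dot r ph = 0;
  rich_all : forall t ph (k : nat), (t <= B)%MS -> qg F t ph k -> (3 < k)%N ->
    exists o c, [/\ o \in s, c != 0 & t = c *: pe B o];
  rich_anti : forall c ph t, (c <= B)%MS -> qg F c ph n -> (t <= B)%MS -> t != 0 -> dot t ph = 0 ->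
    exists o k, [/\ o \in s, k != 0 & t = k *: pe B o] }.

Lemma neg_one_even (c : K) m j : (c ^+ 5 = -1) -> c ^+ m = 1 -> m = (5 * j)%N -> (10 %| m)%N.
Proof.
move=> c5 cm mE; have oj : ~~ odd j.
  apply/negP => oj; move: cm; rewrite mE exprM c5 -signr_odd oj expr1 => /eqP.
  rewrite -subr_eq0 -opprD oppr_eq0 -[1 + 1]/(2%:R); have/pcharf0P -> := charK0.
  by [].
by rewrite mE; rewrite -[10%N]/(5 * 2)%N dvdn_pmul2l // dvdn2.
Qed.

(** An involution of the line has eigenvalues a and -a there and fixes r, so its
    square is up to a scalar a homology with centre r, and its determinant is
    -a ^ 2. The determinant condition gives (a ^ 2) ^ 5 = -1, so the multiplier
    a ^ -2 has even order. *)
Lemma involution_even r ps m M : qg F r ps m -> (5 %| m)%N ->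
  (forall v, (dot v ps = 0) <-> (v <= B)%MS) ->
  pole_aut r 5 M -> ~ scalar (res B M) -> scalar (res B M *m res B M) -> (10 %| m)%N.
Proof.
move=> q dv axis hM ns sc2; have [aM sM rM dM] := hM.
have [rr Fr _ _] := q; have nzr := qg_nz d_gt1 smoothC q.
have uM := res_unit freeB (@pole_aut_V r 5) (@pole_aut_A r 5) (@pole_aut_S r 5) hM.
have [|o1 [o2 [n12 f1 f2]]] := @two_fixed _ charK0 (res B M) 2 uM ns isT.
  by rewrite expr2 -mulmxE.
have [a nza e1] := act_res o1 sM uM; have [b nzb e2] := act_res o2 sM uM.
rewrite f1 in e1; rewrite f2 in e2.
set u1 := pe B o1 in e1; set u2 := pe B o2 in e2.
have u1s : dot u1 ps = 0 by apply/axis; apply: pe_in.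
have u2s : dot u2 ps = 0 by apply/axis; apply: pe_in.
have nz1 : u1 != 0 by apply: pe_nz.
have n21 : ~~ (u2 <= u1)%MS.
  by apply/negP => /sub_rVP [k /(pe_inj freeB) e]; rewrite e eqxx in n12.
have fr : frame u1 u2 r \in unitmx.
  apply: frameP => x y z e.
  have z0 : z = 0.
    by have := congr1 (fun v => dot v ps) e; rewrite !dotD !dotZ u1s u2s rr dot0 !mulr0 !add0r mulr1.
  have y0 : y = 0.
    apply/eqP; apply/negPn/negP => nzy; move/negP: n21; apply; apply/sub_rVP.
    exists (- (x / y)); apply: (scalerI nzy); rewrite scalerA mulrN mulrC divfK // scaleNr.
    by apply/eqP; rewrite -addr_eq0 addrC -e z0 scale0r addr0.
  move/eqP: e; rewrite y0 z0 !scale0r !addr0 scaler_eq0 (negPf nz1) orbF => /eqP ->.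
  by [].
have decomp v : (v <= B)%MS -> exists x y, v = x *: u1 + y *: u2.
  move=> /axis v0; have [x [y [z vE]]] := frame_span v fr.
  have z0 : z = 0 by move: v0; rewrite vE !dotD !dotZ u1s u2s rr !mulr0 !add0r mulr1.
  by exists x, y; rewrite vE z0 scale0r addr0.
have nab : a != b.
  apply/eqP => ab; apply: ns; apply/(scalar_res freeB sM); exists a => v /decomp [x [y ->]].
  by rewrite mulmxDl -!scalemxAl e1 e2 -ab scalerDr !scalerA !(mulrC a).
have sq : a ^+ 2 = b ^+ 2.
  have : scalar (res B (M *m M)) by rewrite resM.
  move/(scalar_res freeB (stabM sM sM)) => [c cE].
  have ev u x : u *m M = x *: u -> u != 0 -> (u <= B)%MS -> x ^+ 2 = c.
    move=> uE nzu uB; have := cE u uB; rewrite mulmxA uE -scalemxAl uE scalerA => /eqP.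
    by rewrite -subr_eq0 -scalerBl scaler_eq0 (negPf nzu) orbF subr_eq0 => /eqP.
  by rewrite (ev u1 a) ?(ev u2 b) //; apply: pe_in || apply: pe_nz.
have bE : b = - a.
  move/eqP: sq; rewrite -subr_eq0 subr_sqr mulf_eq0 subr_eq0 (negPf nab) /= addrC addr_eq0.
  by move/eqP.
have detM : \det M = - a ^+ 2.
  rewrite (det_eigenframe fr e1 e2 (_ : r *m M = 1 *: r)) ?scale1r // bE; ring.
have c5 : (a ^+ 2) ^+ 5 = -1.
  by move: dM; rewrite detM exprNn -signr_odd /= expr1 mulN1r => e; rewrite -[LHS]opprK e.
have MM : M *m M = a ^+ 2 *: hom r ps (a ^+ 2)^-1.
  apply: mx_ext => v; have [x [y [z ->]]] := frame_span v fr.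
  rewrite -scalemxAr homE !dotD !dotZ u1s u2s rr mulmxA !mulmxDl -!scalemxAl e1 e2 rM.
  rewrite -!scalemxAl e1 e2 rM bE; apply/rowP => i; rewrite !mxE; field.
  by rewrite nza.
have ah : autC F (hom r ps (a ^+ 2)^-1).
  have -> : hom r ps (a ^+ 2)^-1 = (a ^+ 2)^-1 *: (M *m M).
    by rewrite MM scalerA mulVf ?scale1r // expf_neq0.
  by apply: (autCZ smoothC); [rewrite invr_eq0 expf_neq0 | apply: autCM].
have := qg_root q ah; rewrite exprVn => /eqP; rewrite invr_eq1 => /eqP cm.
by have [j mE] := dvdnP dv; apply: (neg_one_even c5 cm (j := j)); rewrite mE mulnC.
Qed.

End OnLine.
End Geometry.

(** * The dichotomy for a line joining two centres *)

Section Geometry.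
Variables (K : closedFieldType).
Hypothesis charK0 : [pchar K] =i pred0.
Variables (d : nat) (F : {mpoly K[3]}).
Hypothesis d_gt1 : (1 < d)%N.
Hypothesis smoothC : smooth_plane_curve F d.
Implicit Types (u v w p q r t : 'rV[K]_3) (x y z k : K) (M N : 'M[K]_3) (ph ps : 'cV[K]_3) (o : option K).

Section OnLine.
Variable B : 'M[K]_(2, 3).
Hypothesis freeB : row_free B.
Local Notation line_aut := (line_aut F B).
Local Notation pole_aut := (pole_aut F B).
Local Notation pe := (pe B).

Let tri1 := line_trichotomy charK0 d_gt1 smoothC freeB (@line_aut_1 _ F B) (@line_aut_M _ F B) (@line_aut_V _ F B) (@line_aut_A _ F B) (@line_aut_S _ F B).
Let tri2 r n := line_trichotomy charK0 d_gt1 smoothC freeB (@pole_aut_1 _ F B r n) (@pole_aut_M _ F B r n) (@pole_aut_V _ F B r n) (@pole_aut_A _ F B r n) (@pole_aut_S _ F B r n).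

Variables (p1 p2 : 'rV[K]_3) (ph1 ph2 : 'cV[K]_3) (n1 n2 : nat).
Hypotheses (q1 : qg F p1 ph1 n1) (q2 : qg F p2 ph2 n2).
Hypotheses (p1B : (p1 <= B)%MS) (p2B : (p2 <= B)%MS) (np : ~ exists k, p2 = k *: p1).
Hypotheses (n1_gt3 : (3 < n1)%N).

Let off : exists v, [/\ (v <= B)%MS, F.@[v 0] = 0 & dot v ph1 != 0].
Proof. exact: (line_off_axis charK0 d_gt1 smoothC q1 q2 (ltnW n1_gt3) p1B p2B np). Qed.

Let h1 := line_aut_hom (B := B) q1 p1B.

Lemma axis_sym t ph m : qg F t ph m -> (t <= B)%MS -> dot t ph1 = 0 -> dot p1 ph = 0.
Proof.
move=> q tB; exact: (axis_symmetric charK0 d_gt1 smoothC freeB (@line_aut_1 _ F B) (@line_aut_M _ F B) (@line_aut_V _ F B) (@line_aut_A _ F B) (@line_aut_S _ F B)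
   q1 p1B n1_gt3 h1 off q tB (line_aut_hom q tB)).
Qed.

Lemma common_axis t ph m q : qg F t ph m -> (t <= B)%MS -> (q <= B)%MS -> q != 0 ->
  dot q ph1 = 0 -> dot q ph = 0 -> exists k, p1 = k *: t.
Proof.
move=> qt tB; exact: (line_common_axis charK0 d_gt1 smoothC freeB (@line_aut_1 _ F B) (@line_aut_M _ F B) (@line_aut_V _ F B) (@line_aut_A _ F B) (@line_aut_S _ F B)
   q1 p1B n1_gt3 h1 off qt tB (line_aut_hom qt tB)).
Qed.

Lemma conj_centre M k o : autC F M -> k != 0 -> pe o = k *: (p1 *m M) ->
  qg F (pe o) (k^-1 *: (invmx M *m ph1)) n1.
Proof. by move=> aM nzk ->; apply: (qg_scale smoothC nzk); apply: (qg_conj aM). Qed.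

(** Everything but the common point r of the axes comes from [line_trichotomy].
    The third vertex r of the triangle of p1 and its antipode w is a centre by
    [third_qg]. To see that all axes pass through r, the trichotomy is applied
    again to the automorphisms fixing the intersection r0 of the axes of p1 and
    of a vertex in general position: this smaller group is again octahedral or
    icosahedral, so its vertices, whose axes pass through r0, are as many and
    hence the same. As w is among them, r0 = r. *)
Lemma line_cases :
  (forall t ph m, (t <= B)%MS -> qg F t ph m -> (2 < m)%N -> dot t ph1 = 0 \/ exists k, t = k *: p1) \/
  exists r ps m s, rich F B n1 r ps m s.
Proof.
case: (tri1 q1 p1B n1_gt3 h1 off) => [I|[s [us szs cen all anti]]].
  by left=> t ph m tB q m_gt2; apply: I q m_gt2 (line_aut_hom q tB).
right.
have d11 : dot p1 ph1 = 1 by case: q1.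
have nzp1 := qg_nz d_gt1 smoothC q1.
have cenq o : o \in s -> exists M k, [/\ line_aut M, k != 0, pe o = k *: (p1 *m M) & qg F (pe o) (k^-1 *: (invmx M *m ph1)) n1].
  move=> /cen [M [k [hM nzk e]]]; exists M, k; split=> //.
  by apply: conj_centre => //; case: hM.
have all' t ph m : (t <= B)%MS -> qg F t ph m -> (3 < m)%N -> exists o k, [/\ o \in s, k != 0 & t = k *: pe o].
  by move=> tB q m_gt3; apply: all q m_gt3 (line_aut_hom q tB).
have [w [wB nzw w0]] := axis_point freeB p1B d11.
have [ow [kw [ows nzkw wE]]] := anti w wB nzw w0.
have [Mw [cw [hMw nzcw ewM qpw]]] := cenq ow ows.
have [phw qw] : exists ph, qg F w ph n1.
  by eexists; rewrite wE; apply: (qg_scale smoothC nzkw qpw).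
have dp1w : dot p1 phw = 0 := axis_sym qw wB w0.
have [r [ps [m [[qr dvm r1 rw] [sp1 sw dec]]]]] := third_qg charK0 d_gt1 smoothC q1 qw dp1w w0.
have [rr _ _ _] := qr.
have dww : dot w phw = 1 by case: qw.
have nzr := qg_nz d_gt1 smoothC qr.
have np1w : ~ exists k, p1 = k *: w.
  by case=> k e; move/eqP: d11; rewrite e dotZ w0 mulr0 eq_sym oner_eq0.
have rnB t : (t <= B)%MS -> dot t ph1 = 0 -> dot t phw = 0 -> t = 0.
  move=> tB t1 tw; apply/eqP; apply/negPn/negP => nzt.
  by apply: np1w; apply: (common_axis qw wB tB nzt).
have axis v : (dot v ps = 0) <-> (v <= B)%MS.
  split=> [v0|vB].
    by rewrite (dec v) v0 scale0r addr0 addmx_sub ?scalemx_sub.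
  have e : dot v ps *: r = v - dot v ph1 *: p1 - dot v phw *: w.
    by move: (dec v); move: (dot v ph1) (dot v phw) (dot v ps) => a b c ->; apply/rowP => i; rewrite !mxE; ring.
  have : dot v ps *: r = 0.
    apply: rnB; rewrite ?dotZ ?r1 ?rw ?mulr0 //.
    by rewrite e !addmx_sub // eqmx_opp scalemx_sub.
  by move/eqP; rewrite scaler_eq0 (negPf nzr) orbF => /eqP.
(* a vertex in general position with respect to p1: neither p1 nor its antipode *)
have [o2 o2s [nd2 np2]] : exists2 o, o \in s & dot (pe o) ph1 != 0 /\ ~ exists k, pe o = k *: p1.
  apply: contrapT => no.
  have [o1 [k1 [nzk1 p1E]]] := in_line p1B nzp1.
  have sub : {subset s <= [:: o1; ow]}.
    move=> o os; rewrite !inE; apply/orP.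
    have [d0|nd] := eqVneq (dot (pe o) ph1) 0.
      right; apply/eqP; apply: (@pe_inj _ _ freeB _ _ (dot (pe o) phw * kw)).
      have po : dot (pe o) ps = 0 by apply/axis; apply: pe_in.
      by rewrite {1}(dec (pe o)) d0 po !scale0r add0r addr0 wE scalerA.
    left; apply: contrapT => /negP no1; apply: no; exists o => //; split=> // -[k e].
    case/eqP: no1; apply: (@pe_inj _ _ freeB _ _ (k * k1)).
    by rewrite e p1E scalerA.
  by have := uniq_leq_size us sub; case: szs => [[-> _]|[-> _ _]].
have [M2 [c2 [hM2 nzc2 e2M qo2]]] := cenq o2 o2s; set ph2' := (_ *: _) in qo2.
have [r0 [nzr0 r01 r02]] := common_zero ph1 ph2'.
have r0B : ~~ (r0 <= B)%MS.
  apply/negP => r0B; apply: np2.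
  have [k e] := common_axis qo2 (pe_in B o2) r0B nzr0 r01 r02.
  have nzk : k != 0 by apply: contraNneq nzp1 => k0; rewrite e k0 scale0r.
  by exists k^-1; rewrite e scalerA mulVf // scale1r.
case: (tri2 (r := r0) (n := n1) q1 p1B n1_gt3 (pole_aut_hom q1 p1B r01) off) => [I|[s' [us' szs' cen' all2 anti2]]].
  have [|e|e] := I _ _ n1 (pe_in B o2) qo2 (ltnW n1_gt3).
  - exact: pole_aut_hom qo2 (pe_in B o2) r02.
  - by rewrite e eqxx in nd2.
  - by case: np2.
have cenq' o : o \in s' -> exists ph, qg F (pe o) ph n1 /\ dot r0 ph = 0.
  move=> /cen' [M [k [[aM sM rM dM] nzk e]]]; exists (k^-1 *: (invmx M *m ph1)).
  split; first exact: conj_centre.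
  have [uM _] := aM; rewrite dotZr -dotM.
  have -> : r0 *m invmx M = r0 by rewrite -{1}rM mulmxK.
  by rewrite r01 mulr0.
have sub : {subset s' <= s}.
  move=> o os'; have [ph [qo _]] := cenq' o os'.
  have [o' [k [o's _ e]]] := all' _ _ _ (pe_in B o) qo n1_gt3.
  by rewrite (pe_inj freeB e).
have szss' : size s' = size s.
  by case: szs szs' => [[-> e]|[-> e _]] [[-> e']|[-> e' _]] //; rewrite e in e'.
have s's : s' =i s.
  by have [|_] := uniq_min_size us' sub; rewrite ?szss'.
have [phw' [qw' r0w']] : exists ph, qg F (pe ow) ph n1 /\ dot r0 ph = 0.
  by apply: cenq'; rewrite s's.
have r0w : dot r0 phw = 0.
  have qw2 : qg F w (kw^-1 *: phw') n1 by rewrite wE; apply: (qg_scale smoothC nzkw qw').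
  have [-> _] := qg_unique charK0 d_gt1 smoothC qw qw2.
  by rewrite dotZr r0w' mulr0.
have r0E : r0 = dot r0 ps *: r.
  by rewrite {1}(dec r0) r01 r0w !scale0r !add0r.
have nzr0ps : dot r0 ps != 0 by apply: contraNneq nzr0 => e; rewrite r0E e scale0r.
exists r, ps, m, s; split=> //.
- by case: szs => [|[-> -> _]]; [left | right].
- move=> n5; case: szs' => [[_ n4]|[_ _ [M [hM nsM sc]]]]; first by rewrite n5 in n4.
  rewrite n5 in hM dvm.
  apply: (involution_even charK0 d_gt1 smoothC freeB qr dvm axis _ nsM sc).
  case: hM => aM sM rM dM; split=> //.
  move: rM; rewrite r0E -scalemxAl => /(scalerI nzr0ps) //.
- move=> o os; have [ph [qo r0o]] := cenq' o (etrans (s's o) os); exists ph; split=> //.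
  by move/eqP: r0o; rewrite r0E dotZ mulf_eq0 (negPf nzr0ps) => /eqP.
- move=> c ph t cB qc tB nzt t0.
  have [o [k [os nzk cE]]] := all' c ph n1 cB qc n1_gt3.
  have [M [k' [[aM sM] nzk' eM qo]]] := cenq o os; have [uM _] := aM.
  have phE : ph = k^-1 *: (k'^-1 *: (invmx M *m ph1)).
    have qc2 : qg F c (k^-1 *: (k'^-1 *: (invmx M *m ph1))) n1 by rewrite cE; apply: (qg_scale smoothC nzk qo).
    by have [-> _] := qg_unique charK0 d_gt1 smoothC qc qc2.
  have t'0 : dot (t *m invmx M) ph1 = 0.
    move/eqP: t0; rewrite phE !dotZr dotM mulf_eq0 invr_eq0 (negPf nzk) mulf_eq0 invr_eq0 (negPf nzk') /=.
    by move/eqP.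
  have sV : stab B (invmx M) by apply: stabV.
  have t'B : (t *m invmx M <= B)%MS.
    by move: tB => /submxP [u ->]; rewrite -mulmxA (submx_trans _ sV) // submxMl.
  have nzt' : t *m invmx M != 0.
    by apply: contra_neq nzt => e; rewrite -[t](mulmxKV uM) e mul0mx.
  have [o' [k'' [o's nzk'' t'E]]] := anti _ t'B nzt' t'0.
  have [M' [l [_ _ _ qo']]] := cenq o' o's.
  have qt := qg_conj aM (qg_scale smoothC nzk'' qo').
  rewrite -t'E mulmxKV // in qt.
  exact: all' qt n1_gt3.
Qed.

End OnLine.
End Geometry.

(** * Points, lines and G-pairs *)

Section Points.
Variable K : fieldType.
Implicit Types (u v w p q : 'rV[K]_3) (x y k : K) (P Q : proj_point K).

Definition e0 : 'rV[K]_3 := delta_mx 0 0.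

Lemma dim_e0 : \dim <[e0]>%VS == 1%N.
Proof.
rewrite dim_vline; suff -> : e0 != 0 by [].
by apply/rV0Pn; exists 0; rewrite mxE !eqxx oner_neq0.
Qed.

(** The zero vector has no point; it is sent to the default point e0. *)
Definition mkP v : proj_point K := insubd (Point dim_e0) <[v]>%VS.

Lemma mkP_space v : v != 0 -> (mkP v : {vspace _}) = <[v]>%VS.
Proof. by move=> nz; rewrite /mkP insubdK // unfold_in /= dim_vline nz. Qed.

Lemma mkP_exists P : exists2 v, v != 0 & P = mkP v.
Proof.
have dP : \dim P == 1%N by case: P.
have nz : vpick P != 0 by rewrite vpick0 -dimv_eq0 (eqP dP).
exists (vpick P) => //; apply: val_inj; rewrite /= mkP_space //.
apply/eqP; rewrite eq_sym eqEdim -memvE memv_pick /= dim_vline nz.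
by rewrite (eqP dP).
Qed.

Lemma mkP_eq v w : v != 0 -> w != 0 -> mkP v = mkP w <-> exists k, w = k *: v.
Proof.
move=> nv nw; split=> [e|[k e]].
  have : w \in <[v]>%VS by rewrite -mkP_space // e mkP_space // memv_line.
  by move=> /vlineP.
apply: val_inj; rewrite /= !mkP_space // e; apply/eqP; rewrite eq_sym eqEdim -memvE.
rewrite memvZ ?memv_line //= !dim_vline nv -e nw //.
Qed.

Definition line2 p q : 'M[K]_(2, 3) := col_mx p q.

Lemma line2P p q v : (v <= line2 p q)%MS <-> exists x y, v = x *: p + y *: q.
Proof.
split=> [|[x [y ->]]]; rewrite /line2 -(addsmxE p q); last first.
  by apply: addmx_sub_adds; apply: scalemx_sub.
case/sub_addsmxP=> [[a b] /= ->].
by exists (a 0 0), (b 0 0); rewrite {1}[a]mx11_scalar {1}[b]mx11_scalar !mul_scalar_mx.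
Qed.

Lemma line2_l p q : (p <= line2 p q)%MS.
Proof. by apply/line2P; exists 1, 0; rewrite scale1r scale0r addr0. Qed.
Lemma line2_r p q : (q <= line2 p q)%MS.
Proof. by apply/line2P; exists 0, 1; rewrite scale1r scale0r add0r. Qed.

Lemma line2_indep p q : p != 0 -> ~ (exists k, q = k *: p) ->
  forall x y, x *: p + y *: q = 0 -> x = 0 /\ y = 0.
Proof.
move=> nzp nq x y e; have y0 : y = 0.
  apply: contrapT => /eqP nzy; apply: nq; exists (- x / y); apply: (scalerI nzy).
  by rewrite scalerA mulrC divfK // scaleNr; apply/eqP; rewrite -addr_eq0 addrC e.
split=> //; move: e; rewrite y0 scale0r addr0 => /eqP; rewrite scaler_eq0 (negPf nzp) orbF.
by move/eqP.
Qed.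

Lemma line2_free p q : p != 0 -> ~ (exists k, q = k *: p) -> row_free (line2 p q).
Proof.
move=> nzp nq; apply/inj_row_free => u; pose u' : 'rV[K]_(1 + 1) := u.
have -> : u *m line2 p q = lsubmx u' *m p + rsubmx u' *m q by rewrite -mul_row_col hsubmxK.
rewrite [lsubmx u']mx11_scalar [rsubmx u']mx11_scalar !mul_scalar_mx => e.
have [l0 r0] := line2_indep nzp nq e.
rewrite -[u](hsubmxK u') [lsubmx u']mx11_scalar [rsubmx u']mx11_scalar l0 r0.
by rewrite !raddf0 row_mx0.
Qed.

Lemma line_throughP p q v : p != 0 -> q != 0 -> v != 0 ->
  line_through (mkP p) (mkP q) (mkP v) <-> (v <= line2 p q)%MS.
Proof.
move=> np nq nv; rewrite line2P /line_through /mkset /= !mkP_space // -memvE; split.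
  by case/memv_addP => _ /vlineP [x ->] [_ /vlineP [y ->] ->]; exists x, y.
by case=> x [y ->]; apply: memv_add; rewrite memvZ ?memv_line.
Qed.
End Points.

Section GPair.
Variables (K : closedFieldType).
Hypothesis charK0 : [pchar K] =i pred0.
Variables (d : nat) (F : {mpoly K[3]}).
Hypothesis d_gt1 : (1 < d)%N.
Hypothesis smoothC : smooth_plane_curve F d.
Implicit Types (p q : 'rV[K]_3) (z : K) (M : 'M[K]_3) (ph : 'cV[K]_3).

Lemma hom_generator p ph m z : qg F p ph m -> m.-primitive_root z ->
  Defs.generator F (mkP p) (lin (hom p ph z)).
Proof.
move=> q zP; have [pp Fp m_gt1 qE] := q.
have nzp := nz_of_F d_gt1 smoothC Fp; have Pp := mkP_space nzp.
have al y : y ^+ m = 1 -> autC F (hom p ph y) /\ along p (hom p ph y).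
  by move=> ym; apply/qE; exists y.
have [az alz] := al z (prim_expr_order zP).
split; first exact: (Grep_lin charK0 d_gt1 smoothC Fp Pp az alz).
move=> B gB; have [M [aM alM BM]] := Grep_linear charK0 d_gt1 smoothC Fp Pp gB.
have [/(_ (conj aM alM)) [y ym ME] _] := qE M.
have [k yE] := prim_rootP zP ym; exists k.
rewrite iter_comp_lin; suff -> : iter k (mulmx^~ (hom p ph z)) 1%:M = M by [].
rewrite ME yE; elim: (k : nat) => [|j IH] /=; first by rewrite hom1.
by rewrite IH hom_mul // exprSr.
Qed.

Lemma hom_fixes p ph m z q : qg F p ph m -> z ^+ m = 1 -> q != 0 -> dot q ph = 0 ->
  fixes F (lin (hom p ph z)) (mkP q).
Proof.
move=> qp zm nzq q0; have [_ Fp m_gt1 _] := qp; have [uM _] := qg_aut qp zm.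
exists (linfun (mulmxr (hom p ph z))); split.
- apply/eqP; rewrite -subv0; apply/subvP => v; rewrite memv_ker lfunE /= memv0 => /eqP e.
  by rewrite -[v](mulmxK uM) e mul0mx.
- rewrite linear_triple_lin.
  exact/same_ratmap_refl/(ratmap_lin charK0 d_gt1 smoothC Fp).
- by rewrite !mkP_space // limg_line lfunE /= hom_fix.
Qed.

(** A homology fixes the points of its axis, and one with a primitive root of unity
    as multiplier generates G[P]. *)
Lemma mutual_G_pair p p' ph ph' m m' n : (1 < n)%N -> (n %| m)%N -> (n %| m')%N ->
  qg F p ph m -> qg F p' ph' m' -> dot p ph' = 0 -> dot p' ph = 0 ->
  G_pair F n (mkP p) (mkP p').
Proof.
move=> n_gt1 nm nm' q q' d1 d2; have [pp Fp m_gt1 _] := q; have [pp' Fp' m'_gt1 _] := q'.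
have nzp := nz_of_F d_gt1 smoothC Fp; have nzp' := nz_of_F d_gt1 smoothC Fp'.
have Pp := mkP_space nzp; have Pp' := mkP_space nzp'.
have [z zP] := prim_root_ex charK0 (ltnW m_gt1).
have [z' zP'] := prim_root_ex charK0 (ltnW m'_gt1).
split=> //.
- case/(mkP_eq nzp nzp') => k e; move/eqP: pp'.
  by rewrite e dotZ d1 mulr0 eq_sym oner_eq0.
- by split=> /(on_curveP smoothC) => [/(_ _ Pp)|/(_ _ Pp')] /eqP; apply/negP.
- by split; [exists m | exists m'] => //;
    [apply: (groupG_card charK0 d_gt1 smoothC Fp Pp q) | apply: (groupG_card charK0 d_gt1 smoothC Fp' Pp' q')].
exists (lin (hom p ph z)), (lin (hom p' ph' z')); split.
- exact: hom_generator zP.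
- exact: hom_generator zP'.
- exact: hom_fixes q (prim_expr_order zP) nzp' d2.
- exact: hom_fixes q' (prim_expr_order zP') nzp d1.
Qed.
End GPair.

(** * Pairs of centres *)

Section Dual.
Variable K : closedFieldType.
Implicit Types (u v w p q r : 'rV[K]_3) (ph ps : 'cV[K]_3).

Definition dual_basis p1 ph1 p2 ph2 r ps :=
  [/\ [/\ dot p1 ph1 = 1, dot p1 ph2 = 0 & dot p1 ps = 0],
      [/\ dot p2 ph1 = 0, dot p2 ph2 = 1 & dot p2 ps = 0] &
      [/\ dot r ph1 = 0, dot r ph2 = 0 & dot r ps = 1]].

(** [dual_third] gives a third vector and covector; they differ from r and ps by
    inverse scalars. *)
Lemma dual_basis_dec p1 ph1 p2 ph2 r ps : dual_basis p1 ph1 p2 ph2 r ps ->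
  forall v, v = dot v ph1 *: p1 + dot v ph2 *: p2 + dot v ps *: r.
Proof.
case=> [[d11 d12 d1s] [d21 d22 d2s] [r1 r2 rs]] v.
have [r' [ps' [_ [_ _ dec]]]] := dual_third d11 d22 d12 d21.
have rE : r = dot r ps' *: r' by rewrite {1}(dec r) r1 r2 !scale0r !add0r.
have vs : dot v ps = dot v ps' * dot r' ps.
  by rewrite {1}(dec v) !dotD !dotZ d1s d2s !mulr0 !add0r.
have e1 : dot r ps' * dot r' ps = 1 by rewrite -dotZ -rE.
rewrite {1}(dec v) vs rE scalerA; congr (_ + _ *: _).
by rewrite -mulrA [dot r' ps * _]mulrC e1 mulr1.
Qed.
End Dual.

Section Geometry.
Variables (K : closedFieldType).
Hypothesis charK0 : [pchar K] =i pred0.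
Variables (d : nat) (F : {mpoly K[3]}).
Hypothesis d_gt1 : (1 < d)%N.
Hypothesis smoothC : smooth_plane_curve F d.
Implicit Types (u v w p q r t : 'rV[K]_3) (x y z k : K) (M N : 'M[K]_3) (ph ps : 'cV[K]_3) (o : option K).

Lemma not_prop p ph q : dot p ph = 0 -> dot q ph != 0 -> ~ exists k, q = k *: p.
Proof. by move=> p0 nq [k e]; move: nq; rewrite e dotZ p0 mulr0 eqxx. Qed.

Lemma prop_sym p q : q != 0 -> (exists k, q = k *: p) -> exists k, p = k *: q.
Proof.
move=> nzq [k e]; have nzk : k != 0 by apply: contraNneq nzq => k0; rewrite e k0 scale0r.
by exists k^-1; rewrite e scalerA mulVf // scale1r.
Qed.

Section RichLine.
Variables (B : 'M[K]_(2, 3)) (n m : nat) (r : 'rV[K]_3) (ps : 'cV[K]_3) (s : seq (option K)).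
Hypotheses (freeB : row_free B) (R : rich F B n r ps m s).

Lemma rich_order : n = 4%N \/ n = 5%N.
Proof. by case: (rich_size R) => [[_ ->]|[_ ->]]; [left | right]. Qed.

Let n_gt3 : (3 < n)%N. Proof. by case: rich_order => ->. Qed.

Lemma rich_pole : dot r ps = 1.
Proof. by case: (rich_qg R). Qed.

(** Such a centre is a vertex, and the axis and order are determined by the point. *)
Lemma rich_centre_axis t ph (k : nat) : (t <= B)%MS -> qg F t ph k -> (3 < k)%N -> k = n /\ dot r ph = 0.
Proof.
move=> tB qt k_gt3; have [o [c [os nzc tE]]] := rich_all R tB qt k_gt3.
have [pho [qo r0]] := rich_centre R os.
have qt' : qg F t (c^-1 *: pho) n by rewrite tE; apply: (qg_scale smoothC nzc qo).
have [-> ->] := qg_unique charK0 d_gt1 smoothC qt qt'.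
by rewrite dotZr r0 mulr0.
Qed.

(** The trace w of the axis of c is a vertex, and [axis_sym] gives the reverse
    incidence. *)
Lemma antipode c ph : (c <= B)%MS -> qg F c ph n ->
  exists w phw, [/\ (w <= B)%MS, qg F w phw n, dot w ph = 0 & dot c phw = 0].
Proof.
move=> cB qc; have [cc _ _ _] := qc.
have [w [wB nzw w0]] := axis_point freeB cB cc.
have [o [k [os nzk wE]]] := rich_anti R cB qc wB nzw w0.
have [pho [qo _]] := rich_centre R os.
have qw : qg F w (k^-1 *: pho) n by rewrite wE; apply: (qg_scale smoothC nzk qo).
exists w, (k^-1 *: pho); split=> //.
have np : ~ exists k, w = k *: c.
  by case/(prop_sym nzw)=> l e; move/eqP: cc; rewrite e dotZ w0 mulr0 eq_sym oner_eq0.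
exact: (axis_sym charK0 d_gt1 smoothC freeB qc qw cB wB np n_gt3 qw wB w0).
Qed.

End RichLine.

Section TwoCentres.
Variables (p1 p2 : 'rV[K]_3) (ph1 ph2 : 'cV[K]_3) (n1 n2 : nat).
Hypotheses (q1 : qg F p1 ph1 n1) (q2 : qg F p2 ph2 n2).
Hypotheses (np : ~ exists k, p2 = k *: p1) (n1_gt3 : (3 < n1)%N).
Let B := line2 p1 p2.
Let freeB : row_free B. Proof. exact: line2_free (qg_nz d_gt1 smoothC q1) np. Qed.

Let cases := line_cases charK0 d_gt1 smoothC freeB q1 q2 (line2_l p1 p2) (line2_r p1 p2) np n1_gt3.

(** Vertices of an octahedron or icosahedron have order 4 or 5, which leaves the
    mutual case. *)
Lemma large_axis : (5 < n1)%N -> (2 < n2)%N -> dot p2 ph1 = 0.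
Proof.
move=> n1_gt5 n2_gt2; case: cases => [I|[r [ps [m [s R]]]]].
  by case: (I _ _ _ (line2_r p1 p2) q2 n2_gt2).
by case: (rich_order R) n1_gt5 => ->.
Qed.

Lemma pair_cases : (3 < n2)%N ->
  [/\ dot p2 ph1 = 0, dot p1 ph2 = 0 &
      forall t ph m, (t <= B)%MS -> qg F t ph m -> (2 < m)%N ->
        (exists k, t = k *: p1) \/ exists k, t = k *: p2] \/
  n1 = n2 /\ exists r ps m s, rich F B n1 r ps m s.
Proof.
move=> n2_gt3; case: cases => [I|[r [ps [m [s R]]]]]; last first.
  right; split; last by exists r, ps, m, s.
  by have [] := rich_centre_axis R (line2_r p1 p2) q2 n2_gt3.
have d21 : dot p2 ph1 = 0 by case: (I _ _ _ (line2_r p1 p2) q2 (ltnW n2_gt3)).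
have d12 : dot p1 ph2 = 0.
  exact: (axis_sym charK0 d_gt1 smoothC freeB q1 q2 (line2_l p1 p2) (line2_r p1 p2) np n1_gt3 q2 (line2_r p1 p2) d21).
have [d11 _ _ _] := q1.
left; split=> // t ph m tB qt m_gt2; case: (I _ _ _ tB qt m_gt2) => [t0|]; last by left.
right; move: tB t0 => /line2P [x [y ->]]; rewrite dotD !dotZ d11 d21 mulr0 addr0 mulr1 => ->.
by exists y; rewrite scale0r add0r.
Qed.
End TwoCentres.

Lemma qg_basis p1 ph1 n1 p2 ph2 n2 r ps m : qg F p1 ph1 n1 -> qg F p2 ph2 n2 -> qg F r ps m ->
  dot p1 ph2 = 0 -> dot p1 ps = 0 -> dot p2 ph1 = 0 -> dot p2 ps = 0 ->
  dot r ph1 = 0 -> dot r ph2 = 0 -> dual_basis p1 ph1 p2 ph2 r ps.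
Proof. by case=> [? _ _ _] [? _ _ _] [? _ _ _]; split. Qed.

Section SixPoints.
Variables (B : 'M[K]_(2, 3)) (m : nat) (r : 'rV[K]_3) (ps : 'cV[K]_3) (s : seq (option K)).
Hypotheses (freeB : row_free B) (R : rich F B 4 r ps m s).
Variables (a b : 'rV[K]_3) (pha phb : 'cV[K]_3).
Hypotheses (aB : (a <= B)%MS) (bB : (b <= B)%MS) (qa : qg F a pha 4) (qb : qg F b phb 4).
Hypotheses (ab : dot a phb = 0) (ba : dot b pha = 0).
Hypothesis dec : forall t, (t <= B)%MS -> t = dot t pha *: a + dot t phb *: b.

Let aa : dot a pha = 1. Proof. by case: qa. Qed.
Let bb : dot b phb = 1. Proof. by case: qb. Qed.

(* The four vertices of an octahedron other than the antipodes a and b. *)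
Lemma six_rest : exists s' : seq (option K), [/\ size s' = 4%N, {subset s' <= s} &
  forall o x y k, o \in s -> pe B o = k *: (x *: a + y *: b) ->
    (o \in s') = (x != 0) && (y != 0)].
Proof.
have [oa [ka [oas nzka aE]]] := rich_all R aB qa isT.
have [ob [kb [obs nzkb bE]]] := rich_all R bB qb isT.
have us := rich_uniq R; have us' := rem_uniq oa us.
have nab : oa != ob.
  apply: contraTneq isT => e; have : a = (ka / kb) *: b by rewrite aE bE e scalerA divfK.
  by move=> e2; move/eqP: aa; rewrite e2 dotZ ba mulr0 eq_sym oner_eq0.
have inr o : (o \in rem ob (rem oa s)) = [&& o != ob, o != oa & o \in s].
  by rewrite (mem_rem_uniq _ us') !inE (mem_rem_uniq _ us) !inE.
exists (rem ob (rem oa s)); split.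
- rewrite size_rem ?(mem_rem_uniq _ us) ?inE 1?eq_sym ?nab // size_rem //.
  by case: (rich_size R) => [[-> _]|[_]].
- by move=> o; rewrite inr => /and3P [].
move=> o x y k os oE; rewrite inr os andbT.
have nzo := pe_nz freeB o.
congr (~~ _ && ~~ _); apply/eqP/eqP => e.
- have : dot (pe B o) pha = 0 by rewrite e; apply/eqP; move/eqP: ba; rewrite bE dotZ mulf_eq0 (negPf nzkb).
  rewrite oE dotZ dotD !dotZ aa ba mulr0 addr0 mulr1 => /eqP.
  rewrite mulf_eq0 => /orP [/eqP k0|/eqP //].
  by move: nzo; rewrite oE k0 scale0r eqxx.
- apply: (@pe_inj _ _ freeB _ _ (k * y * kb)).
  by rewrite oE e scale0r add0r bE !scalerA.
- have : dot (pe B o) phb = 0 by rewrite e; apply/eqP; move/eqP: ab; rewrite aE dotZ mulf_eq0 (negPf nzka).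
  rewrite oE dotZ dotD !dotZ ab bb mulr0 add0r mulr1 => /eqP.
  rewrite mulf_eq0 => /orP [/eqP k0|/eqP //].
  by move: nzo; rewrite oE k0 scale0r eqxx.
- apply: (@pe_inj _ _ freeB _ _ (k * x * ka)).
  by rewrite oE e scale0r addr0 aE !scalerA.
Qed.

Lemma six_scale : exists2 c : K, c != 0 & exists ph, qg F (a + c *: b) ph 4.
Proof.
have [s' [szs' sub inE']] := six_rest.
case: s' szs' sub inE' => [//|o s'] _ sub inE'.
have os : o \in s by apply: sub; rewrite mem_head.
have oE := dec (pe_in B o); set x := dot _ _ in oE; set y := dot _ _ in oE.
have := inE' o x y 1 os; rewrite scale1r -oE mem_head => /(_ erefl) /esym /andP [nzx nzy].
have [ph [qo _]] := rich_centre R os.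
exists (y / x); first by rewrite mulf_neq0 ?invr_eq0.
exists ((x^-1)^-1 *: ph); have -> : a + (y / x) *: b = x^-1 *: pe B o.
  by rewrite oE scalerDr !scalerA mulVf // scale1r mulrC.
by apply: (qg_scale smoothC _ qo); rewrite invr_eq0.
Qed.

(** The homologies with centre b carry a + b to the four points a + c b with
    c ^ 4 = 1, and there is no room for a fifth vertex besides a and b. *)
Lemma six_roots phc x y ph : qg F (a + b) phc 4 -> qg F (x *: a + y *: b) ph 4 ->
  [\/ x = 0, y = 0 | (y / x) ^+ 4 = 1].
Proof.
move=> qc qt; have [-> | nzx] := eqVneq x 0; first by apply: Or31.
have [-> | nzy] := eqVneq y 0; first by apply: Or32.
apply: Or33; apply: contrapT => /eqP nr.
have [s' [szs' sub inE']] := six_rest.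
have [rs [urs szrs rsE]] := unity_roots charK0 (isT : (0 < 4)%N).
pose f o := dot (pe B o) phb / dot (pe B o) pha.
have fP c ph' : c != 0 -> qg F (a + c *: b) ph' 4 -> c \in map f s'.
  move=> nzc q; have cB : ((a + c *: b)%R <= B)%MS by rewrite addmx_sub ?scalemx_sub.
  have [o [k [os nzk e]]] := rich_all R cB q isT.
  have oE : pe B o = k^-1 *: (1 *: a + c *: b).
    by rewrite scale1r e scalerA mulVf // scale1r.
  apply/mapP; exists o; first by rewrite (inE' o _ _ _ os oE) oner_neq0.
  rewrite /f oE !dotZ !dotD !dotZ aa bb ab ba !mulr0 !mulr1 addr0 add0r.
  by rewrite ?mulr1 mulrAC mulfV ?invr_eq0 // mul1r.
have qr c : c ^+ 4 = 1 -> exists ph', qg F (a + c *: b) ph' 4.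
  move=> c4; exists (invmx (hom b phb c) *m phc).
  have -> : a + c *: b = (a + b) *m hom b phb c.
    by rewrite mulmxDl hom_fix // hom_center.
  exact: qg_conj (qg_aut qb c4) qc.
(* the ratio y / x would be a fifth parameter besides the fourth roots of unity *)
have sub5 : {subset (y / x) :: rs <= map f s'}.
  move=> c; rewrite inE => /orP [/eqP ->|].
    apply: (fP _ ((x^-1)^-1 *: ph)); first by rewrite mulf_neq0 ?invr_eq0.
    have -> : a + (y / x) *: b = x^-1 *: (x *: a + y *: b).
      by rewrite scalerDr !scalerA mulVf // scale1r mulrC.
    by apply: (qg_scale smoothC _ qt); rewrite invr_eq0.
  rewrite rsE => /eqP c4; have [ph' q] := qr c c4; apply: fP q.
  by apply: contra_eq_neq c4 => ->; rewrite expr0n eq_sym oner_neq0.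
have := uniq_leq_size _ sub5; rewrite /= size_map szs' szrs urs andbT rsE nr.
by move/(_ isT).
Qed.

End SixPoints.
End Geometry.

(** * Centres off an octahedral or icosahedral line *)

Section Arithmetic.
Variable K : closedFieldType.
Hypothesis charK0 : [pchar K] =i pred0.

Lemma natr_neq0 n : (n.+1%:R : K) != 0.
Proof. by have/pcharf0P -> := charK0. Qed.

(** The hypothesis on x leaves 2 x = 1, 1 + i or 1 - i. For z = i the first value
    gives ((1 + i) / 2) ^ 4 = -1/4; the other two, with z = -i and z = i, give
    1 - i and 1 + i, whose fourth power is -4. *)
Lemma quartic_clash (i x : K) : i ^+ 2 = -1 -> x != 1 -> (- x / (1 - x)) ^+ 4 = 1 ->
  (forall z, z ^+ 2 = -1 -> 1 + (z - 1) * x = 0 \/ (1 + (z - 1) * x) ^+ 4 = 1) -> False.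
Proof.
move=> i2 x1 k4 H; have nx : 1 - x != 0 by rewrite subr_eq0 eq_sym.
have n2 := natr_neq0 1; have n4 := natr_neq0 3; have n5 := natr_neq0 4; have n20 := natr_neq0 19.
have i4 : i ^+ 4 = 1 by rewrite -[4%N]/(2 * 2)%N exprM i2 sqrrN expr1n.
have j2 : (- i) ^+ 2 = -1 by rewrite sqrrN.
have x4 : x ^+ 4 = (1 - x) ^+ 4.
  move: k4; rewrite expr_div_n => /(canRL (mulfVK (expf_neq0 4 nx))).
  by rewrite mul1r => <-; ring.
have f4 (z l : K) : z ^+ 2 = -1 -> l = 1 + z -> l = 0 \/ l ^+ 4 = 1 -> False.
  move=> z2 lE; have l2 : l ^+ 2 = 2%:R * z.
    by rewrite lE (_ : (1 + z) ^+ 2 = z ^+ 2 + 1 + 2%:R * z); [rewrite z2; ring | ring].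
  have l4 : l ^+ 4 = - 4%:R.
    by rewrite -[4%N]/(2 * 2)%N exprM l2 exprMn z2; ring.
  rewrite l4; case=> [l0|/eqP].
    by move: l4 => /eqP; rewrite l0 expr0n /= eq_sym oppr_eq0 (negPf n4).
  by rewrite -subr_eq0 (_ : - 4%:R - 1 = - 5%:R); [rewrite oppr_eq0 (negPf n5) | ring].
have : (2%:R * x - 1) * ((2%:R * x - 1) ^+ 2 - i ^+ 2) = 0.
  rewrite i2; have -> : (2%:R * x - 1) * ((2%:R * x - 1) ^+ 2 - -1) = 2%:R * (x ^+ 4 - (1 - x) ^+ 4) by ring.
  by rewrite x4 subrr mulr0.
rewrite subr_sqr => /eqP; rewrite !mulf_eq0 => /or3P [/eqP e|/eqP e|/eqP e].
- have lE : 2%:R * (1 + (i - 1) * x) = 1 + i.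
    by rewrite (_ : _ * _ = 1 + i + (2%:R * x - 1) * (i - 1)); [rewrite e mul0r addr0 | ring].
  have i4E : (1 + i) ^+ 4 = - 4%:R.
    rewrite (_ : (1 + i) ^+ 4 = (i ^+ 2 + 1 + 2%:R * i) ^+ 2); last by ring.
    by rewrite i2 addNr add0r exprMn i2; ring.
  case: (H i i2) => l.
    move: i4E => /eqP; rewrite -lE l mulr0 expr0n /= eq_sym oppr_eq0.
    by rewrite (negPf n4).
  move: i4E => /eqP; rewrite -lE exprMn l mulr1 -subr_eq0.
  by rewrite (_ : _ - _ = 20%:R); [rewrite (negPf n20) | ring].
- apply: (f4 (- i) (1 + (- i - 1) * x) j2 _ (H _ j2)).
  have xE : 2%:R * x = 1 + i by apply/eqP; rewrite -subr_eq0 -e; apply/eqP; ring.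
  apply: (mulfI n2); transitivity (2%:R - (i + 1) * (2%:R * x)); first by ring.
  rewrite xE; transitivity (2%:R * (1 - i) - (i ^+ 2 + 1)); first by ring.
  by rewrite i2 addNr subr0.
- apply: (f4 i (1 + (i - 1) * x) i2 _ (H i i2)).
  have xE : 2%:R * x = 1 - i by apply/eqP; rewrite -subr_eq0 -e; apply/eqP; ring.
  apply: (mulfI n2); transitivity (2%:R + (i - 1) * (2%:R * x)); first by ring.
  rewrite xE; transitivity (2%:R * (1 + i) - (i ^+ 2 + 1)); first by ring.
  by rewrite i2 addNr subr0.
Qed.
End Arithmetic.

Section Geometry.
Variables (K : closedFieldType).
Hypothesis charK0 : [pchar K] =i pred0.
Variables (d : nat) (F : {mpoly K[3]}).
Hypothesis d_gt1 : (1 < d)%N.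
Hypothesis smoothC : smooth_plane_curve F d.
Implicit Types (u v w p q r t : 'rV[K]_3) (x y z k : K) (M N : 'M[K]_3) (ph ps : 'cV[K]_3) (o : option K).

(** The point in question is where the line through r and t meets the axis of r.
    It is t itself when t lies on that axis; otherwise the line is octahedral and
    the point is the antipode of r. *)
Lemma centre_project r ps t ph : qg F r ps 4 -> qg F t ph 4 -> ~ (exists k, t = k *: r) ->
  exists ph', qg F (t - dot t ps *: r) ph' 4.
Proof.
move=> qr qt np; have [rr _ _ _] := qr.
have freeB := line2_free (qg_nz d_gt1 smoothC qr) np.
case: (pair_cases charK0 d_gt1 smoothC qr qt np isT isT) => [[t0 _ _]|[_ [r' [ps' [m [s R]]]]]].
  by exists ph; rewrite t0 scale0r subr0.
have [w [phw [wB qw w0 _]]] := antipode charK0 d_gt1 smoothC freeB R (line2_l r t) qr.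
have nzw := qg_nz d_gt1 smoothC qw.
move: wB => /line2P [x [y wE]].
have xE : x = - y * dot t ps.
  by apply/eqP; rewrite mulNr -addr_eq0 -w0 wE dotD !dotZ rr mulr1.
have {}wE : w = y *: (t - dot t ps *: r).
  by rewrite wE xE; apply/rowP => i; rewrite !mxE; ring.
have nzy : y != 0 by apply: contraNneq nzw => y0; rewrite wE y0 scale0r.
exists (y^-1^-1 *: phw); have -> : t - dot t ps *: r = y^-1 *: w.
  by rewrite wE scalerA mulVf // scale1r.
by apply: (qg_scale smoothC _ qw); rewrite invr_eq0.
Qed.

Section Configuration.
Variables (B B' : 'M[K]_(2, 3)) (r0 r1 : 'rV[K]_3) (ps0 ps1 : 'cV[K]_3) (m0 m1 : nat) (s0 s1 : seq (option K)).
Hypotheses (freeB : row_free B) (R : rich F B 4 r0 ps0 m0 s0).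
Hypotheses (freeB' : row_free B') (R' : rich F B' 4 r1 ps1 m1 s1).
Variables (a b c : 'rV[K]_3) (pha phb phc phu phv : 'cV[K]_3).
Hypotheses (qa : qg F a pha 4) (qb : qg F b phb 4) (qc : qg F c phc 4).
Hypothesis D : dual_basis a pha b phb c phc.
Hypotheses (BE : forall t, (t <= B)%MS <-> dot t phc = 0) (B'E : forall t, (t <= B')%MS <-> dot t pha = 0).
Hypotheses (qu : qg F (a + b) phu 4) (qv : qg F (b + c) phv 4) (av : dot a phv = 0).

(** Two octahedral lines, spanned by the antipodes a, b and by the antipodes b, c,
    with vectors scaled so that a + b and v = b + c are vertices. Put x = phv(b).
    The antipode of v is proportional to b - x / (1 - x) c, so the ratio has fourth
    power one by [six_roots]. The homology with centre v and multiplier z, z^4 = 1,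
    moves the vertex a + b off its line; projecting the image from c gives the
    vertex a + (1 + (z - 1) x) b, to which [six_roots] applies again. *)
Lemma configuration_absurd : False.
Proof.
have dec := dual_basis_dec D.
have [[aa ab ac] [ba bb bc] [ca cb cc]] := D.
have decB t : (t <= B)%MS -> t = dot t pha *: a + dot t phb *: b.
  by move/BE => e; rewrite {1}(dec t) e scale0r addr0.
have decB' t : (t <= B')%MS -> t = dot t phb *: b + dot t phc *: c.
  by move/B'E => e; rewrite {1}(dec t) e scale0r add0r.
have aB : (a <= B)%MS by apply/BE.
have bB : (b <= B)%MS by apply/BE.
have bB' : (b <= B')%MS by apply/B'E.
have cB' : (c <= B')%MS by apply/B'E.
pose v := b + c; have vB' : (v <= B')%MS by apply/B'E; rewrite dotD ba ca addr0.
have vv : dot v phv = 1 by case: qv.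
have vb : dot v phb = 1 by rewrite dotD bb cb addr0.
have vc : dot v phc = 1 by rewrite dotD bc cc add0r.
have [nbv nbc] : ~ (exists k, b = k *: v) /\ ~ (exists k, c = k *: v).
  split=> -[k e].
    have k0 : k = 0 by rewrite -[k]mulr1 -vc -dotZ -e.
    by move/eqP: bb; rewrite e k0 scale0r dot0 eq_sym oner_eq0.
  have k0 : k = 0 by rewrite -[k]mulr1 -vb -dotZ -e.
  by move/eqP: cc; rewrite e k0 scale0r dot0 eq_sym oner_eq0.
pose x := dot b phv; have cv : dot c phv = 1 - x by rewrite -vv dotD addrAC subrr add0r.
have nx1 : x != 1.
  apply/eqP => x1; have : dot v phc = 0.
    apply: (axis_sym charK0 d_gt1 smoothC freeB' qv qb vB' bB' nbv isT qc cB').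
    by rewrite cv x1 subrr.
  by rewrite vc => /eqP; rewrite oner_eq0.
have [w [phw [wB' qw w0 _]]] := antipode charK0 d_gt1 smoothC freeB' R' vB' qv.
have k4 : (- x / (1 - x)) ^+ 4 = 1.
  have nx : 1 - x != 0 by rewrite subr_eq0 eq_sym.
  have wE := decB' w wB'; set y := dot w phb in wE; set z := dot w phc in wE.
  have yz : y * x + z * (1 - x) = 0 by rewrite -w0 wE dotD !dotZ cv.
  have nzw := qg_nz d_gt1 smoothC qw.
  have zE : z = y * (- x / (1 - x)).
    apply: (mulIf nx); rewrite -mulrA divfK // mulrN; apply/eqP.
    by rewrite -addr_eq0 addrC yz.
  have nzy : y != 0.
    by apply: contraNneq nzw => y0; rewrite wE zE y0 mul0r !scale0r addr0.
  rewrite wE in qw.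
  case: (six_roots charK0 smoothC freeB' R' bB' cB' qb qc bc cb qv qw) => [y0|z0|].
  - by rewrite y0 eqxx in nzy.
  - have x0 : x = 0.
      apply/eqP; move/eqP: z0; rewrite zE mulf_eq0 (negPf nzy) mulf_eq0 invr_eq0 (negPf nx) orbF.
      by rewrite oppr_eq0.
    have : dot v phb = 0.
      exact: (axis_sym charK0 d_gt1 smoothC freeB' qv qb vB' bB' nbv isT qb bB').
    by rewrite vb => /eqP; rewrite oner_eq0.
  - by rewrite zE mulrAC mulfV // mul1r.
have [i i2] : exists i : K, i ^+ 2 = -1.
  have [i iP] := @solve_monicpoly K 2 (fun j => if j == 0%N then -1 else 0) isT.
  by exists i; rewrite iP !big_ord_recl big_ord0 /= mul0r !addr0 expr0 mulr1.
apply: (quartic_clash charK0 i2 nx1 k4) => z z2.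
have z4 : z ^+ 4 = 1 by rewrite -[4%N]/(2 * 2)%N exprM z2 sqrrN expr1n.
pose t := (a + b) *m hom v phv z.
have tE : t = a + (1 + (z - 1) * x) *: b + ((z - 1) * x) *: c.
  by rewrite /t homE dotD av add0r -/x /v; apply/rowP => j; rewrite !mxE; ring.
have qt := qg_conj (qg_aut qv z4) qu; rewrite -/t in qt.
have nt : ~ exists k, t = k *: c.
  apply: (@not_prop _ c pha) => //.
  by rewrite tE !dotD !dotZ aa ba ca !mulr0 !addr0 oner_neq0.
have [ph' q'] := centre_project qc qt nt.
have pE : t - dot t phc *: c = 1 *: a + (1 + (z - 1) * x) *: b.
  by rewrite tE !dotD !dotZ ac bc cc mulr0 !add0r mulr1 scale1r addrK.
rewrite pE in q'.
case: (six_roots charK0 smoothC freeB R aB bB qa qb ab ba qu q') => [/eqP|->|].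
- by rewrite oner_eq0.
- by left.
- by rewrite divr1; right.
Qed.
End Configuration.

(** If q is not r, the pair r, q is not mutual, as q is off the axis of r; so their
    line is octahedral. With b the antipode of r on it and a the
    point through which its axes pass, the lines of a, b and of b, r are in the
    position of [configuration_absurd]. *)
Lemma off_line_four B r ps m s q ph (k : nat) : row_free B -> rich F B 4 r ps m s ->
  qg F q ph k -> (3 < k)%N -> ~~ (q <= B)%MS -> exists c, q = c *: r.
Proof.
move=> freeB R qq k_gt3 nqB; apply: contrapT => np.
have qr := rich_qg R; have [rr _ m_gt1 _] := qr.
have gt3 j : (1 < j)%N -> (4 %| j)%N -> (3 < j)%N by move=> j_gt1; apply: dvdn_leq; apply: ltnW.
have m_gt3 := gt3 m m_gt1 (rich_dvd R).
case: (pair_cases charK0 d_gt1 smoothC qr qq np m_gt3 k_gt3) => [[q0 _ _]|[_ [a [pha [ma [s' R']]]]]].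
  by case/negP: nqB; apply/(rich_axis R).
(* the order of r is 4 or 5 on an octahedral or icosahedral line, and 4 divides it *)
have m4 : m = 4%N.
  by case: (rich_order R') => // m5; have := rich_dvd R; rewrite m5.
rewrite {}m4 {m_gt3} in qr R'.
have freeB' := line2_free (qg_nz d_gt1 smoothC qr) np; set B' := line2 r q in freeB' R'.
have rB' : (r <= B')%MS := line2_l r q.
have qa := rich_qg R'; have [aa _ ma_gt1 _] := qa.
have [_ a0] := rich_centre_axis charK0 d_gt1 smoothC R' rB' qr isT.
have aB : (a <= B)%MS by apply/(rich_axis R).
have [ma4 ra] := rich_centre_axis charK0 d_gt1 smoothC R aB qa (gt3 _ ma_gt1 (rich_dvd R')).
rewrite {}ma4 in qa R'.
have [b [phb [bB' qb b0 rb]]] := antipode charK0 d_gt1 smoothC freeB' R' rB' qr.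
have bB : (b <= B)%MS by apply/(rich_axis R).
have ba : dot b pha = 0 by apply/(rich_axis R').
have [_ ab] := rich_centre_axis charK0 d_gt1 smoothC R' bB' qb isT.
have dec1 := dual_basis_dec (qg_basis qa qb qr ab a0 ba b0 ra rb).
have [|c1 nzc1 [phu qu]] := six_scale smoothC freeB R aB bB qa qb ab ba.
  by move=> t /(rich_axis R) e; rewrite {1}(dec1 t) e scale0r addr0.
have qb' := qg_scale smoothC nzc1 qb; set b' := c1 *: b in qb' qu; set phb' := _ *: phb in qb'.
have b'0 : dot b' ps = 0 by rewrite dotZ b0 mulr0.
have b'a : dot b' pha = 0 by rewrite dotZ ba mulr0.
have ab' : dot a phb' = 0 by rewrite dotZr ab mulr0.
have rb' : dot r phb' = 0 by rewrite dotZr rb mulr0.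
have b'B' : (b' <= B')%MS by apply/(rich_axis R').
have dec2 := dual_basis_dec (qg_basis qa qb' qr ab' a0 b'a b'0 ra rb').
have [|c2 nzc2 [phv qv]] := six_scale smoothC freeB' R' b'B' rB' qb' qr b'0 rb'.
  by move=> t /(rich_axis R') e; rewrite {1}(dec2 t) e scale0r add0r.
have qr' := qg_scale smoothC nzc2 qr; set r' := c2 *: r in qr' qv; set ps' := _ *: ps in qr'.
have vB' : ((b' + r')%R <= B')%MS by rewrite addmx_sub ?scalemx_sub.
have [_ av] := rich_centre_axis charK0 d_gt1 smoothC R' vB' qv isT.
have D : dual_basis a pha b' phb' r' ps'.
  apply: (qg_basis qa qb' qr') => //.
  - by rewrite dotZr a0 mulr0.
  - by rewrite dotZr b'0 mulr0.
  - by rewrite dotZ ra mulr0.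
  - by rewrite dotZ rb' mulr0.
apply: (configuration_absurd freeB R freeB' R' qa qb' qr' D _ _ qu qv av) => t.
  rewrite -(rich_axis R) dotZr; split=> [->|/eqP]; first by rewrite mulr0.
  by rewrite mulf_eq0 invr_eq0 (negPf nzc2) => /eqP.
by rewrite -(rich_axis R').
Qed.

(** Here r has order at least 10, so [large_axis] puts q on the axis of r. *)
Lemma off_line_five B r ps m s q ph (k : nat) : rich F B 5 r ps m s ->
  qg F q ph k -> (3 < k)%N -> ~~ (q <= B)%MS -> exists c, q = c *: r.
Proof.
move=> R qq k_gt3 nqB; apply: contrapT => np.
have qr := rich_qg R; have [rr _ m_gt1 _] := qr.
have m_gt5 : (5 < m)%N.
  by apply: (@leq_trans 10) => //; apply: dvdn_leq (ltnW m_gt1) (rich_even R erefl).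
case/negP: nqB; apply/(rich_axis R).
exact: (large_axis charK0 d_gt1 smoothC qr qq np (ltnW (ltnW m_gt5)) m_gt5 (ltnW k_gt3)).
Qed.

Lemma off_line_unique B n r ps m s q ph (k : nat) : row_free B -> rich F B n r ps m s ->
  qg F q ph k -> (3 < k)%N -> ~~ (q <= B)%MS -> exists c, q = c *: r.
Proof.
move=> freeB R; case: (rich_order R) => n45; rewrite n45 in R.
  exact: off_line_four freeB R.
exact: off_line_five R.
Qed.

End Geometry.

(** * Counting quasi-Galois points *)

Section SmallLists.
Variable T : eqType.
Implicit Types a b c x : T.

Lemma uniq3 a b c : a != b -> a != c -> b != c -> uniq [:: a; b; c].
Proof. by move=> ab ac bc; rewrite /= !inE negb_or ab ac bc. Qed.

Lemma mem2P x a b : x \in [:: a; b] <-> x = a \/ x = b.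
Proof.
rewrite !inE; split=> [/orP [] /eqP|[] ->]; by [left | right | rewrite eqxx ?orbT].
Qed.

Lemma mem3P x a b c : x \in [:: a; b; c] <-> [\/ x = a, x = b | x = c].
Proof.
rewrite !inE; split=> [/or3P [] /eqP|[] ->]; by [exact: Or31 | exact: Or32 | exact: Or33 | rewrite eqxx ?orbT].
Qed.
End SmallLists.

Section Counting.
Variables (K : closedFieldType).
Hypothesis charK0 : [pchar K] =i pred0.
Variables (d : nat) (F : {mpoly K[3]}).
Hypothesis d_gt1 : (1 < d)%N.
Hypothesis smoothC : smooth_plane_curve F d.
Implicit Types (u v w p q r t : 'rV[K]_3) (x y z k : K) (M N : 'M[K]_3) (ph ps : 'cV[K]_3) (o : option K).

Local Notation qg := (qg F).
Let qnz := qg_nz d_gt1 smoothC.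

Lemma Delta_mkP p (n : nat) : p != 0 -> (1 < n)%N -> Delta F n (mkP p) <-> exists ph, qg p ph n.
Proof. by move=> nzp n_gt1; apply: (DeltaP charK0 d_gt1 smoothC n_gt1 (mkP_space nzp)). Qed.

Lemma Delta_ge_mkP p (n : nat) : p != 0 -> (1 < n)%N ->
  Delta_ge F n (mkP p) <-> exists ph m, (n <= m)%N /\ qg p ph m.
Proof. by move=> nzp n_gt1; apply: (Delta_geP charK0 d_gt1 smoothC n_gt1 (mkP_space nzp)). Qed.

Lemma mkP_neq p q : p != 0 -> q != 0 -> ~ (exists k, q = k *: p) -> mkP p != mkP q.
Proof. by move=> nzp nzq np; apply/eqP => /(mkP_eq nzp nzq). Qed.

Lemma mkP_prop p q : p != 0 -> q != 0 -> (exists k, q = k *: p) -> mkP q = mkP p.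
Proof. by move=> nzp nzq e; apply/esym/mkP_eq. Qed.

Lemma card_mkP (L : seq 'rV[K]_3) (A : set (proj_point K)) : uniq (map (@mkP K) L) ->
  (forall v, v != 0 -> A (mkP v) <-> mkP v \in map (@mkP K) L) -> A #= `I_(size L).
Proof.
move=> uL AL; rewrite -(size_map (@mkP K)); apply: card_seq => // P.
by have [v nzv ->] := mkP_exists P; apply: AL.
Qed.

Section MutualPair.
Variables (p1 p2 r : 'rV[K]_3) (ph1 ph2 ps : 'cV[K]_3) (n m : nat).
Hypotheses (q1 : qg p1 ph1 n) (q2 : qg p2 ph2 n) (qr : qg r ps m) (n_dvd : (n %| m)%N).
Hypothesis D : dual_basis p1 ph1 p2 ph2 r ps.

Let n_gt1 : (1 < n)%N. Proof. by case: q1. Qed.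
Let n_le_m : (n <= m)%N.
Proof. by apply: dvdn_leq n_dvd; case: qr => _ _ /ltnW. Qed.
Let nz1 := qnz q1.
Let nz2 := qnz q2.
Let nzr := qnz qr.

Lemma basis_uniq : uniq [:: mkP p1; mkP p2; mkP r].
Proof.
case: D => [[d11 d12 d1s] [d21 d22 d2s] [r1 r2 rs]].
have n12 : mkP p1 != mkP p2.
  by apply: mkP_neq => //; apply: (not_prop d12); rewrite d22 oner_neq0.
have n1r : mkP p1 != mkP r.
  by apply: mkP_neq => //; apply: (not_prop d1s); rewrite rs oner_neq0.
have n2r : mkP p2 != mkP r.
  by apply: mkP_neq => //; apply: (not_prop d2s); rewrite rs oner_neq0.
exact: uniq3.
Qed.

Lemma vertex_in q : q != 0 -> [\/ exists k, q = k *: p1, exists k, q = k *: p2 | exists k, q = k *: r] ->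
  mkP q \in [:: mkP p1; mkP p2; mkP r].
Proof.
by move=> nzq [] e; apply/mem3P; [apply: Or31 | apply: Or32 | apply: Or33]; apply: mkP_prop.
Qed.

Lemma vertex_ge (k : nat) P : (1 < k <= n)%N -> P \in [:: mkP p1; mkP p2; mkP r] -> Delta_ge F k P.
Proof.
case/andP=> k_gt1 k_le /mem3P [] ->; apply/Delta_ge_mkP => //.
- by exists ph1, n.
- by exists ph2, n.
- by exists ps, m; split=> //; apply: leq_trans k_le n_le_m.
Qed.

Lemma vertex_pair P Q : P \in [:: mkP p1; mkP p2; mkP r] -> Q \in [:: mkP p1; mkP p2; mkP r] ->
  P <> Q -> G_pair F n P Q.
Proof.
case: D => [[d11 d12 d1s] [d21 d22 d2s] [r1 r2 rs]].
have gp := mutual_G_pair charK0 d_gt1 smoothC n_gt1; have nn := dvdnn n.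
move=> /mem3P [] -> /mem3P [] -> // _.
- exact: gp q1 q2 d12 d21.
- exact: gp q1 qr d1s r1.
- exact: gp q2 q1 d21 d12.
- exact: gp q2 qr d2s r2.
- exact: gp qr q1 r1 d1s.
- exact: gp qr q2 r2 d2s.
Qed.

End MutualPair.

Lemma mutual_third p1 ph1 p2 ph2 (n : nat) : qg p1 ph1 n -> qg p2 ph2 n ->
  dot p1 ph2 = 0 -> dot p2 ph1 = 0 ->
  exists r ps m, [/\ qg r ps m, (n %| m)%N & dual_basis p1 ph1 p2 ph2 r ps].
Proof.
move=> q1 q2 d12 d21.
have [r [ps [m [[qr dv r1 r2] [s1 s2 _]]]]] := third_qg charK0 d_gt1 smoothC q1 q2 d12 d21.
by exists r, ps, m; split=> //; apply: (qg_basis q1 q2 qr).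
Qed.

Section LargeOrder.
Variables (p1 p2 : 'rV[K]_3) (ph1 ph2 : 'cV[K]_3) (n : nat).
Hypotheses (q1 : qg p1 ph1 n) (q2 : qg p2 ph2 n) (np : ~ exists k, p2 = k *: p1).
Hypothesis n_ge6 : (6 <= n)%N.

(** A centre of order at least 3 other than the three vertices lies on all three
    axes, by [large_axis], and these have no common point. *)
Lemma large_count : [/\ Delta_ge F n #= `I_3,
    forall P Q, Delta_ge F n P -> Delta_ge F n Q -> P <> Q -> G_pair F n P Q
  & Delta_ge F 3 #= `I_3].
Proof.
have n_gt3 : (3 < n)%N by apply: leq_trans n_ge6.
have n_gt2 := ltnW n_gt3; have n_gt1 := ltnW n_gt2.
have np' : ~ exists k, p1 = k *: p2 by move/(prop_sym (qnz q1)).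
have d21 := large_axis charK0 d_gt1 smoothC q1 q2 np n_gt3 n_ge6 n_gt2.
have d12 := large_axis charK0 d_gt1 smoothC q2 q1 np' n_gt3 n_ge6 n_gt2.
have [r [ps [m [qr dv D]]]] := mutual_third q1 q2 d12 d21.
have m_ge6 : (6 <= m)%N.
  by apply: leq_trans n_ge6 _; apply: dvdn_leq dv; case: qr => _ _ /ltnW.
have all3 P : Delta_ge F 3 P <-> P \in [:: mkP p1; mkP p2; mkP r].
  split; last by apply: (vertex_ge q1 q2 qr dv).
  have [q nzq ->] := mkP_exists P; case/(Delta_ge_mkP (n := 3) nzq isT) => ph [k [k_gt2 qq]].
  apply: (vertex_in q1 q2 qr nzq); apply: contrapT => no.
  have no1 : ~ exists k, q = k *: p1 by move=> e; apply: no; apply: Or31.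
  have no2 : ~ exists k, q = k *: p2 by move=> e; apply: no; apply: Or32.
  have nor : ~ exists k, q = k *: r by move=> e; apply: no; apply: Or33.
  have e1 := large_axis charK0 d_gt1 smoothC q1 qq no1 n_gt3 n_ge6 k_gt2.
  have e2 := large_axis charK0 d_gt1 smoothC q2 qq no2 n_gt3 n_ge6 k_gt2.
  have er := large_axis charK0 d_gt1 smoothC qr qq nor (ltnW (ltnW m_ge6)) m_ge6 k_gt2.
  by move: nzq; rewrite (dual_basis_dec D q) e1 e2 er !scale0r !addr0 eqxx.
have alln P : Delta_ge F n P <-> P \in [:: mkP p1; mkP p2; mkP r].
  split; last by apply: (vertex_ge q1 q2 qr dv); rewrite n_gt1 leqnn.
  have [q nzq ->] := mkP_exists P; case/(Delta_ge_mkP nzq n_gt1) => ph [k [k_ge qq]].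
  by apply/all3/(Delta_ge_mkP (n := 3) nzq isT); exists ph, k; split=> //; apply: leq_trans k_ge.
have u3 := basis_uniq q1 q2 qr D.
split; [exact: card_seq u3 alln | | exact: card_seq u3 all3].
by move=> P Q /alln P3 /alln Q3; apply: (vertex_pair q1 q2 qr dv D).
Qed.
End LargeOrder.

Section Rich.
Variables (p q : 'rV[K]_3) (n m : nat) (r : 'rV[K]_3) (ps : 'cV[K]_3) (s : seq (option K)).
Hypotheses (nzp : p != 0) (nzq : q != 0) (np : ~ exists k, q = k *: p).
Hypothesis R : rich F (line2 p q) n r ps m s.
Let l := line_through (mkP p) (mkP q).
Let B := line2 p q.
Let freeB : row_free B. Proof. exact: line2_free. Qed.

Let n_gt3 : (3 < n)%N. Proof. by case: (rich_order R) => ->. Qed.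
Let n_gt1 : (1 < n)%N. Proof. exact: ltnW (ltnW n_gt3). Qed.
Let qr := rich_qg R.
Let nzr := qnz qr.
Let n_le_m : (n <= m)%N.
Proof. by apply: dvdn_leq (rich_dvd R); case: qr => _ _ /ltnW. Qed.

Let pt o := mkP (pe B o).

Let lP v : v != 0 -> l (mkP v) <-> (v <= B)%MS.
Proof. exact: line_throughP. Qed.

Let rNB : ~~ (r <= B)%MS.
Proof. by apply/negP => /(rich_axis R); rewrite (rich_pole R) => /eqP; rewrite oner_eq0. Qed.

Let uniq_pt : uniq (map pt s).
Proof.
rewrite map_inj_uniq; first exact: rich_uniq R.
move=> o o' /(mkP_eq (pe_nz freeB o) (pe_nz freeB o')) [k e].
by apply/esym/(pe_inj freeB e).
Qed.

Let ptP v : v != 0 -> (Delta F n (mkP v) /\ l (mkP v)) <-> mkP v \in map pt s.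
Proof.
move=> nzv; split=> [[/(Delta_mkP nzv n_gt1) [ph qv] /(lP nzv) vB]|/mapP [o os e]].
  have [o [c [os nzc vE]]] := rich_all R vB qv n_gt3.
  by apply/mapP; exists o => //; apply: mkP_prop => //; [exact: pe_nz | exists c].
have [ph [qo _]] := rich_centre R os; have nzo := qnz qo.
rewrite e /pt; split; [by apply/Delta_mkP => //; exists ph | apply/lP => //; exact: pe_in].
Qed.

Lemma rich_line_count : Delta F n `&` l #= `I_(size s).
Proof.
rewrite -(size_map pt); apply: card_seq uniq_pt _ => P.
by have [v nzv ->] := mkP_exists P; apply: ptP.
Qed.

Lemma rich_off_count (k : nat) : (3 < k <= m)%N -> Delta_ge F k `&` ~` l #= `I_1.
Proof.
case/andP=> k_gt3 k_le; have k_gt1 := ltnW (ltnW k_gt3).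
apply: (@card_mkP [:: r]) => // v nzv; rewrite inE; split.
  case=> /(Delta_ge_mkP nzv k_gt1) [ph [j [j_ge qv]]] nl; apply/eqP/mkP_prop => //.
  apply: (off_line_unique charK0 d_gt1 smoothC freeB R qv (leq_trans k_gt3 j_ge)).
  by apply/negP => /(lP nzv).
move=> /eqP ->; split; first by apply/Delta_ge_mkP => //; exists ps, m.
by move/(lP nzr); apply/negP.
Qed.

(** The point r is the only candidate off the line, and it counts when its order
    is n itself. *)
Lemma rich_total : Delta F n #= `I_(size s) /\ n != m \/ Delta F n #= `I_(size s).+1 /\ n = m.
Proof.
have cls v : v != 0 -> Delta F n (mkP v) -> mkP v \in map pt s \/ (mkP v = mkP r /\ n = m).
  move=> nzv Dv; have [vB|vB] := boolP (v <= B)%MS.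
    by left; apply/ptP => //; split=> //; apply/lP.
  right; case/(Delta_mkP nzv n_gt1): Dv => ph qv.
  have [c vE] := off_line_unique charK0 d_gt1 smoothC freeB R qv n_gt3 vB.
  split; first by apply: mkP_prop => //; exists c.
  have nzc : c != 0 by apply: contraNneq nzv => c0; rewrite vE c0 scale0r.
  have qv' := qg_scale smoothC nzc qr; rewrite -vE in qv'.
  by have [] := qg_unique charK0 d_gt1 smoothC qv qv'.
have [nm|nm] := eqVneq n m; [right | left]; split=> //.
  rewrite -(size_map pt); apply: (@card_seq _ _ (mkP r :: map pt s)) => /=.
    rewrite uniq_pt andbT; apply/negP => rs.
    by have [_ /(lP nzr)] := (ptP nzr).2 rs; apply/negP.
  move=> P; have [v nzv ->] := mkP_exists P; rewrite inE; split.
    by case/(cls v nzv) => [->|[-> _]]; rewrite ?eqxx ?orbT.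
  case/orP=> [/eqP ->|/(ptP nzv) []//].
  by apply/Delta_mkP => //; exists ps; rewrite nm.
rewrite -(size_map pt); apply: card_seq uniq_pt _ => P.
have [v nzv ->] := mkP_exists P; split; last by case/(ptP nzv).
by case/(cls v nzv) => // -[_ e]; rewrite e eqxx in nm.
Qed.
End Rich.

Lemma mutual_line_count p1 ph1 p2 ph2 (n : nat) : qg p1 ph1 n -> qg p2 ph2 n -> (2 < n)%N ->
  ~ (exists k, p2 = k *: p1) ->
  (forall t ph (m : nat), (t <= line2 p1 p2)%MS -> qg t ph m -> (2 < m)%N ->
        (exists k, t = k *: p1) \/ exists k, t = k *: p2) ->
  Delta F n `&` line_through (mkP p1) (mkP p2) #= `I_2.
Proof.
move=> q1 q2 n_gt2 np all; have n_gt1 := ltnW n_gt2; have nz1 := qnz q1; have nz2 := qnz q2.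
apply: (@card_mkP [:: p1; p2]); first by rewrite /= inE andbT mkP_neq.
move=> v nzv; split.
  case=> /(Delta_mkP nzv n_gt1) [ph qv] /(line_throughP nz1 nz2 nzv) vB.
  by case: (all _ _ _ vB qv n_gt2) => e; apply/mem2P; [left | right]; apply: mkP_prop.
case/mem2P=> ->; split.
- by apply/Delta_mkP => //; exists ph1.
- by apply/line_throughP => //; apply: line2_l.
- by apply/Delta_mkP => //; exists ph2.
- by apply/line_throughP => //; apply: line2_r.
Qed.

(** If any two points of order n lie on each other's axes, a third one is the third
    vertex of the triangle. *)
Lemma poor_total p1 ph1 p2 ph2 (n : nat) : qg p1 ph1 n -> qg p2 ph2 n -> (1 < n)%N ->
  ~ (exists k, p2 = k *: p1) ->
  (forall p ph q ph', qg p ph n -> qg q ph' n -> ~ (exists k, q = k *: p) ->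
     dot q ph = 0 /\ dot p ph' = 0) ->
  Delta F n #= `I_2 \/ Delta F n #= `I_3.
Proof.
move=> q1 q2 n_gt1 np mut; have nz1 := qnz q1; have nz2 := qnz q2.
have [d21 d12] := mut _ _ _ _ q1 q2 np.
have [r [ps [m [qr dv D]]]] := mutual_third q1 q2 d12 d21.
have nzr := qnz qr; have u3 := basis_uniq q1 q2 qr D.
have cls v : v != 0 -> Delta F n (mkP v) -> mkP v \in [:: mkP p1; mkP p2; mkP r].
  move=> nzv /(Delta_mkP nzv n_gt1) [ph qv]; apply: (vertex_in q1 q2 qr nzv).
  apply: contrapT => no.
  have no1 : ~ exists k, v = k *: p1 by move=> e; apply: no; apply: Or31.
  have no2 : ~ exists k, v = k *: p2 by move=> e; apply: no; apply: Or32.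
  have [v1 _] := mut _ _ _ _ q1 qv no1; have [v2 _] := mut _ _ _ _ q2 qv no2.
  apply: no; apply: Or33; exists (dot v ps).
  by rewrite {1}(dual_basis_dec D v) v1 v2 !scale0r !add0r.
have in12 P : P \in [:: mkP p1; mkP p2] -> Delta F n P.
  by case/mem2P=> ->; apply/Delta_mkP => //; [exists ph1 | exists ph2].
have [rn|rn] := EM (Delta F n (mkP r)); [right | left].
  apply: (card_seq u3) => P; split; last first.
    by case/mem3P=> -> //; apply: in12; apply/mem2P; [left | right].
  by have [v nzv ->] := mkP_exists P; apply: cls.
have u2 : uniq [:: mkP p1; mkP p2].
  by apply: subseq_uniq u3; apply: (prefix_subseq [:: mkP p1; mkP p2] [:: mkP r]).
apply: (card_seq u2) => P; split; last exact: in12.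
have [v nzv ->] := mkP_exists P => Dv; apply/mem2P.
have := cls v nzv Dv; case/mem3P=> e; [by left | by right | by case: rn; rewrite -e].
Qed.

Lemma total_cases p1 ph1 p2 ph2 (n : nat) : qg p1 ph1 n -> qg p2 ph2 n -> (3 < n)%N ->
  ~ (exists k, p2 = k *: p1) ->
  (Delta F n #= `I_2 \/ Delta F n #= `I_3) \/
  (exists p q r ps m s, [/\ p != 0, q != 0, ~ (exists k, q = k *: p) & rich F (line2 p q) n r ps m s]).
Proof.
move=> q1 q2 n_gt3 np.
have [|no] := EM (exists p q r ps m s, [/\ p != 0, q != 0, ~ (exists k, q = k *: p) & rich F (line2 p q) n r ps m s]).
  by right.
left; apply: (poor_total q1 q2 (ltnW (ltnW n_gt3)) np) => p ph q ph' qp qq npq.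
case: (pair_cases charK0 d_gt1 smoothC qp qq npq n_gt3 n_gt3) => [[] //|[_ [r [ps [m [s R]]]]]].
by case: no; exists p, q, r, ps, m, s; split=> //; [apply: qnz qp | apply: qnz qq].
Qed.

End Counting.

Theorem theorem3p10 (K : closedFieldType) (charK0 : [pchar K] =i pred0)
    (d : nat) (d_ge4 : (4 <= d)%N)
    (F : {mpoly K[3]}) (smoothC : smooth_plane_curve F d)
    (n : nat) (n_ge4 : (4 <= n)%N)
    (P1 P2 : proj_point K) (P1P2 : P1 <> P2)
    (P1n : Delta F n P1) (P2n : Delta F n P2) :
  let l := line_through P1 P2 in
  [/\ exists P1', l P1' /\ G_pair F n P1 P1',
      (6 <= n)%N ->
        [/\ Delta_ge F n #= `I_3,
            forall P Q, Delta_ge F n P -> Delta_ge F n Q -> P <> Q ->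
              G_pair F n P Q
          & Delta_ge F 3 #= `I_3],
      n = 5%N ->
        [/\ Delta F 5 `&` l #= `I_2 \/ Delta F 5 `&` l #= `I_12,
            Delta F 5 `&` l #= `I_12 ->
              Delta_ge F 5 `&` ~` l #= `I_1 /\
              Delta_ge F 10 `&` ~` l #= `I_1
          & [\/ Delta F 5 #= `I_2, Delta F 5 #= `I_3 | Delta F 5 #= `I_12]]
    & n = 4%N ->
        [/\ Delta F 4 `&` l #= `I_2 \/ Delta F 4 `&` l #= `I_6,
            Delta F 4 `&` l #= `I_6 -> Delta_ge F 4 `&` ~` l #= `I_1
          & [\/ Delta F 4 #= `I_2, Delta F 4 #= `I_3, Delta F 4 #= `I_6
              | Delta F 4 #= `I_7]]].
Proof.
have d_gt1 : (1 < d)%N := ltnW (ltnW d_ge4).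
have n_gt2 := ltnW n_ge4; have n_gt1 := ltnW n_gt2.
have clash (A : set (proj_point K)) i j : A #= `I_i -> A #= `I_j -> i = j.
  by move=> /card_esym Ai Aj; apply: card_eq_II (card_eq_trans Ai Aj).
have [p1 nz1 P1E] := mkP_exists P1; have [p2 nz2 P2E] := mkP_exists P2.
subst P1 P2; move=> l.
have [ph1 q1] := (Delta_mkP charK0 d_gt1 smoothC nz1 n_gt1).1 P1n.
have [ph2 q2] := (Delta_mkP charK0 d_gt1 smoothC nz2 n_gt1).1 P2n.
have np : ~ exists k, p2 = k *: p1 by move/(mkP_eq nz1 nz2).
have freeB := line2_free nz1 np.
have lP v : v != 0 -> l (mkP v) <-> (v <= line2 p1 p2)%MS := @line_throughP _ p1 p2 v nz1 nz2.
have cases := pair_cases charK0 d_gt1 smoothC q1 q2 np n_ge4 n_ge4.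
have onl : Delta F n `&` l #= `I_2 \/ exists r ps m s, rich F (line2 p1 p2) n r ps m s.
  case: cases => [[d21 d12 all]|[_ ex]]; last by right.
  by left; apply: (mutual_line_count charK0 d_gt1 smoothC q1 q2 n_gt2 np all).
have total := total_cases charK0 d_gt1 smoothC q1 q2 n_ge4 np.
split.
- case: cases => [[d21 d12 _]|[_ [r [ps [m [s R]]]]]].
    exists (mkP p2); split; first by apply/lP => //; apply: line2_r.
    exact: (mutual_G_pair charK0 d_gt1 smoothC n_gt1 (dvdnn n) (dvdnn n) q1 q2 d12 d21).
  have [w [phw [wB qw w0 d1w]]] := antipode charK0 d_gt1 smoothC freeB R (line2_l p1 p2) q1.
  exists (mkP w); split; first by apply/lP => //; apply: (qg_nz d_gt1 smoothC qw).
  exact: (mutual_G_pair charK0 d_gt1 smoothC n_gt1 (dvdnn n) (dvdnn n) q1 qw d1w w0).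
- exact: (large_count charK0 d_gt1 smoothC q1 q2 np).
- move=> n5; rewrite n5 in onl total; split.
  + case: onl => [|[r [ps [m [s R]]]]]; [by left | right].
    by case: (rich_size R) => -[szs // _]; rewrite -szs; apply: (rich_line_count charK0 d_gt1 smoothC nz1 nz2 np R).
  + move=> c12; case: onl => [/(clash _ _ _ c12) //|[r [ps [m [s R]]]]].
    have m_ge10 : (10 <= m)%N.
      by have [_ _ /ltnW m_gt0 _] := rich_qg R; apply: dvdn_leq m_gt0 (rich_even R erefl).
    split; apply: (rich_off_count charK0 d_gt1 smoothC nz1 nz2 np R); rewrite /= ?m_ge10 //.
    exact: leq_trans m_ge10.
  + case: total => [[c|c]|[p [q [r [ps [m [s [nzp nzq npq R]]]]]]]]; [exact: Or31 | exact: Or32 | apply: Or33].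
    have szs : size s = 12%N by case: (rich_size R) => -[].
    case: (rich_total charK0 d_gt1 smoothC nzp nzq npq R) => -[]; first by rewrite szs.
    by move=> _ m5; have := rich_even R erefl; rewrite -m5.
- move=> n4; rewrite n4 in onl total; split.
  + case: onl => [|[r [ps [m [s R]]]]]; [by left | right].
    by case: (rich_size R) => -[szs // _]; rewrite -szs; apply: (rich_line_count charK0 d_gt1 smoothC nz1 nz2 np R).
  + move=> c6; case: onl => [/(clash _ _ _ c6) //|[r [ps [m [s R]]]]].
    apply: (rich_off_count charK0 d_gt1 smoothC nz1 nz2 np R).
    by have [_ _ /ltnW m_gt0 _] := rich_qg R; apply: dvdn_leq m_gt0 (rich_dvd R).
  + case: total => [[c|c]|[p [q [r [ps [m [s [nzp nzq npq R]]]]]]]]; [exact: Or41 | exact: Or42 | ].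
    have szs : size s = 6%N by case: (rich_size R) => -[].
    by case: (rich_total charK0 d_gt1 smoothC nzp nzq npq R); rewrite szs => -[c _]; [apply: Or43 | apply: Or44].
Qed.
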